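(* Let $$g=\begin{pmatrix}1&0&0&0\\0&1&0&0\\\sqrt3&\sqrt5&1&\sqrt2\\0&0&0&1\end{pmatrix}$$ and $X=\mathbb{C}^2/\Lambda(g)$. Then the horizontal foliation of $X$ is uniquely ergodic, but the geodesic flow $Ra_t(X,\omega_0)\in\mathrm{Kah}(\mathbb{T}^4)$ is divergent, i.e. it leaves every compact subset of $\mathrm{Kah}(\mathbb{T}^4)$ as $t\to+\infty$.
   Context: Identify $\mathbb{C}^2$ with $\mathbb{R}^4$ by $(x_1+iy_1,x_2+iy_2)\mapsto(x_1,y_1,x_2,y_2)$. For $g\in\mathrm{SL}(4,\mathbb{R})$, $\Lambda(g)\subset\mathbb{C}^2$ is the lattice generated by the rows of $g$; the torus $\mathbb{C}^2/\Lambda(g)$ carries the standard Kähler form $\omega_0=dx_1\wedge dy_1+dx_2\wedge dy_2$. The moduli space of flat Kähler structures is $\mathrm{Kah}(\mathbb{T}^4)=\mathrm{SL}(4,\mathbb{Z})\backslash\mathrm{SL}(4,\mathbb{R})/\mathrm{U}(2)$ with the quotient topology, the torus $(\mathbb{C}^2/\Lambda(g),\omega_0)$ corresponding to the class of $g$. The geodesic flow is $Ra_t(\mathbb{C}^2/\Lambda(g),\omega_0)=(\mathbb{C}^2/\Lambda(ga_t),\omega_0)$, where $a_t=\mathrm{diag}(e^{-t},e^{t},e^{-t},e^{t})$. The horizontal foliation of $X$ has as leaves the images of the real planes $\{y_1=c_1,y_2=c_2\}$. A transverse measure is a measure assigning non-negative numbers to smooth 2-dimensional submanifolds transverse to the leaves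 (nonzero, countably additive, finite on compact transversals), absolutely continuous with respect to 2-dimensional Lebesgue measure, and invariant under isotopies preserving each leaf. The foliation is uniquely ergodic if it has only one transverse measure up to a nonzero scalar. *)

(* Defs.v *)
From HB Require Import structures.
From mathcomp Require Import all_boot all_order all_algebra generic_quotient.
From mathcomp Require Import complex spectral.
From mathcomp Require Import all_classical all_reals all_analysis.
Set Implicit Arguments.
Unset Strict Implicit.
Unset Printing Implicit Defensive.
Import Order.TTheory GRing.Theory Num.Theory.
Import numFieldNormedType.Exports.
Local Open Scope classical_set_scope.
Local Open Scope complex_scope.
Local Open Scope ring_scope.

(* C^2 is identified with R^4 = 'rV[R]_4 by
   (x_1 + i y_1, x_2 + i y_2) |-> (x_1, y_1, x_2, y_2), so that coordinates
   0 and 2 are the x_i and coordinates 1 and 3 are the y_i. *)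
Definition x_coord (j : 'I_2) : 'I_4 := inord j.*2.
Definition y_coord (j : 'I_2) : 'I_4 := inord j.*2.+1.

Definition to_C2 {R : realType} (v : 'rV[R]_4) : 'rV[R[i]]_2 :=
  \row_j (v 0 (x_coord j) +i* v 0 (y_coord j)).

Definition SL4 (R : realType) : Type := [set m : 'M[R]_4 | \det m = 1].
HB.instance Definition _ (R : realType) := Topological.on (SL4 R).

Definition SL4_of {R : realType} (m : 'M[R]_4) (detm : \det m = 1) : SL4 R :=
  exist _ m (mem_set detm).

Lemma SL4_det (R : realType) (g : SL4 R) : \det (set_val g) = 1.
Proof. by have := set_valP g. Qed.

Section Kah.
Variable R : realType.
Implicit Types g h : SL4 R.

Definition SL4Z (c : 'M[R]_4) : Prop :=
  exists2 z : 'M[int]_4, \det z = 1 & c = map_mx intr z.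

(* Real 4x4 matrices acting on row vectors of C^2 = R^4 as a unitary matrix *)
Definition U2 (k : 'M[R]_4) : Prop :=
  exists2 u : 'M[R[i]]_2,
    u \is unitarymx & forall v : 'rV[R]_4, to_C2 (v *m k) = to_C2 v *m u.

Definition kah_eq g h : bool :=
  `[< exists c k, [/\ SL4Z c, U2 k & set_val h = c *m set_val g *m k] >].

Lemma SL4Z_det c : SL4Z c -> \det c = 1.
Proof. by move=> [z dz ->]; rewrite det_map_mx dz. Qed.

Lemma kah_eq_refl : reflexive kah_eq.
Proof.
move=> g; apply/asboolP; exists 1%:M, 1%:M; split.
- by exists 1%:M; rewrite ?det1 ?map_mx1.
- exists 1%:M; first by apply/unitarymxP; rewrite mul1mx trmx1 map_mx1.
  by move=> v; rewrite !mulmx1.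
- by rewrite mul1mx mulmx1.
Qed.

Lemma kah_eq_trans : transitive kah_eq.
Proof.
move=> h g f /asboolP[c [k [[z dz ->] [u uu ku] gh]]].
move=> /asboolP[c' [k' [[z' dz' ->] [u' uu' ku'] hf]]].
apply/asboolP; exists (map_mx intr z' *m map_mx intr z), (k *m k'); split.
- by exists (z' *m z); rewrite ?map_mxM // det_mulmx dz dz' mulr1.
- exists (u *m u'); first exact: mul_unitarymx.
  by move=> v; rewrite mulmxA ku' ku mulmxA.
- by rewrite hf gh !mulmxA.
Qed.

Lemma kah_eq_sym : symmetric kah_eq.
Proof.
suff H g h : kah_eq g h -> kah_eq h g by move=> g h; apply/idP/idP; exact: H.
move=> /asboolP[c [k [cZ [u uu ku] gh]]].
have [z dz cz] := cZ.
have zu : z \in unitmx by rewrite unitmxE dz unitr1.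
have dk : \det k = 1.
  by have := SL4_det h; rewrite gh !det_mulmx (SL4Z_det cZ) SL4_det !mul1r.
have kun : k \in unitmx by rewrite unitmxE dk unitr1.
have uun : u \in unitmx by exact: unitarymx_unit.
apply/asboolP; exists (map_mx intr (invmx z)), (invmx k); split.
- by exists (invmx z) => //; rewrite det_inv dz invr1.
- exists (invmx u).
    by rewrite invmx_unitary // trmxC_unitary.
  by move=> v; rewrite -[in RHS](mulmxKV kun v) ku mulmxK.
- have zz : map_mx intr (invmx z) *m c = 1%:M.
    by rewrite cz -map_mxM mulVmx // map_mx1.
  by rewrite gh !mulmxA zz mul1mx mulmxK.
Qed.

Canonical kah_equiv :=
  EquivRel kah_eq kah_eq_refl kah_eq_sym kah_eq_trans.

(* The moduli space SL(4,Z) \ SL(4,R) / U(2) with the quotient topology *)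
Definition Kah : Type := quotient_topology {eq_quot kah_eq}%qT.
HB.instance Definition _ := Topological.on Kah.

(* The point of Kah given by (C^2 / Lambda(g), omega_0) *)
Definition kah_point g : Kah := (\pi_({eq_quot kah_eq}) g)%qT.

Definition a_flow (t : R) : 'M[R]_4 :=
  diag_mx (\row_j if odd j then expR t else expR (- t)).

Lemma det_a_flow t : \det (a_flow t) = 1.
Proof.
rewrite /a_flow det_diag !big_ord_recl big_ord0 !mxE /= mulr1.
have e : expR (- t) * expR t = 1 by rewrite -expRD addNr expR0.
by rewrite mulrA e mul1r.
Qed.

Lemma det_mul_a_flow g t : \det (set_val g *m a_flow t) = 1.
Proof.
by rewrite det_mulmx SL4_det det_a_flow mulr1.
Qed.

(* a_t does not normalise U(2), so this is a function of g and not of the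
   class of g in Kah *)
Definition Ra (t : R) g : Kah := kah_point (SL4_of (det_mul_a_flow g t)).

Definition divergent (p : R -> Kah) : Prop :=
  forall K : set Kah, compact K -> \forall t \near +oo, ~ K (p t).

End Kah.

Section smooth.
Variables (R : realType) (E F : normedModType R).

(* C^infinity on the open set D: every iterated directional derivative is
   Frechet differentiable at every point of D *)
Definition smooth_on (D : set E) (f : E -> F) : Prop :=
  forall (vs : seq E) (e : E), D e ->
    differentiable (foldr (fun v h => 'D_v h) f vs) e.

End smooth.

Section torus.
Variables (R : realType) (g : SL4 R).

Definition lattice : set 'rV[R]_4 :=
  [set map_mx intr n *m set_val g | n in [set: 'rV[int]_4]].

Definition torus_eq (v w : 'rV[R]_4) : bool := `[< lattice (v - w) >].

Lemma torus_eq_refl : reflexive torus_eq.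
Proof.
by move=> v; apply/asboolP; exists 0 => //; rewrite map_mx0 mul0mx subrr.
Qed.

Lemma torus_eq_sym : symmetric torus_eq.
Proof.
suff H v w : torus_eq v w -> torus_eq w v.
  by move=> v w; apply/idP/idP; exact: H.
move=> /asboolP[n _ nE]; apply/asboolP; exists (- n) => //.
by rewrite map_mxN mulNmx nE opprB.
Qed.

Lemma torus_eq_trans : transitive torus_eq.
Proof.
move=> v u w /asboolP[n _ nE] /asboolP[m _ mE]; apply/asboolP.
exists (n + m) => //.
by rewrite map_mxD mulmxDl nE mE addrA subrK.
Qed.

Canonical torus_equiv :=
  EquivRel torus_eq torus_eq_refl torus_eq_sym torus_eq_trans.

(* X = C^2 / Lambda(g) *)
Definition torus : Type := quotient_topology {eq_quot torus_eq}%qT.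
HB.instance Definition _ := Topological.on torus.
HB.instance Definition _ := Pointed.on torus.

Definition pr (v : 'rV[R]_4) : torus := (\pi_({eq_quot torus_eq}) v)%qT.

Definition horizontal (v : 'rV[R]_4) : Prop :=
  forall j : 'I_2, v 0 (y_coord j) = 0.

Definition leaf (L : set torus) : Prop :=
  exists c : 'I_2 -> R, L = pr @` [set v : 'rV[R]_4 | forall j, v 0 (y_coord j) = c j].

(* A map into X is smooth on a (not necessarily open) set D when near each
   point of D it agrees on D with the projection of a smooth map into R^4. *)
Definition smooth_into (E : normedModType R) (D : set E) (f : E -> torus) :=
  forall e, D e -> exists (N : set E) (F : E -> 'rV[R]_4),
    [/\ open N, N e, smooth_on N F & forall e', (D `&` N) e' -> pr (F e') = f e'].

(* pr \o phi is a smooth parametrization, with domain the open set V of the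
   plane, of a relatively open part of S: an injective immersion which is a
   homeomorphism onto its image. *)
Definition parametrization (S : set torus)
    (V : set (R * R)) (phi : R * R -> 'rV[R]_4) : Prop :=
  [/\ open V, smooth_on V phi, (forall q, V q -> injective ('d phi q)),
      set_inj V (pr \o phi)
    & forall W, open W -> W `<=` V ->
        exists2 U : set torus, open U & (pr \o phi) @` W = S `&` U].

Definition submanifold (S : set torus) : Prop :=
  forall p, S p -> exists V phi,
    parametrization S V phi /\ ((pr \o phi) @` V) p.

Definition transversal (S : set torus) : Prop :=
  submanifold S /\
  forall V phi q, parametrization S V phi -> V q ->
    forall v : 'rV[R]_4, exists w h, horizontal h /\ v = 'd phi q w + h.

(* f restricts to a diffeomorphism from S onto the submanifold f @` S *)
Definition embeds (S : set torus) (f : torus -> torus) : Prop :=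
  set_inj S f /\
  forall V phi q, parametrization S V phi -> V q ->
    exists V' phi', [/\ V' `<=` V, V' q, parametrization (f @` S) V' phi'
      & forall q', V' q' -> pr (phi' q') = f (pr (phi q'))].

(* Smooth isotopies of S through transversals, each leaf being preserved *)
Definition leafwise_isotopy (S : set torus) (H : R -> torus -> torus) : Prop :=
  [/\ forall V phi, parametrization S V phi ->
        @smooth_into (R * (R * R))%type [set sq | 0 <= sq.1 <= 1 /\ V sq.2]
          (fun sq => H sq.1 (pr (phi sq.2))),
      forall p, S p -> H 0 p = p,
      forall s, 0 <= s <= 1 -> embeds S (H s) /\ transversal (H s @` S)
    & forall L s p, leaf L -> 0 <= s <= 1 -> S p -> L p -> L (H s p)].

Definition null_in (S A : set torus) : Prop :=
  forall V phi, parametrization S V phi ->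
    (lebesgue_measure \x lebesgue_measure)%E.-negligible
      (V `&` (pr \o phi) @^-1` A).

Definition transversal_borel (A : set torus) : Prop :=
  <<s (@open torus) >> A /\ exists2 S, transversal S & A `<=` S.

Lemma submanifold0 : submanifold set0.
Proof. by []. Qed.

Lemma transversal0 : transversal set0.
Proof.
split=> // V phi q [oV _ _ _ /(_ V oV)] [//|U _]; rewrite set0I => V0 Vq.
have : ((pr \o phi) @` V) (pr (phi q)) by exists q.
by rewrite V0.
Qed.

Lemma transversal_borel0 : transversal_borel set0.
Proof.
split; first exact: (@measurable0 _ (g_sigma_algebraType (@open torus))).
by exists set0 => //; exact: transversal0.
Qed.

Lemma transversal_borelI : setI_closed transversal_borel.
Proof.
move=> A B [mA [S tS AS]] [mB _]; split.
  exact: (@measurableI _ (g_sigma_algebraType (@open torus)) A B).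
by exists S => // p [/AS].
Qed.

Lemma transversal_borelD : semi_setD_closed transversal_borel.
Proof.
move=> A B [mA [S tS AS]] [mB _]; exists [set A `\` B]; split.
- exact: finite_set1.
- move=> _ ->; split; last by exists S => // p [/AS].
  exact: (@measurableD _ (g_sigma_algebraType (@open torus)) A B).
- by rewrite bigcup_set1.
- by move=> C D -> ->.
Qed.

(* The torus with the semiring of Borel subsets of transversals: a measure on
   it is the same thing as a family of Borel measures on the transversals that
   agree on their common Borel subsets. *)
Definition transverse_sets : Type := torus.
HB.instance Definition _ := Pointed.on transverse_sets.
HB.instance Definition _ := @isSemiRingOfSets.Build default_measure_display
  transverse_sets transversal_borel
  transversal_borel0 transversal_borelI transversal_borelD.

Local Open Scope ereal_scope.

Record transverse_measure (mu : {measure set transverse_sets -> \bar R}) : Prop := {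
  tm_nonzero : exists A : set transverse_sets, measurable A /\ mu A != 0 ;
  tm_finite : forall S K : set torus,
    transversal S -> compact K -> K `<=` S -> mu K < +oo ;
  tm_ac : forall S A : set torus,
    transversal S -> A `<=` S -> transversal_borel A -> null_in S A ->
    mu A = 0 ;
  tm_invariant : forall (S A : set torus) (H : R -> torus -> torus),
    transversal S -> leafwise_isotopy S H ->
    A `<=` S -> transversal_borel A -> mu (H 1%R @` A) = mu A }.

Definition uniquely_ergodic : Prop :=
  exists2 mu : {measure set transverse_sets -> \bar R}, transverse_measure mu &
    forall nu : {measure set transverse_sets -> \bar R}, transverse_measure nu ->
      exists2 c : R, c != 0%R &
        forall A : set transverse_sets, measurable A -> nu A = c%:E * mu A.

End torus.

Section example.
Variable R : realType.

Definition example_rows : seq (seq R) :=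
  [:: [:: 1; 0; 0; 0];
      [:: 0; 1; 0; 0];
      [:: Num.sqrt 3; Num.sqrt 5; 1; Num.sqrt 2];
      [:: 0; 0; 0; 1] ].

Definition example_mx : 'M[R]_4 :=
  \matrix_(i, j) nth 0 (nth [::] example_rows i) j.

Lemma det_example : \det example_mx = 1.
Proof.
rewrite (expand_det_row _ ord0) !big_ord_recl big_ord0 !mxE /= !mul0r !addr0.
rewrite mul1r /cofactor /= expr0 mul1r.
rewrite (expand_det_row _ ord0) !big_ord_recl big_ord0 !mxE /= !mul0r !addr0.
rewrite mul1r /cofactor /= expr0 mul1r.
rewrite (expand_det_row _ ord_max) !big_ord_recl big_ord0 !mxE /=.
by rewrite mul0r add0r addr0 mul1r /cofactor det_mx11 !mxE /= expr2 mulrNN !mulr1.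
Qed.

Definition example : SL4 R := SL4_of det_example.

End example.

(* Main.v *)
Require Import Defs.
From HB Require Import structures.
From mathcomp Require Import all_boot all_order all_algebra generic_quotient.
From mathcomp Require Import complex spectral.
From mathcomp Require Import all_classical all_reals all_analysis measurable_realfun unstable.
From mathcomp Require Import ring lra zify.
Set Implicit Arguments.
Unset Strict Implicit.
Unset Printing Implicit Defensive.
Import Order.TTheory GRing.Theory Num.Theory.
Import numFieldNormedType.Exports.
Local Open Scope classical_set_scope.
Local Open Scope ring_scope.

(** Write [Y] for the coordinates (y_1, y_2), which are constant on leaves up to
    the group Gamma = Y(Lambda) = Z^2 + Z (sqrt 5, sqrt 2).

    Every transversal is a countable union of small graphs over the y-plane, and
    contracting the x-coordinates of such a graph is a leafwise isotopy onto a
    piece of the fibre torus T = {x = 0}. A transverse measure is therefore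
    determined by its restriction to T, which is invariant under Gamma. As 1,
    sqrt 2 and sqrt 5 are rationally independent, Gamma is dense (Dirichlet,
    Kronecker), so a small box can be moved by Gamma into any larger one;
    cutting the unit square into equal boxes then shows that the restriction is
    a multiple of Lebesgue measure.

    For existence, [Y] induces a function on the torus with values in R^2 / Gamma,
    of which a section is chosen; the required measure is the least one above
    the outer Lebesgue measure of the image under this section.

    The flow is divergent because Lambda(g a_t) contains the vector
    (e^(-t), 0, 0, 0), while the systole, which is invariant under U(2), is
    bounded below on compact sets of classes. *)

(** * Coordinates and the lattice of the example *)

(** The outer measure of an image under the section is not additive: points of a transversal with
    the same value are counted once. The supremum over finite Borel partitions restores the
    multiplicity. On a piece of a transversal parametrized by [phi] this supremum is the area of the
    image of any injective continuous [f] that agrees with [Y] after [phi] up to Gamma. The element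
    of Gamma may vary from point to point without any regularity: Gamma is countable, so Borel cells
    on which it is constant reduce the claim to translation invariance of area. Invariance under
    isotopies follows, because a point and its image on the same leaf have values of [Y] that differ
    by Gamma. Null sets of a transversal are defined in parameters, while the measure is area in the
    y-plane. The passage from one to the other rests on Lipschitz estimates and Fubini rather than
    on a change of variables. All charts are kept so small that they embed in the torus: nonzero
    lattice vectors have sup norm at least 1. This is where the constants 1/4 and 1/8 come from. *)

Section coordinates.
Variable R : realType.
Implicit Types v w : 'rV[R]_4.

Definition crd (k : nat) v : R := v 0 (inord k).

Definition row4 (a b c d : R) : 'rV[R]_4 := \row_j nth 0 [:: a; b; c; d] j.

Lemma crd_row4 a b c d k : (k < 4)%N -> crd k (row4 a b c d) = nth 0 [:: a; b; c; d] k.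
Proof. by move=> k4; rewrite /crd mxE inordK. Qed.

Lemma crdD k v w : crd k (v + w) = crd k v + crd k w.
Proof. by rewrite /crd mxE. Qed.

Lemma crdN k v : crd k (- v) = - crd k v.
Proof. by rewrite /crd mxE. Qed.

Lemma crdB k v w : crd k (v - w) = crd k v - crd k w.
Proof. by rewrite crdD crdN. Qed.

Lemma crdZ k a v : crd k (a *: v) = a * crd k v.
Proof. by rewrite /crd mxE. Qed.

Lemma crd0 k : crd k 0 = 0.
Proof. by rewrite /crd mxE. Qed.

Lemma rV4P v w : crd 0 v = crd 0 w -> crd 1 v = crd 1 w -> crd 2 v = crd 2 w ->
  crd 3 v = crd 3 w -> v = w.
Proof.
move=> h0 h1 h2 h3; apply/rowP => j; rewrite -(inord_val j).
by case: j => [] [|[|[|[|]]]] //=.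
Qed.

Lemma crd_le_norm k v : `|crd k v| <= `|v|.
Proof.
rewrite /Num.Def.normr/= mx_normrE.
apply/bigmax_geP; right; exists (ord0, inord k) => //=.
Qed.

Lemma norm_lt_crd v e : 0 < e -> (forall k, (k < 4)%N -> `|crd k v| < e) -> `|v| < e.
Proof.
move=> e0 h; rewrite /Num.Def.normr/= mx_normrE.
apply/bigmax_ltP; split => //= -[i j] _ /=; rewrite (ord1 i) -(inord_val j).
exact: h.
Qed.

Lemma norm_le_crd v e : 0 <= e -> (forall k, (k < 4)%N -> `|crd k v| <= e) -> `|v| <= e.
Proof.
move=> e0 h; rewrite /Num.Def.normr/= mx_normrE.
apply/bigmax_leP; split => //= -[i j] _ /=; rewrite (ord1 i) -(inord_val j).
exact: h.
Qed.

Lemma crd_continuous k : continuous (crd k).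
Proof. exact: coord_continuous. Qed.

(* [Y] is the transverse coordinate of the horizontal foliation. *)
Definition Y v : R * R := (crd 1 v, crd 3 v).
Definition X v : 'rV[R]_4 := row4 (crd 0 v) 0 (crd 2 v) 0.

Lemma YD v w : Y (v + w) = Y v + Y w.
Proof. by rewrite /Y !crdD. Qed.

Lemma YB v w : Y (v - w) = Y v - Y w.
Proof. by rewrite /Y !crdB. Qed.

Lemma horizontalP v : horizontal v <-> Y v = 0.
Proof.
split=> [h|[h1 h3] j].
  have := h ord0; have := h ord_max; rewrite /y_coord/= => h3 h1.
  by rewrite /Y /crd h1 h3.
by rewrite /y_coord; case: j => -[|[|]].
Qed.

End coordinates.
Arguments Y {R} v.
Arguments X {R} v.

Section example_lattice.
Variable R : realType.
Local Notation g := (example R).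
Implicit Types (v w : 'rV[R]_4) (n : 'rV[int]_4).

Definition lat n : 'rV[R]_4 := map_mx intr n *m set_val g.

Definition icrd (k : nat) n : int := n 0 (inord k).

Lemma latE n : lat n = row4 ((icrd 0 n)%:~R + Num.sqrt 3 * (icrd 2 n)%:~R)
  ((icrd 1 n)%:~R + Num.sqrt 5 * (icrd 2 n)%:~R) (icrd 2 n)%:~R
  (Num.sqrt 2 * (icrd 2 n)%:~R + (icrd 3 n)%:~R).
Proof.
apply/rowP => j; rewrite /lat mxE !big_ord_recl big_ord0 !mxE /=.
have -> : n 0 ord0 = icrd 0 n by congr (n _ _); apply: val_inj; rewrite /= inordK.
have -> : n 0 (lift ord0 ord0) = icrd 1 n by congr (n _ _); apply: val_inj; rewrite /= inordK.
have -> : n 0 (lift ord0 (lift ord0 ord0)) = icrd 2 n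
  by congr (n _ _); apply: val_inj; rewrite /= inordK.
have -> : n 0 (lift ord0 (lift ord0 (lift ord0 ord0))) = icrd 3 n
  by congr (n _ _); apply: val_inj; rewrite /= inordK.
by case: j => [] [|[|[|[|]]]] //= _; ring.
Qed.

Lemma crd_lat n : [/\ crd 0 (lat n) = (icrd 0 n)%:~R + Num.sqrt 3 * (icrd 2 n)%:~R,
  crd 1 (lat n) = (icrd 1 n)%:~R + Num.sqrt 5 * (icrd 2 n)%:~R,
  crd 2 (lat n) = (icrd 2 n)%:~R &
  crd 3 (lat n) = Num.sqrt 2 * (icrd 2 n)%:~R + (icrd 3 n)%:~R].
Proof. by rewrite latE !crd_row4. Qed.

Lemma latticeP v : lattice g v <-> exists n, v = lat n.
Proof. by split=> [[n _ <-]|[n ->]]; exists n. Qed.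

Lemma latD n m : lat (n + m) = lat n + lat m.
Proof. by rewrite /lat map_mxD mulmxDl. Qed.

Lemma latN n : lat (- n) = - lat n.
Proof. by rewrite /lat map_mxN mulNmx. Qed.

Lemma lat0 : lat 0 = 0.
Proof. by rewrite /lat map_mx0 mul0mx. Qed.

Lemma intr_lt1 (z : int) : `|z%:~R : R| < 1 -> z = 0.
Proof. by rewrite -intr_norm -[X in _ < X]/(1%:~R) ltr_int; lia. Qed.

(** Coordinate 2 of a lattice vector is the integer [icrd 2 n]; once it vanishes, the other three
    coordinates are integers too. *)
Lemma lat_small n : `|lat n| < 1 -> lat n = 0.
Proof.
move=> h; have [h0 h1 h2 h3] := crd_lat n.
have := le_lt_trans (crd_le_norm 2 (lat n)) h; rewrite h2 => /intr_lt1 e2.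
rewrite e2 !mulr0 ?addr0 ?add0r in h0 h1 h2 h3.
have := le_lt_trans (crd_le_norm 0 (lat n)) h; rewrite h0 => /intr_lt1 e0.
have := le_lt_trans (crd_le_norm 1 (lat n)) h; rewrite h1 => /intr_lt1 e1.
have := le_lt_trans (crd_le_norm 3 (lat n)) h; rewrite h3 => /intr_lt1 e3.
by apply: rV4P; rewrite crd0 ?h0 ?h1 ?h2 ?h3 ?e0 ?e1 ?e2 ?e3.
Qed.

Lemma pr_eq v w : pr g v = pr g w <-> exists n, v = w + lat n.
Proof.
split.
  move=> e; have : torus_eq g v w by apply/eqmodP; exact: e.
  move=> /asboolP/latticeP[n h]; exists n.
  by rewrite -h addrC subrK.
move=> [n ->]; apply/eqmodP/asboolP/latticeP; exists n.
by rewrite addrC addKr.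
Qed.

Lemma pr_lat v n : pr g (v + lat n) = pr g v.
Proof. by apply/pr_eq; exists n. Qed.

Lemma pr_surj (p : torus g) : exists v, pr g v = p.
Proof. by exists (repr p); rewrite /pr reprK. Qed.

Lemma pr_inj_near v w : `|v - w| < 1 -> pr g v = pr g w -> v = w.
Proof.
move=> h /pr_eq[n vE]; have := @lat_small n.
rewrite vE addrC addKr in h => /(_ h) e.
by rewrite vE e addr0.
Qed.

Lemma pr_continuous : continuous (pr g).
Proof. exact: pi_continuous. Qed.

Lemma open_torus (U : set (torus g)) : open U <-> open (pr g @^-1` U).
Proof. by []. Qed.

Lemma open_shift (U : set 'rV[R]_4) w : open U -> open ((fun v => v + w) @^-1` U).
Proof.
move: U; apply/continuousP => v.
by apply: (@cvgD _ _ _ (nbhs v) _ id (cst w)); [exact: cvg_id | exact: cvg_cst].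
Qed.

Lemma pr_open (U : set 'rV[R]_4) : open U -> open (pr g @` U).
Proof.
move=> oU; apply/open_torus.
have -> : pr g @^-1` (pr g @` U) = \bigcup_(n in [set: 'rV[int]_4]) ((fun v => v + lat n) @^-1` U).
  apply/seteqP; split => v /=.
    by move=> [w Uw /pr_eq[n wE]]; exists n => //=; rewrite -wE.
  by move=> [n _ /= Un]; exists (v + lat n) => //; rewrite pr_lat.
by apply: bigcup_open => n _; exact: open_shift.
Qed.

Lemma torus_hausdorff : hausdorff_space (torus g).
Proof.
rewrite open_hausdorff => p q /eqP pq.
have [v vp] := pr_surj p; have [w0 wq0] := pr_surj q.
have [r r0 rP] : exists2 r : R, 0 < r &
    forall v' w', ball v r v' -> ball w0 r w' -> pr g v' <> pr g w'.
  (* If a lattice translate of [w0] lies within 1/2 of [v], points of the two half-distance balls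
     are closer than 1, so equality in the torus forces equality in R^4. Otherwise balls of radius
     1/4 already have disjoint images. *)
  have [[n hn]|hn] := pselect (exists n, `|v - (w0 + lat n)| < 1 / 2).
    set w := w0 + lat n in hn.
    have vw : v != w by apply/eqP => vw; apply: pq; rewrite -vp -wq0 vw pr_lat.
    have d0 : 0 < `|v - w| by rewrite normr_gt0 subr_eq0.
    exists (`|v - w| / 2); first by rewrite divr_gt0.
    move=> v' w'; rewrite -!ball_normE /= => hv hw e.
    have e' : pr g v' = pr g (w' + lat n) by rewrite pr_lat.
    have hw' : `|w - (w' + lat n)| < `|v - w| / 2.
      by rewrite /w opprD addrACA subrr addr0.
    have E : v' - (w' + lat n) = (v - w) - (v - v') + (w - (w' + lat n)).
      by apply/rowP => j; rewrite !mxE; ring.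
    have h1 : v' = w' + lat n.
      apply: pr_inj_near e'; rewrite E.
      apply: le_lt_trans (ler_normD _ _) _.
      have := ler_normB (v - w) (v - v'); lra.
    have : `|v - w| < `|v - w|.
      have {1}-> : v - w = (v - v') - (w - (w' + lat n)).
        by rewrite h1; apply/rowP => j; rewrite !mxE; ring.
      have := ler_normB (v - v') (w - (w' + lat n)); lra.
    by rewrite ltxx.
  exists (1 / 4); first by [].
  move=> v' w'; rewrite -!ball_normE /= => hv hw /pr_eq[n e]; apply: hn.
  exists n; have -> : v - (w0 + lat n) = (v - v') - (w0 - w').
    by rewrite e; apply/rowP => j; rewrite !mxE; ring.
  have := ler_normB (v - v') (w0 - w'); lra.
exists (pr g @` ball v r, pr g @` ball w0 r) => /=.
  by split; rewrite inE; [exists v|exists w0] => //; exact: ballxx.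
split; [exact/pr_open/ball_open|exact/pr_open/ball_open|].
apply/eqP; rewrite -subset0 => _ [[v' hv' <-] [w' hw']] /esym.
exact: rP.
Qed.
End example_lattice.

(** * Lebesgue measure on the plane *)

Section plane.
Variable R : realType.

Definition plane : measurableType _ := (measurableTypeR R * measurableTypeR R)%type.

Definition lam2 : {measure set plane -> \bar R} :=
  (@lebesgue_measure R \x @lebesgue_measure R)%E.

(** A generating family of closed sets that is stable under intersection: closedness serves
    [borel_image], stability serves the uniqueness argument in [uniform_measure]. *)
Definition quadrants : set (set plane) :=
  [set A | exists a b : R, A = `]-oo, a]%classic `*` `]-oo, b]%classic].

Lemma bigcup_ray : \bigcup_k `]-oo, k%:R]%classic = [set: R].
Proof.
apply/seteqP; split => // x _; exists (Num.truncn `|x|).+1 => //=.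
rewrite in_itv/=; apply: le_trans (ler_norm x) _.
by rewrite ltW// truncnS_gt.
Qed.

(** One factor at a time: for a fixed ray in the second factor, the sets whose product with the ray
    is generated by quadrants form a sigma-algebra. The same argument then frees the second
    factor. *)
Lemma plane_measurableE : @measurable _ plane = <<s quadrants >>.
Proof.
have H1 (b : R) A : measurable A -> <<s quadrants >> (A `*` `]-oo, b]%classic).
  move: A; apply: smallest_sub.
    split => /=.
    - by rewrite set0X; exact: sigma_algebra0.
    - move=> A hA.
      have -> : (setT `\` A) `*` `]-oo, b]%classic =
          (setT `*` `]-oo, b]%classic) `\` (A `*` `]-oo, b]%classic).
        by apply/seteqP; split => -[x y] /=; [tauto|move=> [[_ hy] h]; split => //; tauto].
      apply: (@measurableD _ (g_sigma_algebraType quadrants)) => //.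
      rewrite -bigcup_ray setX_bigcupl.
      apply: (@bigcup_measurable _ (g_sigma_algebraType quadrants)) => k _.
      by apply: sub_sigma_algebra; exists k%:R, b.
    - move=> F hF; rewrite setX_bigcupl.
      by apply: (@bigcup_measurable _ (g_sigma_algebraType quadrants)) => k _; exact: hF.
  move=> _ [[c d] _ <-] /=.
  have -> : `]c, d]%classic `*` `]-oo, b]%classic =
      (`]-oo, d]%classic `*` `]-oo, b]%classic) `\`
      (`]-oo, c]%classic `*` `]-oo, b]%classic) :> set plane.
    apply/seteqP; split => -[x y] /=; rewrite !in_itv/=.
      by move=> [/andP[cx xd] yb]; split => // -[]; rewrite leNgt cx.
    move=> [[xd yb] h]; split => //; rewrite xd andbT ltNge.
    by apply/negP => xc; exact: h.
  apply: (@measurableD _ (g_sigma_algebraType quadrants)).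
    by apply: sub_sigma_algebra; exists d, b.
  by apply: sub_sigma_algebra; exists c, b.
have H2 A B : measurable A -> measurable B -> <<s quadrants >> (A `*` B).
  move=> mA; move: B; apply: smallest_sub.
    split => /=.
    - by rewrite setX0; exact: sigma_algebra0.
    - move=> B hB.
      have -> : A `*` (setT `\` B) = (A `*` setT) `\` (A `*` B) :> set plane.
        by apply/seteqP; split => -[x y] /=; [tauto|move=> [[hx _] h]; split => //; tauto].
      apply: (@measurableD _ (g_sigma_algebraType quadrants)) => //.
      rewrite -bigcup_ray setX_bigcupr.
      by apply: (@bigcup_measurable _ (g_sigma_algebraType quadrants)) => k _; exact: H1.
    - move=> F hF; rewrite setX_bigcupr.
      by apply: (@bigcup_measurable _ (g_sigma_algebraType quadrants)) => k _; exact: hF.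
  move=> _ [[c d] _ <-] /=.
  have -> : A `*` `]c, d]%classic = (A `*` `]-oo, d]%classic) `\` (A `*` `]-oo, c]%classic) :> set plane.
    apply/seteqP; split => -[x y] /=; rewrite !in_itv/=.
      by move=> [xA /andP[cy yd]]; split => // -[_]; rewrite leNgt cy.
    move=> [[xA yd] h]; split => //; rewrite yd andbT ltNge.
    by apply/negP => yc; exact: h.
  by apply: (@measurableD _ (g_sigma_algebraType quadrants)); exact: H1.
rewrite measurable_prod_measurableType eqEsubset; split.
  apply: smallest_sub; first exact: smallest_sigma_algebra.
  by move=> _ [A mA] [B mB] <-; exact: H2.
apply: smallest_sub; first exact: smallest_sigma_algebra.
move=> _ [a [b ->]]; apply: sub_sigma_algebra; exists `]-oo, a]%classic; first exact: measurable_itv.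
by exists `]-oo, b]%classic => //; exact: measurable_itv.
Qed.

Lemma quadrantsI : setI_closed quadrants.
Proof.
move=> _ _ [a [b ->]] [c [d ->]]; exists (Num.min a c), (Num.min b d).
apply/seteqP; split => -[x y] /=; rewrite !in_itv/= !le_min.
  by move=> [[-> ->] [-> ->]].
by move=> [/andP[-> ->] /andP[-> ->]].
Qed.

Lemma lebesgue_shift (w : R) A : measurable A ->
  pushforward (@lebesgue_measure R) (fun x => x + w : measurableTypeR R) A = lebesgue_measure A.
Proof.
move=> mA; have ms : measurable_fun [set: measurableTypeR R] (fun x => x + w : measurableTypeR R).
  exact: (@measurable_funD _ (measurableTypeR R) R setT idfun (cst w) (@measurable_id _ _ _)).
apply/esym/lebesgue_measure_unique => //= _ [[a b] _ <-] /=; rewrite /pushforward.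
have -> : (fun x => x + w) @^-1` `]a, b]%classic = `]a - w, b - w]%classic.
  by apply/seteqP; split => x /=; rewrite !in_itv/= ltrBlDr lerBrDr.
rewrite !lebesgue_measure_itv/= !lte_fin ltrD2r; case: ifP => // _.
by rewrite -!EFinB; congr (_%:E); ring.
Qed.

Lemma measurable_fun_shift (w : R * R) : measurable_fun [set: plane] (fun x => x + w : plane).
Proof.
apply/measurable_fun_pairP; split.
  exact: (@measurable_funD _ plane R setT fst (cst w.1) (@measurable_fst _ _ _ _)).
exact: (@measurable_funD _ plane R setT snd (cst w.2) (@measurable_snd _ _ _ _)).
Qed.

Lemma lam2X (A B : set (measurableTypeR R)) : measurable A -> measurable B ->
  lam2 (A `*` B) = (lebesgue_measure A * lebesgue_measure B)%E.
Proof. by move=> mA mB; exact: product_measure1E. Qed.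

Lemma measurable_shift (w : R * R) (A : set plane) : measurable A ->
  measurable ((fun x => x + w : plane) @^-1` A).
Proof.
by move=> mA; rewrite -[X in measurable X]setTI; exact: measurable_fun_shift.
Qed.

Lemma lam2_shift (w : R * R) (A : set plane) : measurable A ->
  pushforward lam2 (fun x => x + w : plane) A = lam2 A.
Proof.
move=> mA; apply/esym/product_measure_unique => //; first exact: measurable_fun_shift.
move=> mf B C mB mC; rewrite /pushforward.
transitivity (lam2 (((fun x => x + w.1) @^-1` B) `*` ((fun x => x + w.2) @^-1` C))) => //.
have ms (z : R) D : measurable D -> measurable ((fun x => x + z : measurableTypeR R) @^-1` D).
  move=> mD; rewrite -[X in measurable X]setTI.
  exact: (@measurable_funD _ (measurableTypeR R) R setT idfun (cst z) (@measurable_id _ _ _)).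
rewrite lam2X; [|exact: ms|exact: ms].
by congr (_ * _)%E; exact: lebesgue_shift.
Qed.

End plane.

(** * Borel sets of the plane and of the torus *)

Section borel_sets.
Variable R : realType.
Local Notation plane := (plane R).

Lemma ratr_near (x e : R) : 0 < e -> exists q : rat, `|x - ratr q| < e.
Proof.
move=> e0; have [q] := @rat_in_itvoo R (x - e) (x + e) ltac:(lra).
rewrite in_itv/= => /andP[h1 h2]; exists q.
by rewrite ltr_norml; apply/andP; split; lra.
Qed.

Definition rat_box (n : nat) : set (R * R) :=
  if unpickle n is Some (a, b, k) then
    (`[ratr a - k.+1%:R^-1, ratr a + k.+1%:R^-1]%classic `*`
    `[ratr b - k.+1%:R^-1, ratr b + k.+1%:R^-1]%classic)
  else set0.

Lemma rat_box_compact n : @compact (R * R)%type (rat_box n).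
Proof.
rewrite /rat_box; case: (unpickle n) => [[[a b] k]|]; last exact: compact0.
by apply: compact_setX; exact: segment_compact.
Qed.

Lemma rat_box_measurable n : measurable (rat_box n : set plane).
Proof.
rewrite /rat_box; case: (unpickle n) => [[[a b] k]|]; last exact: measurable0.
by apply: measurableX; exact: measurable_itv.
Qed.

Lemma rat_box_base (U : set (R * R)) p : open U -> U p ->
  exists n, rat_box n p /\ rat_box n `<=` U.
Proof.
move=> oU Up; have /nbhs_ballP[e /= e0 eU] := open_nbhs_nbhs (conj oU Up).
have [k ke] : exists k : nat, k.+1%:R^-1 < e / 2.
  exists (Num.truncn (e / 2)^-1).
  have h : 0 < (e / 2)^-1 by rewrite invr_gt0 divr_gt0.
  by rewrite -[e / 2 in X in _ < X]invrK ltf_pV2 ?posrE ?ltr0n// truncnS_gt.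
have k0 : (0 : R) < k.+1%:R^-1 by rewrite invr_gt0 ltr0n.
have [a ha] := ratr_near p.1 k0; have [b hb] := ratr_near p.2 k0.
exists (pickle (a, b, k)); rewrite /rat_box pickleK.
move: (k.+1%:R^-1) k0 ke ha hb => r r0 re; rewrite !ltr_norml => /andP[? ?] /andP[? ?].
split.
  by split => /=; rewrite in_itv/=; apply/andP; split; lra.
move=> [x y] [] /=; rewrite !in_itv/= => /andP[? ?] /andP[? ?]; apply: eU.
by split; rewrite /ball/= ltr_norml; apply/andP; split; lra.
Qed.

Lemma open_rat_boxE (U : set (R * R)) : open U ->
  U = \bigcup_(n in [set n | rat_box n `<=` U]) rat_box n.
Proof.
move=> oU; apply/seteqP; split => [p /(rat_box_base oU)[n [np nU]]|p [n /= nU /nU//]].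
by exists n.
Qed.

Lemma plane_open_measurable (U : set plane) : @open (R * R)%type U -> measurable U.
Proof.
move=> oU; rewrite (open_rat_boxE oU); apply: bigcup_measurable => n _.
exact: rat_box_measurable.
Qed.

Lemma quadrant_closed (a b : R) : @closed (R * R)%type (`]-oo, a] `*` `]-oo, b]%classic).
Proof.
have -> : `]-oo, a] `*` `]-oo, b]%classic =
    (fst @^-1` `]-oo, a]%classic) `&` (snd @^-1` `]-oo, b]%classic) :> set (R * R) by [].
have cR (c : R) : closed (`]-oo, c]%classic) by exact: closed_le.
apply: closedI; apply: closed_comp; try exact: cR.
  by move=> p _; exact: cvg_fst.
by move=> p _; exact: cvg_snd.
Qed.

Lemma plane_borelE : @measurable _ plane = <<s @open (R * R)%type >>.
Proof.
rewrite eqEsubset; split.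
  rewrite plane_measurableE; apply: smallest_sub; first exact: smallest_sigma_algebra.
  move=> _ [a [b ->]]; rewrite -[X in <<s _ >> X]setCK.
  apply: (@measurableC _ (g_sigma_algebraType _)); apply: sub_sigma_algebra.
  by apply: closed_openC; exact: quadrant_closed.
apply: smallest_sub; first exact: sigma_algebra_measurable.
exact: plane_open_measurable.
Qed.

(** * Borel sets under continuous injections of plane domains *)

Section image.
Variables (T : topologicalType) (V : set (R * R)) (f : R * R -> T).
Hypotheses (oV : open V) (cf : forall q, V q -> {for q, continuous f}).
Local Notation borel := <<s @open T >>.

Lemma open_preimage_on (U : set T) : open U -> open (V `&` f @^-1` U).
Proof.
move=> oU; rewrite openE => q [Vq Uq]; apply: filterI.
  exact: open_nbhs_nbhs.
by apply: cf => //; exact: open_nbhs_nbhs.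
Qed.

Lemma borel_preimage (A : set T) : borel A -> measurable (V `&` f @^-1` A : set plane).
Proof.
move: A; apply: smallest_sub; last first.
  by move=> U oU; apply: plane_open_measurable; exact: open_preimage_on.
split => /=.
- by rewrite preimage_set0 setI0; exact: measurable0.
- move=> A mA; have -> : V `&` f @^-1` (setT `\` A) = V `\` (V `&` f @^-1` A).
    by apply/seteqP; split => q /=; tauto.
  by apply: measurableD => //; exact: plane_open_measurable.
- move=> F mF; rewrite preimage_bigcup setI_bigcupr.
  by apply: bigcup_measurable => n _; exact: mF.
Qed.

Hypotheses (hT : hausdorff_space T) (fI : set_inj V f).

(* Open sets are countable unions of compact boxes, and the images of compact
   sets are compact, hence closed. *)
Lemma borel_image (B : set plane) : measurable B -> B `<=` V -> borel (f @` B).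
Proof.
pose T' : pointedType := HB.pack (Topological.sort T) (isPointed.Build T (f 0)).
suff H : measurable B -> borel (f @` (B `&` V)) by move=> mB /setIidl BV; rewrite -BV; exact: H.
have bC (C : set (R * R)) : closed C -> borel (f @` (C `&` V)).
  move=> cC; rewrite {1}(open_rat_boxE oV) setI_bigcupr image_bigcup.
  apply: (@bigcup_measurable _ (@g_sigma_algebraType T' (@open T))) => n nV.
  rewrite -[X in @measurable _ _ X]setCK; apply: (@measurableC _ (@g_sigma_algebraType T' (@open T))).
  apply: sub_sigma_algebra; apply: closed_openC; apply: compact_closed => //.
  apply: continuous_compact.
    apply: continuous_in_subspaceT => q; rewrite inE => -[_ /nV Vq].
    exact: cf.
  by rewrite setIC; apply: compact_closedI => //; exact: rat_box_compact.
rewrite plane_measurableE; move: B; apply: smallest_sub; last first.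
  by move=> _ [a [b ->]]; apply: bC; exact: quadrant_closed.
split => /=.
- by rewrite set0I image_set0; exact: sigma_algebra0.
- move=> A mA; have -> : f @` ((setT `\` A) `&` V) = (f @` (setT `&` V)) `\` (f @` (A `&` V)).
    apply/seteqP; split => p /=.
      move=> [q [[_ nA] Vq] <-]; split; first by exists q.
      move=> [q' [Aq' Vq'] e]; apply: nA.
      by rewrite -(fI _ _ e) ?inE.
    move=> [[q [_ Vq] <-] h]; exists q => //; split => //; split => // Aq.
    by apply: h; exists q.
  apply: (@measurableD _ (@g_sigma_algebraType T' (@open T))) => //.
  by apply: bC; exact: closedT.
- move=> F mF; rewrite setI_bigcupl image_bigcup.
  by apply: (@bigcup_measurable _ (@g_sigma_algebraType T' (@open T))) => n _; exact: mF.
Qed.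

End image.

(** * Countable subcovers in the torus *)

Section lindelof.
Local Notation g := (example R).

Definition rat_ball (n : nat) : set (torus g) :=
  if unpickle n is Some (c, k) then pr g @` ball (map_mx ratr (c : 'rV[rat]_4) : 'rV[R]_4) k.+1%:R^-1
  else set0.

Lemma rat_ball_base (U : set (torus g)) p : open U -> U p ->
  exists n, rat_ball n p /\ rat_ball n `<=` U.
Proof.
move=> oU Up; have [v vp] := pr_surj p.
have oV : open (pr g @^-1` U) by [].
have Vv : (pr g @^-1` U) v by rewrite /= vp.
have /nbhs_ballP[e /= e0 eU] := open_nbhs_nbhs (conj oV Vv).
have [k ke] : exists k : nat, k.+1%:R^-1 < e / 2.
  exists (Num.truncn (e / 2)^-1).
  have h : 0 < (e / 2)^-1 by rewrite invr_gt0 divr_gt0.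
  by rewrite -[e / 2 in X in _ < X]invrK ltf_pV2 ?posrE ?ltr0n// truncnS_gt.
have k0 : (0 : R) < k.+1%:R^-1 by rewrite invr_gt0 ltr0n.
pose c : 'rV[rat]_4 := \row_j projT1 (cid (ratr_near (v 0 j) k0)).
have cv : `|map_mx ratr c - v| < k.+1%:R^-1.
  apply: norm_lt_crd => // j j4; rewrite /crd !mxE; case: cid => q /= hq.
  by rewrite distrC.
exists (pickle (c, k)); rewrite /rat_ball pickleK; split.
  by exists v => //; rewrite -ball_normE.
move=> _ [w hw <-]; apply: eU; rewrite -ball_normE /=.
rewrite -ball_normE /= in hw.
have -> : v - w = (map_mx ratr c - w) - (map_mx ratr c - v).
  by apply/rowP => j; rewrite !mxE; ring.
have := ler_normB (map_mx ratr c - w) (map_mx ratr c - v).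
move: ke hw cv; move: (k.+1%:R^-1) (`|_ - w|) (`|_ - v|) => r x y; lra.
Qed.

(** Around each [p] in [S] some rational ball fits into [U p]. For each of the countably many
    rational balls that fit into some [U p], one such [p] is chosen; [None] stands for the balls
    that fit into none. *)
Lemma torus_lindelof (S : set (torus g)) (U : torus g -> set (torus g)) :
  (forall p, S p -> open (U p) /\ U p p) ->
  exists s : nat -> option (torus g), (forall n p, s n = Some p -> S p) /\
    forall p, S p -> exists n q, s n = Some q /\ U q p.
Proof.
move=> h; pose P n p := S p /\ rat_ball n `<=` U p.
pose s n := if pselect (exists p, P n p) is left e then Some (projT1 (cid e)) else None.
exists s; split.
  by move=> n p; rewrite /s; case: pselect => // e [<-]; case: cid => x /= [].
move=> p Sp; have [oU Up] := h _ Sp.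
have [n [np nU]] := rat_ball_base oU Up.
exists n; rewrite /s; case: pselect => [e|[]]; last by exists p.
by exists (projT1 (cid e)); split => //; case: cid => x /= [_]; exact.
Qed.

End lindelof.

End borel_sets.

(** * The least measure above a set function *)

Section hull.
Context d (T : measurableType d) (R : realType) (tau : set T -> \bar R).
Local Open Scope ereal_scope.
Hypotheses (tau0 : tau set0 = 0) (tau_ge0 : forall A, 0 <= tau A).
Hypothesis tau_le : {homo tau : A B / A `<=` B >-> A <= B}.
Hypothesis tau_sub : forall F : (set T)^nat,
  tau (\bigcup_k F k) <= \sum_(k <oo) tau (F k).

(** A countable measurable partition, encoded by the map from a point to the index of its piece, so
    that disjointness and covering hold by construction. *)
Definition labelling (l : T -> nat) := forall k, measurable (l @^-1` [set k]).

(* The least measure above [tau]: the supremum of the sums of [tau] over finite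
   measurable partitions. *)
Definition hull (A : set T) : \bar R :=
  ereal_sup [set \sum_(i < p.2) tau (A `&` p.1 @^-1` [set (i : nat)]) |
    p in [set p : (T -> nat) * nat | labelling p.1]].

Lemma hull_ub A l n : labelling l ->
  \sum_(i < n) tau (A `&` l @^-1` [set (i : nat)]) <= hull A.
Proof. by move=> hl; apply: ereal_sup_ubound; exists (l, n). Qed.

Lemma hull_le_ub A c :
  (forall l n, labelling l -> \sum_(i < n) tau (A `&` l @^-1` [set (i : nat)]) <= c) ->
  hull A <= c.
Proof. by move=> h; apply: ge_ereal_sup => _ [[l n] /= hl <-]; exact: h. Qed.

Lemma tau_le_hull A : tau A <= hull A.
Proof.
have h : labelling (fun _ => 0%N).
  move=> [|k].
    by rewrite (_ : _ @^-1` _ = setT)//; apply/seteqP; split.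
  by rewrite (_ : _ @^-1` _ = set0)//; apply/seteqP; split.
apply: le_trans (hull_ub A 1 h); rewrite big_ord1.
by apply: tau_le => x Ax; split.
Qed.

Lemma hull_ge0 A : 0 <= hull A.
Proof. exact: le_trans (tau_ge0 A) (tau_le_hull A). Qed.

Lemma hull0 : hull set0 = 0.
Proof.
apply/eqP; rewrite eq_le hull_ge0 andbT; apply: hull_le_ub => l n _.
by rewrite big1// => i _; rewrite set0I.
Qed.

Lemma hull_le : {homo hull : A B / A `<=` B >-> A <= B}.
Proof.
move=> A B AB; apply: hull_le_ub => l n hl; apply: le_trans (hull_ub B n hl).
by apply: lee_sum => i _; apply: tau_le; exact: setSI.
Qed.

Lemma labelling_if (A : set T) l1 l2 n : measurable A -> labelling l1 -> labelling l2 ->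
  labelling (fun x => if x \in A then l1 x else (n + l2 x)%N).
Proof.
move=> mA h1 h2 k.
have -> : (fun x => if x \in A then l1 x else (n + l2 x)%N) @^-1` [set k] =
    (A `&` l1 @^-1` [set k]) `|`
    (~` A `&` if (n <= k)%N then l2 @^-1` [set (k - n)%N] else set0).
  apply/seteqP; split => x /=.
    case: ifPn => [/set_mem Ax e|/negP xA <-]; first by left.
    right; split => [Ax|]; first by apply: xA; exact: mem_set.
    by rewrite leq_addr /= addKn.
  move=> [[Ax <-]|[nA]]; first by rewrite mem_set.
  by case: ifP => // nk /= e; rewrite memNset// e subnKC.
apply: measurableU; first exact: measurableI.
apply: measurableI; first exact: measurableC.
by case: ifP => // _; exact: h2.
Qed.

(** A partition for [A] and one for [B] are glued by [labelling_if]. Labels from [n] on in [A] may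
    collide with shifted labels of [B]; this only enlarges pieces, and [tau] is monotone. *)
Lemma hullD A B : measurable A -> A `&` B = set0 -> hull A + hull B <= hull (A `|` B).
Proof.
move=> mA AB0; have [->|Moo] := eqVneq (hull (A `|` B)) +oo; first by rewrite leey.
have fin C : C `<=` A `|` B -> hull C \is a fin_num.
  move=> CAB; rewrite ge0_fin_numE ?hull_ge0//.
  by apply: le_lt_trans (hull_le CAB) _; rewrite ltey.
have finB : hull B \is a fin_num by apply: fin; exact: subsetUr.
rewrite -leeBrDr//; apply: hull_le_ub => l n hl.
have finS : \sum_(i < n) tau (A `&` l @^-1` [set (i : nat)]) \is a fin_num.
  rewrite ge0_fin_numE ?sume_ge0//; apply: le_lt_trans (hull_ub A n hl) _.
  by rewrite -ge0_fin_numE ?hull_ge0//; apply: fin; exact: subsetUl.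
rewrite leeBrDr// addeC -leeBrDr//; apply: hull_le_ub => l' n' hl'; rewrite leeBrDr//.
apply: le_trans (hull_ub _ (n + n') (labelling_if n mA hl hl')).
rewrite addeC big_split_ord/=.
apply: leeD; apply: lee_sum => i _; apply: tau_le => x /= [Ex lx].
  by split; [left|rewrite mem_set].
split; first by right.
rewrite memNset ?lx// => Ax; have : (A `&` B) x by [].
by rewrite AB0.
Qed.

(** The upper bound exchanges the finite sum over a partition with the series given by subadditivity
    of [tau]; the lower bound is [hullD] on finite unions. *)
Lemma hull_semi_sigma_additive : semi_sigma_additive hull.
Proof.
move=> F mF tF mUF.
suff -> : hull (\bigcup_n F n) = \sum_(k <oo) hull (F k).
  by apply: is_cvg_nneseries => n _ _; exact: hull_ge0.
apply/eqP; rewrite eq_le; apply/andP; split.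
  apply: hull_le_ub => l n hl.
  apply: (@le_trans _ _ (\sum_(i < n) \sum_(k <oo) tau (F k `&` l @^-1` [set (i : nat)]))).
    by apply: lee_sum => i _; rewrite setI_bigcupl; exact: tau_sub.
  rewrite -(@nneseries_sum _ _ _ R)//.
  by apply: lee_nneseries => [k _ _|k _]; [exact: sume_ge0|exact: hull_ub].
apply: lime_le; first by apply: is_cvg_nneseries => n _ _; exact: hull_ge0.
apply: nearW => n; rewrite big_mkord.
apply: (@le_trans _ _ (hull (\big[setU/set0]_(k < n) F k))); last first.
  by apply: hull_le; exact: bigsetU_bigcup.
elim: n => [|n IH]; first by rewrite !big_ord0 hull0.
rewrite !big_ord_recr /=; apply: le_trans (hullD _ _); first exact: leeD2r.
  by apply: bigsetU_measurable => k _; exact: mF.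
rewrite -bigcup_mkord -subset0 => x [[k /= kn Fkx] Fnx].
have kn' : k = n by apply: tF => //; exists x.
by rewrite kn' ltnn in kn.
Qed.

End hull.

(** * Smooth maps *)

Section smooth_calculus.
Variable R : realType.
Implicit Types E F G : normedModType R.

Lemma near_eq_differentiable E F (f h : E -> F) (x : E) :
  (\near x, f x = h x) -> differentiable f x -> differentiable h x.
Proof.
move=> fh /diff_locallyP[df dfE].
have hE : h \o shift x = cst (h x) + 'd f x +o_ 0 id.
  apply/eqaddoP => e e0; move/eqaddoP: dfE => /(_ e e0) dfE.
  have fh0 : \forall y \near (0 : E), f (y + x) = h (y + x).
    by move: fh; rewrite (near_shift 0); apply: filterS => y /=; rewrite subr0.
  apply: filterS2 dfE fh0 => y + fhy.
  suff -> : (h \o shift x - (cst (h x) + 'd f x)) y = (f \o shift x - (cst (f x) + 'd f x)) y by [].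
  by rewrite !fctE /= (nbhs_singleton fh) fhy.
have d := diff_unique df hE.
by apply/diff_locallyP; rewrite d.
Qed.

Section basics.
Variables (E F : normedModType R) (D : set E).

Lemma smooth_on_differentiable (f : E -> F) e : smooth_on D f -> D e -> differentiable f e.
Proof. by move=> sf De; exact: (sf [::]). Qed.

Lemma smooth_on_continuous (f : E -> F) e : smooth_on D f -> D e -> {for e, continuous f}.
Proof. by move=> sf De; apply: differentiable_continuous; exact: smooth_on_differentiable. Qed.

Lemma smooth_on_derive (f : E -> F) v : smooth_on D f -> smooth_on D ('D_v f).
Proof. by move=> sf vs e De; have := sf (rcons vs v) e De; rewrite foldr_rcons. Qed.

Lemma smooth_on_sub (D' : set E) (f : E -> F) : D' `<=` D -> smooth_on D f -> smooth_on D' f.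
Proof. by move=> D'D sf vs e /D'D; exact: sf. Qed.

(* Coinduction: a class of functions differentiable on [D] and stable under
   directional derivatives consists of smooth functions. *)
Lemma smooth_on_coind (P : (E -> F) -> Prop) :
  (forall f, P f -> (forall e, D e -> differentiable f e) /\ forall v, P ('D_v f)) ->
  forall f, P f -> smooth_on D f.
Proof.
move=> h f Pf vs; elim/last_ind: vs f Pf => [|vs v IH] f Pf e De.
  by have [+ _] := h _ Pf; exact.
by rewrite foldr_rcons; apply: IH => //; have [_] := h _ Pf; exact.
Qed.

End basics.

Lemma diff_linD E F G (f : E -> F) (L : {linear F -> G}) (c : G) e : continuous L ->
  differentiable f e ->
  differentiable (fun x => L (f x) + c) e /\ forall v, 'd (fun x => L (f x) + c) e v = L ('d f e v).
Proof.
move=> cL df; have dL : differentiable L (f e) by exact: linear_differentiable.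
have dc : differentiable (L \o f) e by exact: differentiable_comp.
have E1 : (fun x => L (f x) + c) = (L \o f) + cst c by [].
rewrite E1; split; first exact: differentiableD.
by move=> v; rewrite diffD// diff_cst/= addr0 diff_comp// diff_lin.
Qed.

Lemma smooth_on_linD E F G (D : set E) (f : E -> F) (L : {linear F -> G}) (c : G) : open D ->
  continuous L -> smooth_on D f -> smooth_on D (fun x => L (f x) + c).
Proof.
(* Equality is asked on [D] only; as [D] is open, this determines the derivatives there. *)
move=> oD cL sf; pose P (h : E -> G) := exists f c, smooth_on D f /\ forall e, D e -> h e = L (f e) + c.
apply: (@smooth_on_coind _ _ _ P); last by exists f, c.
move=> h [f' [c' [sf' hE]]].
have near_h e : D e -> \near e, L (f' e) + c' = h e.
  by move=> De; apply: filterS (open_nbhs_nbhs (conj oD De)) => x /hE ->.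
split=> [e De|v].
  apply: near_eq_differentiable (near_h _ De) _.
  by have [] := diff_linD c' cL (smooth_on_differentiable sf' De).
exists ('D_v f'), 0; split; first exact: smooth_on_derive.
move=> e De; rewrite addr0 -(near_eq_derive v (near_h _ De)).
have dfe := smooth_on_differentiable sf' De.
have [d1 d2] := diff_linD c' cL dfe.
by rewrite deriveE// d2 -deriveE.
Qed.

Lemma smooth_on_addZ E F (D : set E) (f g : E -> F) (a : R) : open D ->
  smooth_on D f -> smooth_on D g -> smooth_on D (fun x => f x + a *: g x).
Proof.
move=> oD sf sg; pose P (h : E -> F) := exists f g, [/\ smooth_on D f, smooth_on D g &
  forall e, D e -> h e = f e + a *: g e].
apply: (@smooth_on_coind _ _ _ P); last by exists f, g.
move=> h [f' [g' [sf' sg' hE]]].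
have near_h e : D e -> \near e, (f' + a *: g') e = h e.
  by move=> De; apply: filterS (open_nbhs_nbhs (conj oD De)) => x /hE ->.
have d e : D e -> differentiable (f' + a *: g') e.
  move=> De; apply: differentiableD; first exact: smooth_on_differentiable sf' De.
  by apply: differentiableZ; exact: smooth_on_differentiable sg' De.
split=> [e De|v].
  by apply: near_eq_differentiable (near_h _ De) _; exact: d.
exists ('D_v f'), ('D_v g'); split; [exact: smooth_on_derive|exact: smooth_on_derive|].
move=> e De; rewrite -(near_eq_derive v (near_h _ De)).
have df := @diff_derivable _ _ _ _ _ v (smooth_on_differentiable sf' De).
have dg := @diff_derivable _ _ _ _ _ v (smooth_on_differentiable sg' De).
by rewrite deriveD// ?deriveZ//; exact: derivableZ.
Qed.

Lemma smooth_on_affine E F (D : set E) (L : {linear E -> F}) (c : F) :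
  continuous L -> smooth_on D (fun x => L x + c).
Proof.
(* One derivative turns an affine map into a constant, hence the second alternative. *)
move=> cL; pose P (h : E -> F) := (exists c, h = fun x => L x + c) \/ exists c, h = cst c :> (E -> F).
apply: (@smooth_on_coind _ _ _ P); last by left; exists c.
move=> h [[c' ->]|[c' ->]].
  have H e := diff_linD c' cL (@ex_diff _ _ _ _ _ _ _ (@is_diff_id _ _ e)).
  split=> [e _|v]; first by case: (H e).
  right; exists (L v); apply/funext => e; have [d1 d2] := H e.
  by rewrite deriveE// d2 diff_val.
split=> [e _|v]; first exact: differentiable_cst.
by right; exists 0; apply/funext => e; rewrite derive_cst.
Qed.

Lemma is_diff_fst E F (x : E * F) : is_diff x fst fst.
Proof.
have c : continuous (fst : E * F -> E) by move=> y; exact: cvg_fst.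
by apply: DiffDef; [exact: linear_differentiable|rewrite diff_lin].
Qed.

Lemma is_diff_snd E F (x : E * F) : is_diff x snd snd.
Proof.
have c : continuous (snd : E * F -> F) by move=> y; exact: cvg_snd.
by apply: DiffDef; [exact: linear_differentiable|rewrite diff_lin].
Qed.

Lemma diff_scale_pair E F (f0 f1 : E -> F) (sq : R * E) :
  differentiable f0 sq.2 -> differentiable f1 sq.2 ->
  differentiable (fun sq : R * E => f0 sq.2 + sq.1 *: f1 sq.2) sq /\
  forall v, 'd (fun sq : R * E => f0 sq.2 + sq.1 *: f1 sq.2) sq v =
     'd f0 (sq.2) (v.2) + (sq.1 *: 'd f1 (sq.2) (v.2) + v.1 *: f1 sq.2).
Proof.
move=> d0 d1.
have pf : bilinear_for (GRing.Scale.Law.clone _ _ *:%R _) (GRing.Scale.Law.clone _ _ *:%R _)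
    (fun (a : R) (v : F) => a *: v).
  split=> [u'|u] a x y /=; first by rewrite scalerDl scalerA.
  by rewrite scalerDr !scalerA mulrC.
pose bM := bilinear_isBilinear.Build R R F F _ _ (fun (a : R) (v : F) => a *: v) pf.
pose b : {bilinear R -> F -> F} := HB.pack (fun (a : R) (v : F) => a *: v) bM.
have cb : continuous (fun p : R * F => b p.1 p.2) by exact: scale_continuous.
have dfst := is_diff_fst sq; have dsnd := is_diff_snd sq.
have d0' : differentiable (f0 \o snd) sq by apply: differentiable_comp.
have d1' : differentiable (f1 \o snd) sq by apply: differentiable_comp.
have dp : differentiable (fun sq : R * E => (sq.1, (f1 \o snd) sq)) sq.
  by apply: differentiable_pair.
have db := @differentiable_bilin _ _ _ _ b (sq.1, (f1 \o snd) sq) cb.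
pose h := fun sq : R * E => (sq.1, (f1 \o snd) sq).
have E1 : (fun sq : R * E => f0 sq.2 + sq.1 *: f1 sq.2) =
    (f0 \o snd) + ((fun p => b p.1 p.2) \o h) by [].
have e2 := diff_comp dp db.
have e3 := @diff_bilin _ _ _ _ b (h sq) cb.
have e4 := diff_pair (@ex_diff _ _ _ _ _ _ _ dfst) d1'.
have dbh : differentiable ((fun p => b p.1 p.2) \o h) sq by exact: differentiable_comp.
rewrite E1; split; first exact: differentiableD.
have s1 : 'd snd sq = snd :> (R * E -> E) by exact: diff_val.
have s2 : 'd fst sq = fst :> (R * E -> R) by exact: diff_val.
have a0 := diff_comp (@ex_diff _ _ _ _ _ _ _ dsnd) d0.
have a1 := diff_comp (@ex_diff _ _ _ _ _ _ _ dsnd) d1.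
move=> v; rewrite diffD//.
transitivity ('d (f0 \o snd) sq v + 'd ((fun p => b p.1 p.2) \o h) sq v); first by [].
rewrite a0 e2 /= e3 e4 /h /=.
have -> : 'd (fun x : R * E => f1 x.2) sq = 'd f1 (sq.2) \o 'd snd sq :> (R * E -> F) by exact: a1.
have -> : 'd (fun x : R * E => x.1) sq = fst :> (R * E -> R) by exact: s2.
by rewrite /= s1.
Qed.

(** A derivative along [v] keeps the shape: the constant term becomes the derivative of [f0] plus
    [v.1 *: f1], and the coefficient of [sq.1] the derivative of [f1], both along [v.2]. This gives
    smoothness of the contractions jointly in time and parameter. *)
Lemma smooth_on_scale_pair E F (D : set E) (f0 f1 : E -> F) : open D ->
  smooth_on D f0 -> smooth_on D f1 ->
  smooth_on [set sq : R * E | D sq.2] (fun sq : R * E => f0 sq.2 + sq.1 *: f1 sq.2).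
Proof.
move=> oD s0 s1.
pose P (h : R * E -> F) := exists f0 f1, [/\ smooth_on D f0, smooth_on D f1 &
  forall sq, D sq.2 -> h sq = f0 sq.2 + sq.1 *: f1 sq.2].
apply: (@smooth_on_coind _ _ _ P); last by exists f0, f1.
move=> h [g0 [g1 [sg0 sg1 hE]]].
have near_h (sq : R * E) : D sq.2 -> \near sq, g0 sq.2 + sq.1 *: g1 sq.2 = h sq.
  move=> De; have : nbhs sq (snd @^-1` D).
    have oD2 : open (snd @^-1` D : set (R * E)).
      by apply: open_comp => // x _; exact: cvg_snd.
    by apply: (@open_nbhs_nbhs _ sq (snd @^-1` D)); split.
  by apply: filterS => x /hE ->.
split=> [sq De|v].
  apply: near_eq_differentiable (near_h _ De) _.
  by have [] := diff_scale_pair (smooth_on_differentiable sg0 De) (smooth_on_differentiable sg1 De).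
exists (fun x => ('D_(v.2) g0 x) + v.1 *: g1 x), ('D_(v.2) g1).
split.
- by apply: smooth_on_addZ => //; exact: smooth_on_derive.
- exact: smooth_on_derive.
move=> sq De; rewrite -(near_eq_derive v (near_h _ De)).
have dg0 := smooth_on_differentiable sg0 De; have dg1 := smooth_on_differentiable sg1 De.
have [d1 d2] := diff_scale_pair dg0 dg1.
rewrite deriveE// d2 -!deriveE//; rewrite -addrA; congr (_ + _).
by rewrite addrC.
Qed.

End smooth_calculus.

(** * Lipschitz images of null sets *)

Section null_sets.
Variable R : realType.
Local Notation plane := (plane R).
Local Notation leb := (@lebesgue_measure R).
Local Open Scope ereal_scope.

Lemma outer_measure_le_itv (B : set R) (c d : R) : (c <= d)%R -> B `<=` `[c, d]%classic ->
  ((wlength (@idfun R))^*)%mu B <= (d - c)%:E.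
Proof.
move=> cd Bcd; have h := le_outer_measure ((wlength (@idfun R))^*)%mu _ _ Bcd.
apply: (@le_trans _ _ (leb `[c, d]%classic)); first exact: h.
by rewrite lebesgue_measure_itv/=; case: ifPn => _; rewrite lee_fin// subr_ge0.
Qed.

(** If an interval of a cover meets [A] in [x], its part in [A] is mapped to within [L] times its
    length of [h x], hence into an interval [2 * L] times as long. *)
Lemma lipschitz_null (A : set R) (h : R -> R) (L : R) : (0 <= L)%R ->
  (forall x y, A x -> A y -> (`|h x - h y| <= L * `|x - y|)%R) ->
  leb.-negligible A -> leb.-negligible (h @` A).
Proof.
move=> L0 hL /negligible_outer_measure A0; apply/negligible_outer_measure.
apply/eqP; rewrite eq_le outer_measure_ge0 andbT; apply/lee_addgt0Pr => e e0.
rewrite add0e.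
(* Images of intervals lengthen by the factor [2 * L]; the added 1 keeps the denominator positive
   when [L] is 0. *)
have e0' : (0 < e / (2 * L + 1))%R by rewrite divr_gt0//; lra.
have [F [cF AF] Fe] : exists2 F, open_itv_cover A F &
    \sum_(0 <= k <oo) (@wlength R idfun) (F k) <= (e / (2 * L + 1))%:E.
  have := A0; rewrite outer_measure_open_itv_cover => A0'.
  have := @lb_ereal_inf_adherent R
    [set \sum_(k <oo) (@wlength R idfun) (F k) | F in open_itv_cover A] _ e0'.
  rewrite A0' => /(_ isT)[_/= [F AF <-]]; rewrite add0e => Fe.
  by exists F => //; exact: ltW.
apply: (@le_trans _ _ (\sum_(0 <= k <oo) (2 * L)%:E * (@wlength R idfun) (F k))).
  apply: (@le_trans _ _ (((wlength idfun)^*)%mu (\bigcup_k (h @` (A `&` F k))))).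
    apply: le_outer_measure => _ [x Ax <-].
    by have [k _ Fx] := AF x Ax; exists k => //; exists x.
  apply: le_trans (outer_measure_sigma_subadditive _ _) _.
  apply: lee_nneseries => // k _.
  have [[a b] ->] := cF k.
  have [[x [Ax abx]]|AF0] := pselect ((A `&` `]a, b[%classic) !=set0); last first.
    have -> : A `&` `]a, b[%classic = set0 by apply/seteqP; split => // x Fx; apply: AF0; exists x.
    by rewrite image_set0 outer_measure0; apply: mule_ge0; [rewrite lee_fin; lra|exact: wlength_ge0].
  move: abx; rewrite /= in_itv/= => /andP[ax xb].
  have ab := lt_trans ax xb.
  rewrite wlength_itv/= lte_fin ab -EFinB -EFinM.
  have -> : (2 * L * (b - a) = (h x + L * (b - a)) - (h x - L * (b - a)))%R by ring.
  apply: outer_measure_le_itv.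
    have : (0 <= L * (b - a))%R by apply: mulr_ge0; lra.
    lra.
  move=> _ [y [Ay yab] <-]; move: yab; rewrite /= !in_itv/= => /andP[ay yb].
  have : (`|h y - h x| <= L * (b - a))%R.
    apply: le_trans (hL _ _ Ay Ax) _; apply: ler_wpM2l => //.
    by rewrite ler_norml; apply/andP; split; lra.
  by rewrite ler_norml => /andP[? ?]; apply/andP; split; lra.
rewrite nneseriesZl; last by move=> k _; exact: wlength_ge0.
apply: (@le_trans _ _ ((2 * L)%:E * (e / (2 * L + 1))%:E)).
  by apply: lee_wpmul2l => //; rewrite lee_fin; lra.
rewrite -EFinM lee_fin mulrA ler_pdivrMr; lra.
Qed.

Lemma xsection_set (T1 T2 : Type) (A : set (T1 * T2)) x : xsection A x = [set y | A (x, y)].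
Proof. by apply/seteqP; split => y; [move/xsectionP|move=> ?; apply/xsectionP]. Qed.

Lemma lam2_null_xsection (E : set plane) : measurable E ->
  lam2 R E = 0 <-> {ae leb, forall x, leb (xsection E x) = 0}.
Proof.
move=> mE.
have mf : measurable_fun setT (leb \o xsection E) by exact: measurable_fun_xsection.
have -> : lam2 R E = \int[leb]_x `|(leb \o xsection E) x|.
  by apply: eq_integral => x _; rewrite gee0_abs.
rewrite (ae_eq_integral_abs leb measurableT mf).
by split; apply: filterS => x /=; [exact|move=> h _].
Qed.

Lemma measurable_swap_preimage (E : set plane) : measurable E ->
  measurable (swap @^-1` E : set plane).
Proof. by move=> mE; rewrite -[X in measurable X]setTI; exact: measurable_swap. Qed.

Lemma lam2_swap (E : set plane) : measurable E -> lam2 R (swap @^-1` E) = lam2 R E.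
Proof.
move=> mE; suff : pushforward (lam2 R) (swap : plane -> plane) E = lam2 R E by [].
apply/esym/product_measure_unique => //; first exact: measurable_swap.
move=> mf B C mB mC.
transitivity (lam2 R (C `*` B)).
  by rewrite /pushforward; congr (lam2 R _); apply/seteqP; split => -[x y] [].
by rewrite lam2X// muleC.
Qed.

Lemma negligible_measure_le (A B : set (measurableTypeR R)) : measurable A ->
  A `<=` B -> leb.-negligible B -> leb A = 0.
Proof. by move=> mA AB /(negligibleS AB)/negligibleP; exact. Qed.

Lemma plane_image_measurable (V : set (R * R)) (f : R * R -> R * R) (B : set plane) :
  open V -> (forall q, V q -> {for q, continuous f}) -> set_inj V f ->
  measurable B -> B `<=` V -> measurable (f @` B : set plane).
Proof.
move=> oV cf fI mB BV.
have hR : hausdorff_space (R * R)%type by exact: norm_hausdorff.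
have h := borel_image oV cf hR fI mB BV.
suff H A : <<s @open (R * R)%type >> A -> measurable (A : set plane) by exact: H h.
by rewrite plane_borelE.
Qed.

Section factor.
Variables (Q : set (R * R)) (f : R * R -> R * R) (C : R).
Hypotheses (oQ : open Q) (cf : forall q, Q q -> {for q, continuous f}) (fI : set_inj Q f).
Hypothesis C0 : (0 <= C)%R.
Hypothesis f1_lip : forall q q', Q q -> Q q' ->
  (`|(f q).1 - (f q').1| <= C * (`|q.1 - q'.1| + `|q.2 - q'.2|))%R.
Hypothesis f2_lip : forall q q', Q q -> Q q' ->
  (`|(f q).2 - (f q').2| <= C * (`|q.1 - q'.1| + `|q.2 - q'.2|))%R.
(** A quantitative form of the nonvanishing of the partial derivative of the first component in the
    first variable. *)
Hypothesis f1_colip : forall q q', Q q -> Q q' ->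
  (`|q.1 - q'.1| <= C * (`|(f q).1 - (f q').1| + `|q.2 - q'.2|))%R.

(* [f] factors through [g (x, y) = (f1 (x, y), y)]; each of the two factors moves
   a single coordinate, so that Fubini reduces the claim to Lipschitz maps of the
   line. *)
Lemma null_image_factor (E : set plane) : measurable E -> E `<=` Q ->
  lam2 R E = 0 -> lam2 R (f @` E) = 0.
Proof.
move=> mE EQ E0; pose g (q : R * R) : R * R := ((f q).1, q.2).
have gI : set_inj Q g.
  move=> q q'; rewrite !inE => Qq Qq' [e1 e2].
  have := f1_colip Qq Qq'; rewrite e1 e2 !subrr !normr0 addr0 mulr0 normr_le0 subr_eq0 => /eqP e.
  by case: q q' e e2 {e1 Qq Qq'} => [? ?] [? ?] /= -> ->.
have cg q : Q q -> {for q, continuous g}.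
  move=> Qq; have c1 : {for q, continuous (fst \o f)}.
    by apply: continuous_comp; [exact: cf Qq|exact: cvg_fst].
  have c2 : {for q, continuous (snd : R * R -> R)} by exact: cvg_snd.
  exact: (cvg_pair c1 c2).
have mg : measurable (g @` E : set plane).
  exact: plane_image_measurable oQ cg gI mE EQ.
have mfE : measurable (f @` E : set plane).
  exact: plane_image_measurable oQ cf fI mE EQ.
have g0 : lam2 R (g @` E) = 0.
  rewrite -lam2_swap//; apply/lam2_null_xsection; first exact: measurable_swap_preimage.
  have := E0; rewrite -lam2_swap//.
  move/(lam2_null_xsection (measurable_swap_preimage mE)); apply: filterS => y y0.
  apply: (@negligible_measure_le _ ((fun x => (f (x, y)).1) @` xsection (swap @^-1` E) y)).
  - by apply: measurable_xsection; exact: measurable_swap_preimage.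
  - rewrite !xsection_set => u /= [[a b] Eab [<- /= ba]].
    by exists a; rewrite -?ba.
  - apply: (lipschitz_null C0); last first.
      apply/negligibleP => //; apply: measurable_xsection; exact: measurable_swap_preimage.
    move=> x x'; rewrite !xsection_set /= => /EQ Qx /EQ Qx'.
    by have := f1_lip Qx Qx'; rewrite /= subrr normr0 addr0.
apply/lam2_null_xsection => //; move/(lam2_null_xsection mg): g0.
apply: filterS => u u0.
(* [h] is the second component of [f] along the level set of the first component at [u], as a
   function of [y]. By [f1_colip] a value of [y] determines [x] on this level set; elsewhere [h] has
   the default value 0. *)
pose h y := if pselect (exists2 x, E (x, y) & (f (x, y)).1 = u) is left e
  then (f (projT1 (cid2 e), y)).2 else 0%R.
have hP x y : E (x, y) -> (f (x, y)).1 = u -> h y = (f (x, y)).2.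
  move=> Exy fu; rewrite /h; case: pselect => [e|[]]; last by exists x.
  case: cid2 => x' /= Ex' fu'.
  have := f1_colip (EQ _ Exy) (EQ _ Ex').
  by rewrite /= fu fu' !subrr !normr0 addr0 mulr0 normr_le0 subr_eq0 => /eqP ->.
apply: (@negligible_measure_le _ (h @` xsection (g @` E) u)).
- exact: measurable_xsection.
- rewrite !xsection_set => v /= [[a b] Eab fE]; exists b.
    by exists (a, b) => //; rewrite /g fE.
  by rewrite (hP a b)// fE.
(* On the level set [x] is [C]-Lipschitz in [y], so [|x - x'| + |y - y'|] is at most [C + 1] times
   the change of [y]; the second component costs another factor [C]. *)
- apply: (@lipschitz_null _ _ (C * (C + 1))) => [|y y'|].
  + by apply: mulr_ge0 => //; apply: addr_ge0.
  + rewrite !xsection_set /= => -[[a b] Eab [e1 e2]] [[a' b'] Eab' [e1' e2']].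
    move: e2 e2' => /= e2 e2'; subst y y'; rewrite (hP a b)// (hP a' b')//.
    have := f2_lip (EQ _ Eab) (EQ _ Eab'); have := f1_colip (EQ _ Eab) (EQ _ Eab').
    rewrite /= e1 e1' subrr normr0 add0r => h1 h2.
    apply: le_trans h2 _; rewrite -mulrA; apply: ler_wpM2l => //.
    by rewrite mulrDl mul1r lerD2r.
  + by apply/negligibleP => //; exact: measurable_xsection.
Qed.

End factor.

End null_sets.

(** * Transverse immersions of the plane *)

Section mean_value.
Variable R : realType.

Lemma crd_linear k : linear (@crd R k).
Proof. by move=> a u v; rewrite crdD crdZ. Qed.
HB.instance Definition _ k :=
  GRing.isLinear.Build R 'rV[R]_4 R *%R (@crd R k) (@crd_linear k).

Lemma diff_crd (E : normedModType R) (f : E -> 'rV[R]_4) k e : differentiable f e ->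
  differentiable (crd k \o f) e /\ forall v, 'd (crd k \o f) e v = crd k ('d f e v).
Proof.
move=> df; have dc : differentiable (@crd R k) (f e).
  by apply: linear_differentiable; exact: crd_continuous.
split; first exact: differentiable_comp.
by move=> v; rewrite diff_comp// diff_lin//; exact: crd_continuous.
Qed.

Lemma ball_convex (E : normedModType R) (q0 q w : E) (r t : R) : 0 <= t <= 1 ->
  ball q0 r q -> ball q0 r (q + w) -> ball q0 r (t *: w + q).
Proof.
move=> /andP[t0 t1]; rewrite -!ball_normE /= => h1 h2.
have -> : q0 - (t *: w + q) = (1 - t) *: (q0 - q) + t *: (q0 - (q + w)).
  have -> : q0 - (q + w) = q0 - q - w by rewrite opprD addrA.
  by rewrite scalerBl scale1r [t *: (_ - w)]scalerBr addrA subrK opprD addrA addrAC.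
apply: le_lt_trans (ler_normD _ _) _; rewrite !normrZ (ger0_norm t0) ger0_norm ?subr_ge0//.
have [->|tn0] := eqVneq t 0; first by rewrite subr0 mul1r mul0r addr0.
have tp : 0 < t by rewrite lt_neqAle eq_sym tn0.
have h3 : t * `|q0 - (q + w)| < t * r by rewrite ltr_pM2l.
have h4 : (1 - t) * `|q0 - q| <= (1 - t) * r by apply: ler_wpM2l; [rewrite subr_ge0|exact: ltW].
lra.
Qed.

Lemma mvt_ball (E : normedModType R) (f : E -> R) (q0 q w : E) (r : R) :
  (forall x, ball q0 r x -> differentiable f x) -> ball q0 r q -> ball q0 r (q + w) ->
  exists2 x, ball q0 r x & f (q + w) - f q = 'd f x w.
Proof.
move=> df bq bqw; pose h (t : R) := f (t *: w + q).
have dh (t : R) : 0 <= t <= 1 -> differentiable (fun t : R => t *: w + q) t /\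
    'd (fun t : R => t *: w + q) t 1 = w.
  move=> _; have dl : differentiable ( *:%R ^~ w : R -> E) t by exact: ex_diff.
  have E1 : (fun t : R => t *: w + q) = ( *:%R ^~ w : R -> E) + cst q by [].
  rewrite E1; split; first exact: differentiableD.
  by rewrite diffD// diff_cst/= addr0 diff_val scale1r.
have dhf (t : R) : 0 <= t <= 1 -> differentiable h t.
  move=> t01; apply: differentiable_comp; first by case: (dh t t01).
  by apply: df; exact: ball_convex.
have [|||c c01] := @MVT_segment R h (fun t => 'd f (t *: w + q) w) 0 1.
- exact: ler01.
- move=> t; rewrite in_itv/= => /andP[t0 t1].
  have t01 : 0 <= t <= 1 by rewrite !ltW.
  have d1 := dhf t t01; have [d2 d3] := dh t t01.
  have d4 : differentiable f (t *: w + q) by apply: df; exact: ball_convex.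
  apply: DeriveDef; first exact: diff_derivable.
  by rewrite deriveE// diff_comp//= d3.
- apply: continuous_in_subspaceT => t; rewrite inE/= in_itv/= => t01.
  exact: differentiable_continuous (dhf t t01).
rewrite subr0 mulr1 /h scale1r scale0r add0r [w + q]addrC => e.
rewrite in_itv/= in c01.
by exists (c *: w + q) => //; exact: ball_convex.
Qed.

End mean_value.

(** * Quantitative inverse function estimates for transverse charts *)

Section charts.
Variable R : realType.
Implicit Types (V : set (R * R)) (phi : R * R -> 'rV[R]_4).

Definition e1 : R * R := (1, 0).
Definition e2 : R * R := (0, 1).

Lemma diff_e phi q w : differentiable phi q ->
  'd phi q w = w.1 *: 'D_e1 phi q + w.2 *: 'D_e2 phi q.
Proof.
move=> dphi; rewrite (deriveE e1 dphi) (deriveE e2 dphi) -!linearZ -linearD.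
congr ('d phi q _); case: w => a b; rewrite /e1 /e2 /=.
by congr (_, _); rewrite /= /GRing.scale/= ?mulr1 ?mulr0 ?addr0 ?add0r.
Qed.

(** The mean value theorem holds for each coordinate separately, with its own intermediate point;
    hence [a] and [b] come after [q], [q'] and [k] and are only close to the derivatives at [q0]. *)
Lemma increments_aux V phi (D1 D2 : R * R -> 'rV[R]_4) q0 (eta : R) : open V -> V q0 ->
  0 < eta -> (forall q, V q -> differentiable phi q) ->
  (forall q w, V q -> 'd phi q w = w.1 *: D1 q + w.2 *: D2 q) ->
  {for q0, continuous D1} -> {for q0, continuous D2} ->
  exists2 r, 0 < r & ball q0 r `<=` V /\ forall q q' k, ball q0 r q -> ball q0 r q' ->
  exists a b, [/\ `|a - crd k (D1 q0)| < eta, `|b - crd k (D2 q0)| < eta &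
    crd k (phi q' - phi q) = a * (q'.1 - q.1) + b * (q'.2 - q.2)].
Proof.
move=> oV Vq0 eta0 dphi dE c1 c2.
have near_d (D : R * R -> 'rV[R]_4) : {for q0, continuous D} ->
    \forall q \near q0, `|D q0 - D q| < eta.
  by move=> cD; have /cvgrPdist_lt/(_ _ eta0) := cD.
have nV : nbhs q0 V by exact: open_nbhs_nbhs.
have : nbhs q0 (V `&` ([set q | `|D1 q0 - D1 q| < eta] `&` [set q | `|D2 q0 - D2 q| < eta])).
  by apply: filterI => //; apply: filterI; exact: near_d.
move=> /nbhs_ballP[r /= r0 rP].
exists r => //; split; first by move=> q /rP[].
move=> q q' k bq bq'.
have dphi' x : ball q0 r x -> differentiable phi x by move=> /rP[Vx _]; exact: dphi.
have [|||x bx] := @mvt_ball R _ (crd k \o phi) q0 q (q' - q) r.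
- by move=> x /dphi' dx; have [] := diff_crd k dx.
- by [].
- by rewrite addrC subrK.
have [_ ->] := diff_crd k (dphi' _ bx).
rewrite /= [q + _]addrC subrK => e.
have [Vx [n1 n2]] := rP _ bx.
exists (crd k (D1 x)), (crd k (D2 x)); split.
- by rewrite -crdB; apply: le_lt_trans (crd_le_norm _ _) _; rewrite distrC.
- by rewrite -crdB; apply: le_lt_trans (crd_le_norm _ _) _; rewrite distrC.
- by rewrite crdB e dE// crdD !crdZ mulrC [X in _ + X]mulrC.
Qed.

Lemma increments V phi q0 (eta : R) : open V -> smooth_on V phi -> V q0 -> 0 < eta ->
  exists2 r, 0 < r & ball q0 r `<=` V /\ forall q q' k, ball q0 r q -> ball q0 r q' ->
  exists a b, [/\ `|a - crd k ('D_e1 phi q0)| < eta, `|b - crd k ('D_e2 phi q0)| < eta &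
    crd k (phi q' - phi q) = a * (q'.1 - q.1) + b * (q'.2 - q.2)].
Proof.
move=> oV sphi Vq0 eta0.
have cd v : {for q0, continuous ('D_v phi)}.
  exact: smooth_on_continuous (smooth_on_derive v sphi) Vq0.
apply: (@increments_aux V phi ('D_e1 phi) ('D_e2 phi)) => //.
- by move=> q; exact: smooth_on_differentiable.
- by move=> q w Vq; apply: diff_e; exact: smooth_on_differentiable Vq.
Qed.

(** If the determinant vanishes, [(b1, - a1)] and [(b2, - a2)] lie in the kernel, so all entries are
    0; but then [(1, 0)] lies in the kernel as well. *)
Lemma det_neq0 (a1 b1 a2 b2 : R) :
  (forall w1 w2, w1 * a1 + w2 * b1 = 0 -> w1 * a2 + w2 * b2 = 0 -> w1 = 0 /\ w2 = 0) ->
  a1 * b2 - a2 * b1 != 0.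
Proof.
move=> h; apply/eqP => d0.
have [? ?] := h b1 (- a1) ltac:(ring) ltac:(rewrite -[RHS]oppr0 -d0; ring).
have [? ?] := h b2 (- a2) ltac:(rewrite -[RHS]d0; ring) ltac:(ring).
have [] := h 1 0; try lra.
Qed.

(** The tangent plane meets the horizontal plane trivially; by dimension this is the same as
    spanning R^4 together with it, see [transversalP]. *)
Definition immersed_transversally phi q := forall w, Y ('d phi q w) = 0 -> w = 0.

Lemma transverse_det_aux (L : R * R -> 'rV[R]_4) (D1 D2 : 'rV[R]_4) :
  (forall w, L w = w.1 *: D1 + w.2 *: D2) -> (forall w, Y (L w) = 0 -> w = 0) ->
  crd 1 D1 * crd 3 D2 - crd 3 D1 * crd 1 D2 != 0.
Proof.
move=> LE h; apply: det_neq0 => w1 w2 h1 h2.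
have [] : (w1, w2) = 0 :> R * R; last by move=> -> ->.
by apply: h; rewrite LE /Y !crdD !crdZ /= h1 h2.
Qed.

Lemma transverse_det phi q : differentiable phi q -> immersed_transversally phi q ->
  crd 1 ('D_e1 phi q) * crd 3 ('D_e2 phi q) - crd 3 ('D_e1 phi q) * crd 1 ('D_e2 phi q) != 0.
Proof. by move=> dphi; apply: transverse_det_aux => w; exact: diff_e. Qed.

(** Increments of [phi] are a linear system in the increments of [q], with coefficients near the
    derivatives at [q0]; Cramer's rule solves its y-part. Its two rows come from different
    intermediate points, so its determinant is compared with [d] entry by entry. *)
Lemma chart_estimates V phi q0 : open V -> smooth_on V phi -> V q0 ->
  immersed_transversally phi q0 ->
  exists r C, [/\ 0 < r, 0 <= C, ball q0 r `<=` V &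
    forall q q', ball q0 r q -> ball q0 r q' ->
    [/\ forall k, `|crd k (phi q' - phi q)| <= C * (`|q'.1 - q.1| + `|q'.2 - q.2|),
     `|q'.1 - q.1| <= C * (`|crd 1 (phi q' - phi q)| + `|crd 3 (phi q' - phi q)|) &
     `|q'.2 - q.2| <= C * (`|crd 1 (phi q' - phi q)| + `|crd 3 (phi q' - phi q)|)]].
Proof.
move=> oV sphi Vq0 ti; have := transverse_det (smooth_on_differentiable sphi Vq0) ti.
have := fun eta => @increments V phi q0 eta oV sphi Vq0.
move: ('D_e1 phi q0) ('D_e2 phi q0) => D1 D2 incr; set d := _ - _ => d0.
pose M := `|D1| + `|D2| + 1.
have M1 : 1 <= M by rewrite lerDr.
have M0 : 0 < M by lra.
have dp : 0 < `|d| by rewrite normr_gt0.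
(* The bound 1 keeps the perturbed coefficients below [M]; the other bound makes four product errors
   of size at most [M * eta] add up to at most half the norm of [d]. *)
pose eta := Num.min 1 (`|d| / (8 * M)).
have eta0 : 0 < eta by rewrite lt_min ltr01 divr_gt0//; lra.
have eta1 : eta <= 1 by rewrite ge_min lexx.
have etad : 8 * M * eta <= `|d|.
  by rewrite mulrC -ler_pdivlMr ?ge_min ?lexx ?orbT//; lra.
have [r r0 [rV rP]] := incr _ eta0.
pose C := Num.max (2 * M) (2 * M / `|d|).
have CM : 2 * M <= C by rewrite le_max lexx.
have Cd : 2 * M / `|d| <= C by rewrite le_max lexx orbT.
have bnd k (a : R) v : `|a - crd k v| < eta -> (v = D1 \/ v = D2) -> `|a| <= M.
  move=> ha hv; have : `|a| <= `|a - crd k v| + `|crd k v|.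
    by rewrite -{1}(subrK (crd k v) a) ler_normD.
  have := crd_le_norm k v.
  have := normr_ge0 (D1); have := normr_ge0 (D2).
  by move: ha; case: hv => ->; rewrite /M; lra.
exists r, C; split => //; first by lra.
move=> q q' bq bq'; split.
- move=> k; have [a [b [ha hb ->]]] := rP q q' k bq bq'.
  have hM1 := bnd _ _ _ ha (or_introl erefl); have hM2 := bnd _ _ _ hb (or_intror erefl).
  apply: le_trans (ler_normD _ _) _; rewrite !normrM mulrDr.
  by apply: lerD; apply: ler_wpM2r => //; lra.
all: have [a1' [b1' [ha1 hb1 ->]]] := rP q q' 1%N bq bq'.
all: have [a2' [b2' [ha2 hb2 ->]]] := rP q q' 3%N bq bq'.
all: have hA1 := bnd _ _ _ ha1 (or_introl erefl).
all: have hB1 := bnd _ _ _ hb1 (or_intror erefl).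
all: have hA2 := bnd _ _ _ ha2 (or_introl erefl).
all: have hB2 := bnd _ _ _ hb2 (or_intror erefl).
all: set w1 := q'.1 - q.1; set w2 := q'.2 - q.2.
all: set u := a1' * w1 + b1' * w2; set v := a2' * w1 + b2' * w2.
all: pose d' := a1' * b2' - a2' * b1'.
all: have dd' : `|d' - d| <= 4 * M * eta.
1, 3: have cM k x : (x = D1 \/ x = D2) -> `|crd k x| <= M
  by move=> hx; apply: (bnd k _ x) => //; rewrite subrr normr0.
1, 2: have -> : d' - d = (a1' - crd 1 (D1)) * b2' +
    crd 1 (D1) * (b2' - crd 3 (D2)) -
    (a2' - crd 3 (D1)) * b1' - crd 3 (D1) * (b1' - crd 1 (D2))
    by rewrite /d' /d; ring.
1, 2: have hm (x y : R) (X Y : R) : `|x| <= X -> `|y| <= Y -> 0 <= X -> `|x * y| <= X * Y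
  by move=> hx hy X0; rewrite normrM; apply: ler_pM.
1, 2: have h1 := hm _ _ _ _ (ltW ha1) hB2 (ltW eta0).
1, 2: have h2 := hm _ _ _ _ (cM 1%N D1 (or_introl erefl)) (ltW hb2) (ltW M0).
1, 2: have h3 := hm _ _ _ _ (ltW ha2) hB1 (ltW eta0).
1, 2: have h4 := hm _ _ _ _ (cM 3%N D1 (or_introl erefl)) (ltW hb1) (ltW M0).
1, 2: apply: le_trans (ler_normB _ _) _; apply: le_trans (lerD (ler_normB _ _) (lexx _)) _.
1, 2: apply: le_trans (lerD (lerD (ler_normD _ _) (lexx _)) (lexx _)) _; lra.
all: have hd' : `|d| / 2 <= `|d'|.
1, 3: have := ler_normB d' (d' - d); rewrite opprB addrC subrK; lra.
- have hw : d' * w1 = b2' * u - b1' * v by rewrite /d' /u /v; ring.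
  clearbody u v.
  have hw' : `|d'| * `|w1| <= M * (`|u| + `|v|).
    rewrite -normrM hw mulrDr; apply: le_trans (ler_normB _ _) _; rewrite !normrM.
    by apply: lerD; apply: ler_wpM2r.
  apply: le_trans (_ : 2 * M / `|d| * (`|u| + `|v|) <= _); last first.
    by apply: ler_wpM2r => //; exact: addr_ge0.
  rewrite mulrAC ler_pdivlMr// -mulrA mulrC.
  have := ler_wpM2r (normr_ge0 w1) hd'; lra.
- have hw : d' * w2 = a1' * v - a2' * u by rewrite /d' /u /v; ring.
  clearbody u v.
  have hw' : `|d'| * `|w2| <= M * (`|u| + `|v|).
    rewrite -normrM hw [`|u| + _]addrC mulrDr; apply: le_trans (ler_normB _ _) _; rewrite !normrM.
    by apply: lerD; apply: ler_wpM2r.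
  apply: le_trans (_ : 2 * M / `|d| * (`|u| + `|v|) <= _); last first.
    by apply: ler_wpM2r => //; exact: addr_ge0.
  rewrite mulrAC ler_pdivlMr// -mulrA mulrC.
  have := ler_wpM2r (normr_ge0 w2) hd'; lra.
Qed.

End charts.

(** * Null sets in transverse charts *)

Section chart_null.
Variable R : realType.
Implicit Types (V : set (R * R)) (phi : R * R -> 'rV[R]_4).
Local Notation plane := (plane R).

Definition null_preserving V phi :=
  forall E : set plane, measurable E -> E `<=` V -> lam2 R E = 0%E -> lam2 R ((Y \o phi) @` E) = 0%E.

(** As [a] keeps at least half the norm of [a1], dividing by it recovers [w1] from [a * w1 + b * w2]
    up to a multiple of [w2]. *)
Lemma colipschitz (a1 b1 : R) : a1 != 0 -> exists2 K, 0 <= K & forall a b w1 w2,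
  `|a - a1| < `|a1| / 2 -> `|b - b1| < `|a1| / 2 -> `|w1| <= K * (`|a * w1 + b * w2| + `|w2|).
Proof.
move=> a10; have ap : 0 < `|a1| by rewrite normr_gt0.
have bp := normr_ge0 b1.
exists (2 * (1 + `|a1| + `|b1|) / `|a1|); first by rewrite divr_ge0//; lra.
move=> a b w1 w2 ha hb.
have ha' : `|a1| / 2 <= `|a|.
  have := ler_normB a (a - a1); rewrite opprB addrC subrK; lra.
have hb' : `|b| <= `|a1| + `|b1|.
  have := ler_normD (b - b1) b1; rewrite subrK; lra.
rewrite mulrAC ler_pdivlMr//.
have h1 : `|a| * `|w1| <= `|a * w1 + b * w2| + `|b| * `|w2|.
  rewrite -!normrM; have := ler_normB (a * w1 + b * w2) (b * w2); rewrite addrK; lra.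
have h2 : `|b| * `|w2| <= (`|a1| + `|b1|) * `|w2| by apply: ler_wpM2r.
have h3 : `|a1| / 2 * `|w1| <= `|a| * `|w1| by apply: ler_wpM2r.
have h4 : 0 <= (`|a1| + `|b1|) * `|a * w1 + b * w2| by apply: mulr_ge0 => //; lra.
have h5 := normr_ge0 w2.
lra.
Qed.

Lemma crd_Y_le k (v : 'rV[R]_4) : (k = 1 \/ k = 3)%N -> `|crd k v| <= `|Y v|.
Proof. by rewrite prod_normE => -[->|->]; rewrite le_max lexx ?orbT. Qed.

Lemma inj_of_lip (U : set (R * R)) (f : R * R -> 'rV[R]_4) (C : R) :
  (forall q q', U q -> U q' -> `|f q - f q'| <= C * `|Y (f q - f q')|) ->
  forall q q', U q -> U q' -> Y (f q) = Y (f q') -> f q = f q'.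
Proof.
move=> h q q' Uq Uq' e; have := h _ _ Uq Uq'.
by rewrite YB e subrr normr0 mulr0 normr_le0 subr_eq0 => /eqP.
Qed.

Lemma chart_null V phi q0 : open V -> smooth_on V phi -> V q0 -> immersed_transversally phi q0 ->
  exists r C, [/\ 0 < r, 0 <= C /\ ball q0 r `<=` V, set_inj (ball q0 r) (Y \o phi),
    (forall q q', ball q0 r q -> ball q0 r q' -> `|phi q' - phi q| <= C * `|Y (phi q' - phi q)|)
    & null_preserving (ball q0 r) phi].
Proof.
move=> oV sphi Vq0 ti; have [r1 [C1 [r10 C10 r1V est]]] := chart_estimates oV sphi Vq0 ti.
have := transverse_det (smooth_on_differentiable sphi Vq0) ti.
have := fun eta => @increments R V phi q0 eta oV sphi Vq0.
move: ('D_(e1 R) phi q0) ('D_(e2 R) phi q0) => D1 D2 incr d0.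
(* The nonzero determinant excludes that both partial derivatives of the first y-coordinate vanish;
   the one that does not vanish selects the parameter to solve for. *)
have [r2 [K [r20 K0 colip]]] : exists r2 K, [/\ 0 < r2, 0 <= K &
    (forall q q', ball q0 r2 q -> ball q0 r2 q' ->
      `|q'.1 - q.1| <= K * (`|crd 1 (phi q' - phi q)| + `|q'.2 - q.2|)) \/
    (forall q q', ball q0 r2 q -> ball q0 r2 q' ->
      `|q'.2 - q.2| <= K * (`|crd 1 (phi q' - phi q)| + `|q'.1 - q.1|))].
  have [a0|a0] := eqVneq (crd 1 D1) 0.
    have b0 : crd 1 D2 != 0.
      by apply: contraNneq d0 => ->; rewrite a0 mul0r mulr0 subrr.
    have [K K0 hK] := colipschitz (crd 1 D1) b0.
    have eta0 : 0 < `|crd 1 D2| / 2 by rewrite divr_gt0// normr_gt0.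
    have [r2 r20 [_ r2P]] := incr _ eta0; exists r2, K; split => //; right => q q' bq bq'.
    by have [a [b [ha hb ->]]] := r2P q q' 1%N bq bq'; rewrite [a * _ + _]addrC; exact: hK.
  have [K K0 hK] := colipschitz (crd 1 D2) a0.
  have eta0 : 0 < `|crd 1 D1| / 2 by rewrite divr_gt0// normr_gt0.
  have [r2 r20 [_ r2P]] := incr _ eta0; exists r2, K; split => //; left => q q' bq bq'.
  by have [a [b [ha hb ->]]] := r2P q q' 1%N bq bq'; exact: hK.
pose r := Num.min r1 r2.
have rr1 : ball q0 r `<=` ball q0 r1 by apply: le_ball; rewrite ge_min lexx.
have rr2 : ball q0 r `<=` ball q0 r2 by apply: le_ball; rewrite ge_min lexx orbT.
have r0 : 0 < r by rewrite lt_min r10.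
have rV : ball q0 r `<=` V by move=> q /rr1/r1V.
have w_le q q' : ball q0 r q -> ball q0 r q' ->
    `|q'.1 - q.1| + `|q'.2 - q.2| <= 4 * C1 * `|Y (phi q' - phi q)|.
  move=> /rr1 bq /rr1 bq'; have [_ h1 h2] := est _ _ bq bq'.
  apply: le_trans (lerD h1 h2) _; rewrite -mulrDr -mulrA mulrCA ler_wpM2l//.
  have := @crd_Y_le 1 (phi q' - phi q) (or_introl erefl).
  by have := @crd_Y_le 3 (phi q' - phi q) (or_intror erefl); lra.
have injY : set_inj (ball q0 r) (Y \o phi).
  move=> q q'; rewrite !inE => bq bq' /= e; have := w_le q' q bq' bq.
  rewrite YB e subrr normr0 mulr0 => h.
  have h1 := normr_ge0 (q.1 - q'.1); have h2 := normr_ge0 (q.2 - q'.2).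
  have /eqP : `|q.1 - q'.1| = 0 by lra.
  have /eqP : `|q.2 - q'.2| = 0 by lra.
  rewrite !normr_eq0 !subr_eq0; case: q q' {bq bq' e h h1 h2} => [? ?] [? ?] /=.
  by move=> /eqP -> /eqP ->.
have cY q : ball q0 r q -> {for q, continuous (Y \o phi)}.
  move=> /rV Vq; have cphi := smooth_on_continuous sphi Vq.
  have ck k : {for q, continuous (crd k \o phi)}.
    by apply: continuous_comp; [exact: cphi|exact: crd_continuous].
  exact: (cvg_pair (ck 1%N) (ck 3%N)).
(* By [w_le] the increments of the parameters are at most [4 * C1] times that of [Y]; passing to
   [phi] costs another factor [C1]. *)
exists r, (C1 * (4 * C1)); split => //.
- by split => //; apply: mulr_ge0 => //; apply: mulr_ge0.
- move=> q q' bq bq'; apply: norm_le_crd.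
    by rewrite !mulr_ge0.
  move=> k _; have [h _ _] := est _ _ (rr1 _ bq) (rr1 _ bq').
  by apply: le_trans (h k) _; rewrite -mulrA; apply: ler_wpM2l => //; exact: w_le.
pose C := Num.max C1 K.
have CC1 : C1 <= C by rewrite le_max lexx.
have CK : K <= C by rewrite le_max lexx orbT.
have C0 : 0 <= C by lra.
have lip k q q' : ball q0 r q -> ball q0 r q' ->
    `|crd k (phi q) - crd k (phi q')| <= C * (`|q.1 - q'.1| + `|q.2 - q'.2|).
  move=> bq bq'; have [h _ _] := est _ _ (rr1 _ bq') (rr1 _ bq).
  rewrite -crdB; apply: le_trans (h k) _; by apply: ler_wpM2r.
move=> E mE EQ E0.
case: colip => [colip|colip].
  refine (@null_image_factor R (ball q0 r) (Y \o phi) C (ball_open q0 r) cY injY C0 _ _ _ E mE EQ E0).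
  - by move=> q q' bq bq'; exact: lip.
  - by move=> q q' bq bq'; exact: lip.
  - move=> q q' bq bq' /=; rewrite -crdB.
    apply: le_trans (colip _ _ (rr2 _ bq') (rr2 _ bq)) _; by apply: ler_wpM2r => //; apply: addr_ge0.
(* The remaining case exchanges the two parameters, and [swap] preserves area. *)
have sb q : ball (swap q0) r q -> ball q0 r (swap q) by case: q => a b [h1 h2].
have sc : continuous (swap : R * R -> R * R).
  by move=> q; apply: (cvg_pair (@cvg_snd _ _ _ _ _) (@cvg_fst _ _ _ _ _)).
have := @null_image_factor R (ball (swap q0) r) ((Y \o phi) \o swap) C
  (ball_open (swap q0) r) _ _ C0 _ _ _ (swap @^-1` E).
have -> : ((Y \o phi) \o swap) @` (swap @^-1` E) = (Y \o phi) @` E.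
  apply/seteqP; split => [_ [[a b] /= Eab <-]|_ [[a b] Eab <-]]; first by exists (b, a).
  by exists (b, a).
rewrite lam2_swap//; apply => //.
- move=> q /sb bq; apply: continuous_comp; first exact: sc.
  exact: cY.
- move=> [a b] [a' b']; rewrite !inE => /sb bq /sb bq' e.
  by have [-> ->] := injY (b, a) (b', a') (mem_set bq) (mem_set bq') e.
- by move=> [a b] [a' b'] /sb bq /sb bq' /=; rewrite [`|a - _| + _]addrC; exact: (lip _ _ _ bq bq').
- by move=> [a b] [a' b'] /sb bq /sb bq' /=; rewrite [`|a - _| + _]addrC; exact: (lip _ _ _ bq bq').
- move=> [a b] [a' b'] /sb bq /sb bq' /=; rewrite -crdB.
  apply: le_trans (colip _ _ (rr2 _ bq') (rr2 _ bq)) _; by apply: ler_wpM2r => //; apply: addr_ge0.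
- exact: measurable_swap_preimage.
- by move=> [a b] /EQ bq; case: bq.
Qed.

End chart_null.

(** * Transversals as graphs over the y-plane *)

Section horizontal_scaling.
Variable R : realType.
Implicit Types v w : 'rV[R]_4.

Lemma contraction_continuous (E F : normedModType R) (L : {linear E -> F}) :
  (forall x, `|L x| <= `|x|) -> continuous L.
Proof.
move=> h; apply: bounded_linear_continuous; apply/linear_boundedP.
near=> r => x; apply: le_trans (h x) _; rewrite -{1}[`|x|]mul1r; apply: ler_wpM2r => //.
Unshelve. all: by end_near. Qed.

Lemma X_linear : linear (@X R).
Proof. by move=> a u v; apply: rV4P; rewrite crdD crdZ !crd_row4//= ?crdD ?crdZ; ring. Qed.
HB.instance Definition _ := GRing.isLinear.Build R 'rV[R]_4 'rV[R]_4 *:%R (@X R) X_linear.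

Definition hs (s : R) v := v - s *: X v.

Lemma hs_linear s : linear (hs s).
Proof.
by move=> a u v; apply: rV4P; rewrite /hs X_linear !(crdB, crdD, crdZ, crdN); ring.
Qed.
HB.instance Definition _ s := GRing.isLinear.Build R 'rV[R]_4 'rV[R]_4 *:%R (hs s) (hs_linear s).

Lemma crd_hs k s v : (k < 4)%N -> crd k (hs s v) = (if odd k then 1 else 1 - s) * crd k v.
Proof. by case: k => [|[|[|[|]]]]//= _; rewrite /hs crdB crdZ crd_row4//=; ring. Qed.

Lemma Y_hs s v : Y (hs s v) = Y v.
Proof. by rewrite /Y !crd_hs//= !mul1r. Qed.

Lemma hs0 v : hs 0 v = v.
Proof. by rewrite /hs scale0r subr0. Qed.

Lemma norm_hs s v : 0 <= s <= 1 -> `|hs s v| <= `|v|.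
Proof.
move=> /andP[s0 s1]; apply: norm_le_crd => // k k4; rewrite crd_hs//.
rewrite normrM; apply: le_trans (_ : 1 * `|crd k v| <= _); last by rewrite mul1r crd_le_norm.
by apply: ler_wpM2r => //; case: ifP => _; rewrite ?normr1// ger0_norm; lra.
Qed.

Lemma norm_X v : `|X v| <= `|v|.
Proof.
apply: norm_le_crd => // k k4; rewrite crd_row4//.
by case: k k4 => [|[|[|[|]]]]//= _; rewrite ?normr0// crd_le_norm.
Qed.

Lemma X_continuous : continuous (@X R).
Proof. by apply: contraction_continuous; exact: norm_X. Qed.

Lemma hs_continuous s : 0 <= s <= 1 -> continuous (hs s).
Proof. by move=> s01; apply: contraction_continuous => v; exact: norm_hs. Qed.

Definition iota (y : R * R) : 'rV[R]_4 := row4 0 y.1 0 y.2.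

Lemma iota_linear : linear iota.
Proof. by move=> a u v; apply: rV4P; rewrite crdD crdZ !crd_row4//=; ring. Qed.
HB.instance Definition _ := GRing.isLinear.Build R (R * R)%type 'rV[R]_4 *:%R iota iota_linear.

Lemma norm_iota y : `|iota y| <= `|y|.
Proof.
apply: norm_le_crd => // k k4; rewrite crd_row4// prod_normE.
by case: k k4 => [|[|[|[|]]]]//= _; rewrite le_max ?normr0 ?normr_ge0 ?lexx ?orbT.
Qed.

Lemma iota_continuous : continuous iota.
Proof. by apply: contraction_continuous; exact: norm_iota. Qed.

Lemma Y_iota y : Y (iota y) = y.
Proof. by rewrite /Y !crd_row4//=; case: y. Qed.

Lemma hs1 v : hs 1 v = iota (Y v).
Proof. by apply: rV4P; rewrite crd_hs// crd_row4//= ; ring. Qed.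

Lemma Y_continuous : continuous (@Y R).
Proof. by move=> v; exact: (cvg_pair (@crd_continuous R 1%N v) (@crd_continuous R 3%N v)). Qed.

End horizontal_scaling.

(** * Good charts and the transversality condition *)

Section transversality.
Variable R : realType.
Implicit Types (V W : set (R * R)) (phi : R * R -> 'rV[R]_4).
Local Notation g := (example R).

(** Preimages of the two basis vectors of the y-plane form an inverse matrix, so the product of the
    determinants is 1. Multiplying a kernel vector by this product shows that it is 0. *)
Lemma transverse_surj (L : R * R -> 'rV[R]_4) (D1 D2 : 'rV[R]_4) :
  (forall w, L w = w.1 *: D1 + w.2 *: D2) ->
  (forall v, exists w h, horizontal h /\ v = L w + h) -> forall w, Y (L w) = 0 -> w = 0.
Proof.
move=> LE h; have YL w : Y (L w) = (w.1 * crd 1 D1 + w.2 * crd 1 D2, w.1 * crd 3 D1 + w.2 * crd 3 D2).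
  by rewrite LE /Y !crdD !crdZ.
have hit v : exists w, Y (L w) = Y v.
  by have [w [k [/horizontalP k0 ->]]] := h v; exists w; rewrite YD k0 addr0.
have [[a b]] := hit (iota (1, 0)); have [[c d]] := hit (iota (0, 1)).
rewrite !YL !Y_iota /=; set a1 := crd 1 D1; set a2 := crd 3 D1; set b1 := crd 1 D2; set b2 := crd 3 D2.
move=> [h1 h2] [h3 h4] [x y]; rewrite YL /= -/a1 -/a2 -/b1 -/b2 => -[k1 k2].
have det : (a1 * b2 - a2 * b1) * (a * d - b * c) = 1.
  have -> : (a1 * b2 - a2 * b1) * (a * d - b * c) =
    (a * a1 + b * b1) * (c * a2 + d * b2) - (a * a2 + b * b2) * (c * a1 + d * b1) by ring.
  by rewrite h1 h2 h3 h4; ring.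
have x0 : x * ((a1 * b2 - a2 * b1) * (a * d - b * c)) = 0.
  have -> : x * ((a1 * b2 - a2 * b1) * (a * d - b * c)) =
    ((x * a1 + y * b1) * b2 - (x * a2 + y * b2) * b1) * (a * d - b * c) by ring.
  by rewrite k1 k2; ring.
have y0 : y * ((a1 * b2 - a2 * b1) * (a * d - b * c)) = 0.
  have -> : y * ((a1 * b2 - a2 * b1) * (a * d - b * c)) =
    ((x * a2 + y * b2) * a1 - (x * a1 + y * b1) * a2) * (a * d - b * c) by ring.
  by rewrite k1 k2; ring.
by rewrite det !mulr1 in x0 y0; rewrite x0 y0.
Qed.

Lemma transverse_inj (L : R * R -> 'rV[R]_4) (D1 D2 : 'rV[R]_4) :
  (forall w, L w = w.1 *: D1 + w.2 *: D2) -> (forall w, Y (L w) = 0 -> w = 0) ->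
  forall v, exists w h, horizontal h /\ v = L w + h.
Proof.
move=> LE h v; have d0 := transverse_det_aux LE h.
set a1 := crd 1 D1 in d0; set a2 := crd 3 D1 in d0.
set b1 := crd 1 D2 in d0; set b2 := crd 3 D2 in d0.
set d := _ - _ in d0; set y1 := crd 1 v; set y2 := crd 3 v.
pose w : R * R := ((y1 * b2 - y2 * b1) / d, (y2 * a1 - y1 * a2) / d).
exists w, (v - L w); split; last by rewrite addrC subrK.
apply/horizontalP; rewrite YB LE /Y !crdD !crdZ /= -/a1 -/a2 -/b1 -/b2 -/y1 -/y2.
by congr (_, _); rewrite /= /d; field; exact: d0.
Qed.

Lemma transversalP phi q : differentiable phi q ->
  (forall v, exists w h, horizontal h /\ v = 'd phi q w + h) <-> immersed_transversally phi q.
Proof.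
by move=> dphi; split; [apply: transverse_surj|apply: transverse_inj] => w; exact: diff_e.
Qed.

Lemma immersed_injective phi q : immersed_transversally phi q -> injective ('d phi q).
Proof.
move=> h w w' e; apply/eqP; rewrite -subr_eq0; apply/eqP; apply: h.
by rewrite linearB /= e subrr /Y !crd0.
Qed.

(* A chart of a transversal that is a small Lipschitz graph over the
   [y]-plane: this shape is inherited by the horizontal contractions of the
   chart onto the plane [x = 0]. *)
Record good V phi : Prop := Good {
  good_open : open V;
  good_smooth : smooth_on V phi;
  good_imm : forall q, V q -> immersed_transversally phi q;
  good_small : exists c, forall q, V q -> `|phi q - c| < 1 / 4;
  good_lip : exists C, 0 <= C /\ forall q q', V q -> V q' ->
    `|phi q - phi q'| <= C * `|Y (phi q - phi q')|;
  good_homeo : forall W q, open W -> W `<=` V -> W q ->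
    exists r, 0 < r /\ forall q', V q' -> `|phi q' - phi q| < r -> W q' }.

Lemma good_continuous V phi q : good V phi -> V q -> {for q, continuous phi}.
Proof. by move=> gV Vq; exact: smooth_on_continuous (good_smooth gV) Vq. Qed.

(** Together with [pr_inj_near], this makes [pr] injective on the points within 1/4 of [c]. *)
Lemma close_lt1 (c v w : 'rV[R]_4) : `|v - c| < 1 / 4 -> `|w - c| < 1 / 4 -> `|v - w| < 1.
Proof.
move=> hv hw; have -> : v - w = (v - c) - (w - c) by apply/rowP => j; rewrite !mxE; ring.
have := ler_normB (v - c) (w - c); lra.
Qed.

Lemma good_phi_inj V phi q q' : good V phi -> V q -> V q' -> phi q = phi q' -> q = q'.
Proof.
move=> gV Vq Vq' e; apply: contrapT => qq'.
(* The continuity of the inverse, applied to [V] without [q'], separates [phi q'] from [phi q]. *)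
have oW : open (V `&` ~` [set q']).
  apply: openI; first exact: good_open gV.
  by apply: closed_openC; apply: accessible_closed_set1; apply: hausdorff_accessible; exact: norm_hausdorff.
have [|//|r [r0 h]] := @good_homeo _ _ gV _ q oW; first by move=> x [].
by have [_ /(_ erefl)] := h q' Vq' ltac:(by rewrite e subrr normr0).
Qed.

Lemma good_pr_inj V phi q q' : good V phi -> V q -> V q' ->
  pr g (phi q) = pr g (phi q') -> q = q'.
Proof.
move=> gV Vq Vq' e; have [c hc] := good_small gV.
apply: good_phi_inj gV _ _ _ => //; apply: pr_inj_near e.
exact: close_lt1 (hc _ Vq) (hc _ Vq').
Qed.

Lemma pr_phi_continuous V phi q : smooth_on V phi -> V q -> {for q, continuous (pr g \o phi)}.
Proof.
move=> sphi Vq; apply: continuous_comp; first exact: smooth_on_continuous sphi Vq.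
exact: pr_continuous.
Qed.

Lemma good_param V phi : good V phi -> parametrization ((pr g \o phi) @` V) V phi.
Proof.
move=> gV; split.
- exact: good_open gV.
- exact: good_smooth gV.
- by move=> q Vq; apply: immersed_injective; exact: good_imm gV _ Vq.
- by move=> q q'; rewrite !inE => Vq Vq'; exact: good_pr_inj gV Vq Vq'.
move=> W oW WV; have [c hc] := good_small gV.
(* The ball around [c] singles out one lift: points near [c] with the same projection coincide. *)
pose O := ball c (1 / 4) `&` [set v | exists q r, [/\ W q, ball (phi q) r v &
  forall q', V q' -> `|phi q' - phi q| < r -> W q']].
have oO : open O.
  apply: openI; first exact: ball_open.
  rewrite openE => v [q [r [Wq bv h]]].
  have : nbhs v (ball (phi q) r) by apply: open_nbhs_nbhs; split => //; exact: ball_open.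
  by apply: filterS => v' bv'; exists q, r.
exists (pr g @` O); first exact: pr_open.
apply/seteqP; split => p.
  move=> [q Wq <-]; split; first by exists q => //; exact: WV.
  have [r [r0 h]] := good_homeo gV oW WV Wq.
  exists (phi q) => //; split.
    by rewrite -ball_normE /= distrC; apply: hc; exact: WV.
  by exists q, r; split => //; exact: ballxx.
move=> [[q' Vq' <-] [v [bv [q [r [Wq bqv h]]]] e]].
have vE : v = phi q'.
  apply: pr_inj_near e; apply: (@close_lt1 c); last exact: hc.
  by rewrite distrC; move: bv; rewrite -ball_normE.
exists q' => //; apply: (h q' Vq').
by rewrite -vE distrC; move: bqv; rewrite -ball_normE.
Qed.

(** Two charts lift the same piece of [S], so they differ pointwise by lattice vectors. Near [q1]
    the vector is constant, because [phi1] stays within 1/4 of [c + lat R n]. *)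
Lemma param_near S U V phi V1 phi1 q1 : good V phi -> open U -> S `&` U = (pr g \o phi) @` V ->
  parametrization S V1 phi1 -> V1 q1 -> U (pr g (phi1 q1)) ->
  exists n V', [/\ open V', V' `<=` V1, V' q1 &
    forall q', V' q' -> exists q'', V q'' /\ phi1 q' = phi q'' + lat R n].
Proof.
move=> gV oU SU [oV1 s1 inj1 sinj1 hom1] V1q1 Uq1.
have inS q : V1 q -> S (pr g (phi1 q)).
  have [U0 oU0 e] := hom1 V1 oV1 (fun _ => id) => Vq.
  have : ((pr g \o phi1) @` V1) (pr g (phi1 q)) by exists q.
  by rewrite e => -[].
have [c hc] := good_small gV.
have : (S `&` U) (pr g (phi1 q1)) by split => //; exact: inS.
rewrite SU => -[q0 Vq0 /esym/pr_eq[n e0]].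
exists n, (V1 `&` phi1 @^-1` ((pr g @^-1` U) `&` ball (c + lat R n) (1 / 4))); split.
- apply: open_preimage_on => //; first by move=> q; exact: smooth_on_continuous.
  by apply: openI => //; exact: ball_open.
- by move=> q [].
- split => //; split => //; rewrite -ball_normE /= e0 distrC.
  by rewrite opprD addrACA subrr addr0; exact: hc.
move=> q' [V1q' [Uq' bq']].
have : (S `&` U) (pr g (phi1 q')) by split => //; exact: inS.
rewrite SU => -[q'' Vq'' e]; exists q''; split => //.
suff -> : phi q'' = phi1 q' - lat R n by rewrite subrK.
have e' : pr g (phi q'') = pr g (phi1 q' - lat R n) by rewrite -latN pr_lat.
apply: pr_inj_near e'; apply: (@close_lt1 c); first exact: hc.
move: bq'; rewrite -ball_normE /= distrC.
by rewrite opprD addrA addrAC.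
Qed.

(* The difference quotients of [phi1] satisfy the Lipschitz bound of the graph. *)
Lemma tangent_transverse S U V phi V1 phi1 q1 : good V phi -> open U ->
  S `&` U = (pr g \o phi) @` V -> parametrization S V1 phi1 -> V1 q1 ->
  U (pr g (phi1 q1)) -> immersed_transversally phi1 q1.
Proof.
move=> gV oU SU p1 V1q1 Uq1; have [n [V' [oV' V'V1 V'q1 hV']]] := param_near gV oU SU p1 V1q1 Uq1.
have [oV1 s1 inj1 _ _] := p1; have [C [C0 hC]] := good_lip gV.
have lip q : V' q -> `|phi1 q - phi1 q1| <= C * `|Y (phi1 q - phi1 q1)|.
  move=> /hV'[a [Va ->]]; have [b [Vb ->]] := hV' _ V'q1.
  by rewrite opprD addrACA subrr addr0; exact: hC.
move=> w Yw; have d1 := smooth_on_differentiable s1 V1q1.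
have dw : derivable phi1 q1 w by exact: diff_derivable.
suff : 'd phi1 q1 w = 0.
  by rewrite -[RHS](linear0 ('d phi1 q1)) => /(inj1 _ V1q1).
rewrite -deriveE// in Yw *.
pose u (h : R) := h^-1 *: (phi1 (h *: w + q1) - phi1 q1).
have cu : u h @[h --> 0^'] --> 'D_w phi1 q1 by exact: dw.
have cn : `|u h| @[h --> 0^'] --> `|'D_w phi1 q1| by exact: cvg_norm.
have cY : C * `|Y (u h)| @[h --> 0^'] --> C * `|Y ('D_w phi1 q1)|.
  apply: cvgM; first exact: cvg_cst.
  apply: cvg_norm; apply: (cvg_comp _ _ cu); exact: Y_continuous.
have : `|'D_w phi1 q1| <= C * `|Y ('D_w phi1 q1)|.
  apply: (ler_cvg_to cn cY).
  have nV : \forall h \near (0 : R), V' (h *: w + q1).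
    have cl : {for (0 : R), continuous (fun h : R => h *: w + q1)}.
      apply: (@cvgD _ _ _ (nbhs (0 : R)) _ ( *:%R ^~ w) (cst q1)); last exact: cvg_cst.
      exact: scalel_continuous.
    by apply: cl; rewrite scale0r add0r; apply: open_nbhs_nbhs; split.
  apply: (@cvg_within _ (nbhs (0 : R))); apply: filterS nV => h Vh.
  rewrite /u; have YZ a v : Y (a *: v) = a *: Y v by rewrite /Y !crdZ.
  rewrite YZ !normrZ mulrCA; apply: ler_wpM2l => //.
  exact: lip.
by rewrite Yw normr0 mulr0 normr_le0 => /eqP.
Qed.

Lemma param_open (S U : set (torus g)) V phi :
  open U -> parametrization (S `&` U) V phi -> parametrization S V phi.
Proof.
move=> oU [oV sV iV injV hV]; split => // W oW WV; have [U' oU' ->] := hV W oW WV.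
by exists (U `&` U'); [exact: openI|rewrite setIA].
Qed.

(** Transversality speaks of every parametrization; one good chart near each point controls all of
    them through [tangent_transverse]. *)
Lemma locally_good_transversal S :
  (forall p, S p -> exists U V phi, [/\ open U, U p, good V phi & S `&` U = (pr g \o phi) @` V]) ->
  Defs.transversal S.
Proof.
move=> h; split.
  move=> p Sp; have [U [V [phi [oU Up gV SU]]]] := h p Sp.
  exists V, phi; split; first by apply: (param_open oU); rewrite SU; exact: good_param.
  by rewrite -SU.
move=> V phi q pV Vq; have [oV sV _ _ hV] := pV.
apply/transversalP; first exact: smooth_on_differentiable sV Vq.
have Sq : S (pr g (phi q)).
  have [U0 oU0 e] := hV V oV (fun _ => id).
  have : ((pr g \o phi) @` V) (pr g (phi q)) by exists q.
  by rewrite e => -[].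
have [U [V' [phi' [oU Up gV' SU]]]] := h _ Sq.
exact: tangent_transverse gV' oU SU pV Vq Up.
Qed.

Lemma good_transversal V phi : good V phi -> Defs.transversal ((pr g \o phi) @` V).
Proof.
move=> gV; apply: locally_good_transversal => p Sp; exists setT, V, phi.
by split => //; [exact: openT|rewrite setIT].
Qed.

End transversality.

(** * Contracting a chart along the leaves *)

Section isotopy.
Variable R : realType.
Local Notation g := (example R).
Implicit Types (V W : set (R * R)) (phi : R * R -> 'rV[R]_4).

Lemma hs_comp_smooth V phi s (c : 'rV[R]_4) : 0 <= s <= 1 -> open V -> smooth_on V phi ->
  smooth_on V (fun q => hs s (phi q) + c).
Proof. by move=> s01 oV sphi; apply: smooth_on_linD => //; exact: hs_continuous. Qed.

Lemma hs_imm V phi s (c : 'rV[R]_4) q : 0 <= s <= 1 -> differentiable phi q ->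
  immersed_transversally phi q -> immersed_transversally (fun q => hs s (phi q) + c) q.
Proof.
move=> s01 dphi h w; have [_ ->] := diff_linD c (hs_continuous s01) dphi.
by rewrite Y_hs; exact: h.
Qed.

Lemma hs_comp0 phi s : (fun q => hs s (phi q)) = (fun q => hs s (phi q) + 0).
Proof. by apply/funext => q; rewrite addr0. Qed.

(** The contraction fixes [Y] and does not increase norms, so the graph bound survives. The inverse
    stays continuous because closeness of [Y] alone controls [phi]. *)
Lemma good_hs V phi s : 0 <= s <= 1 -> good V phi -> good V (fun q => hs s (phi q)).
Proof.
move=> s01 gV; split.
- exact: good_open gV.
- by rewrite hs_comp0; apply: hs_comp_smooth => //; [exact: good_open gV|exact: good_smooth gV].
- move=> q Vq; rewrite hs_comp0; apply: hs_imm => //; last exact: good_imm gV _ Vq.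
  exact: smooth_on_differentiable (good_smooth gV) Vq.
- have [c hc] := good_small gV; exists (hs s c) => q Vq; rewrite -linearB.
  exact: le_lt_trans (norm_hs _ s01) (hc _ Vq).
- have [C [C0 hC]] := good_lip gV; exists C; split => // q q' Vq Vq'.
  by rewrite -linearB /= Y_hs; apply: le_trans (norm_hs _ s01) _; exact: hC.
- move=> W q oW WV Wq; have [r [r0 h]] := good_homeo gV oW WV Wq.
  have [C [C0 hC]] := good_lip gV; have C1 : 0 < C + 1 by lra.
  (* If the contracted points are this close, so are their values of [Y], and the graph bound puts
     the original points within [r]. The added 1 covers the case [C = 0]. *)
  exists (r / (C + 1)); split; first by rewrite divr_gt0.
  move=> q' Vq'; rewrite -linearB /= => hq'; apply: h => //.
  apply: le_lt_trans (hC _ _ Vq' (WV _ Wq)) _.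
  have : `|Y (phi q' - phi q)| < r / (C + 1).
    apply: le_lt_trans hq'; rewrite -(Y_hs s) prod_normE ge_max.
    by rewrite !crd_le_norm.
  rewrite ltr_pdivlMr// mulrDr mulr1 mulrC.
  by have := normr_ge0 (Y (phi q' - phi q)); lra.
Qed.

Section contraction.
Variables (V : set (R * R)) (phi : R * R -> 'rV[R]_4).
Hypothesis gV : good V phi.
Local Notation S0 := ((pr g \o phi) @` V).

(** An isotopy consists of maps of the whole torus; off the image of the chart the identity is a
    default value. *)
Definition contract (s : R) (p : torus g) : torus g :=
  if pselect (exists q, V q /\ pr g (phi q) = p) is left e
  then pr g (hs s (phi (projT1 (cid e)))) else p.

Lemma contract_pr s q : V q -> contract s (pr g (phi q)) = pr g (hs s (phi q)).
Proof.
move=> Vq; rewrite /contract; case: pselect => [e|[]]; last by exists q.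
case: cid => q' /= [Vq' e'].
by rewrite (good_pr_inj gV Vq' Vq e').
Qed.

Lemma contract_image s : contract s @` S0 = (pr g \o (fun q => hs s (phi q))) @` V.
Proof.
apply/seteqP; split.
  by move=> _ [_ [q Vq <-] <-]; exists q => //=; rewrite contract_pr.
by move=> _ [q Vq <-]; exists (pr g (phi q)); [exists q|rewrite contract_pr].
Qed.

Lemma contract_embeds s : 0 <= s <= 1 -> embeds S0 (contract s).
Proof.
move=> s01; have gs := good_hs s01 gV; split.
  move=> p p'; rewrite !inE => -[q Vq <-] [q' Vq' <-] /=; rewrite !contract_pr// => e.
  by rewrite (good_pr_inj gs Vq Vq' e).
move=> V1 phi1 q1 p1 V1q1; have [oV1 s1 inj1 sinj1 hom1] := p1.
have oT : open (setT : set (torus g)) by exact: openT.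
have ST : S0 `&` setT = S0 by rewrite setIT.
have [n [V' [oV' V'V1 V'q1 hV']]] := param_near gV oT ST p1 V1q1 Logic.I.
have hE q q'' : V q'' -> phi1 q = phi q'' + lat R n ->
    hs s (phi1 q) + - hs s (lat R n) = hs s (phi q'').
  by move=> _ ->; rewrite linearD /= addrK.
(* The contraction does not preserve the lattice, so it must act on the lift [phi1 - lat R n], which
   runs in the image of [phi], and not on [phi1]. *)
exists V', (fun q => hs s (phi1 q) + - hs s (lat R n)); split => //; last first.
  move=> q /hV'[q'' [Vq'' e]]; rewrite (hE _ _ Vq'' e) e pr_lat.
  by rewrite contract_pr.
have pr1 q q'' : phi1 q = phi q'' + lat R n -> pr g (phi1 q) = pr g (phi q'').
  by move=> ->; rewrite pr_lat.
split => //.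
- by apply: hs_comp_smooth => //; exact: smooth_on_sub V'V1 s1.
- move=> q V'q; apply: immersed_injective; apply: hs_imm => //.
    exact: smooth_on_differentiable s1 (V'V1 _ V'q).
  exact: tangent_transverse gV oT ST p1 (V'V1 _ V'q) Logic.I.
- move=> q q'; rewrite !inE => V'q V'q' /=.
  have [a [Va ea]] := hV' _ V'q; have [b [Vb eb]] := hV' _ V'q'.
  rewrite (hE _ _ Va ea) (hE _ _ Vb eb) => /(good_pr_inj gs Va Vb) ab.
  apply: sinj1; rewrite ?inE; [exact: V'V1|exact: V'V1|].
  by rewrite /= (pr1 _ _ ea) (pr1 _ _ eb) ab.
move=> W oW WV'; have [U oU SU] := hom1 W oW (subset_trans WV' V'V1).
have oW2 : open (V `&` (pr g \o phi) @^-1` U).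
  apply: open_preimage_on => //; first exact: good_open gV.
  by move=> q Vq; exact: pr_phi_continuous (good_smooth gV) Vq.
have [_ _ _ _ homs] := good_param gs.
have [U' oU' e'] := homs _ oW2 (@subIsetl _ _ _).
exists U' => //; rewrite contract_image -e'; apply/seteqP; split => p.
  move=> [q Wq <-]; have [a [Va ea]] := hV' _ (WV' _ Wq).
  exists a; last by rewrite /= (hE _ _ Va ea).
  split => //=; rewrite -(pr1 _ _ ea).
  have : ((pr g \o phi1) @` W) (pr g (phi1 q)) by exists q.
  by rewrite SU => -[].
move=> [a [Va Ua] <-].
have : (S0 `&` U) (pr g (phi a)) by split => //; exists a.
rewrite -SU => -[q Wq e]; exists q => //=.
have [b [Vb eb]] := hV' _ (WV' _ Wq); rewrite (hE _ _ Vb eb).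
have -> // : b = a; apply: (good_pr_inj gV Vb Va).
by rewrite -(pr1 _ _ eb).
Qed.

Lemma contract_isotopy : leafwise_isotopy S0 contract.
Proof.
have oT : open (setT : set (torus g)) by exact: openT.
have ST : S0 `&` setT = S0 by rewrite setIT.
split.
- move=> V1 phi1 p1 [s q1] [/= s01 V1q1]; have [oV1 s1 _ _ _] := p1.
  have [n [V' [oV' V'V1 V'q1 hV']]] := param_near gV oT ST p1 V1q1 Logic.I.
  exists [set sq : R * (R * R) | V' sq.2].
  (* This is [hs s (phi1 - lat R n)], written as affine in [s] to fit [smooth_on_scale_pair]. *)
  exists (fun sq : R * (R * R) => (idfun (phi1 sq.2) + - lat R n) +
    sq.1 *: ((-%R \o @X R) (phi1 sq.2) + X (lat R n))).
  split => //.
  + by apply: open_comp => // x _; exact: cvg_snd.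
  + have sV' := smooth_on_sub V'V1 s1.
    apply: (@smooth_on_scale_pair _ _ _ V' (fun q => idfun (phi1 q) + - lat R n)
      (fun q => (-%R \o @X R) (phi1 q) + X (lat R n))) => //.
      by apply: smooth_on_linD => // x; exact: cvg_id.
    apply: smooth_on_linD => // x.
    by apply: continuous_comp; [exact: X_continuous|exact: opp_continuous].
  + move=> [s' q'] [[/= s'01 V1q'] V'q'].
    have [q'' [Vq'' e]] := hV' _ V'q'.
    rewrite e pr_lat contract_pr//; congr (pr g _).
    have XD : X (phi q'' + lat R n) = X (phi q'') + X (lat R n) by exact: linearD.
    by rewrite /hs /= XD opprD addrK subrK scalerN.
- by move=> p [q Vq <-]; rewrite contract_pr// hs0.
- move=> s s01; split; first exact: contract_embeds.
  by rewrite contract_image; apply: good_transversal; exact: good_hs.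
- move=> L s p [c ->] s01 [q Vq <-] [v vc e]; rewrite contract_pr//.
  have /pr_eq[n vE] := e; exists (hs s (phi q) + lat R n); last by rewrite pr_lat.
  move=> j; rewrite -(vc j) vE.
  have hsj : hs s (phi q) 0 (y_coord j) = phi q 0 (y_coord j).
    have j4 : (j.*2.+1 < 4)%N by case: j => [] [|[|]].
    by have := crd_hs s (phi q) j4; rewrite /crd /= odd_double mul1r.
  by rewrite mxE hsj [in RHS]mxE.
Qed.

Lemma contract1_image B : B `<=` V ->
  contract 1 @` ((pr g \o phi) @` B) = (pr g \o @iota R) @` ((Y \o phi) @` B).
Proof.
move=> BV; apply/seteqP; split.
  move=> _ [_ [q Bq <-] <-]; exists (Y (phi q)); first by exists q.
  by rewrite /= contract_pr ?hs1//; exact: BV.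
move=> _ [_ [q Bq <-] <-]; exists (pr g (phi q)); first by exists q.
by rewrite /= contract_pr ?hs1//; exact: BV.
Qed.

Lemma good_borel (B : set (plane R)) : measurable B -> B `<=` V ->
  <<s @open (torus g) >> ((pr g \o phi) @` B).
Proof.
move=> mB BV; apply: (@borel_image R (torus g) V (pr g \o phi) (good_open gV) _
  (@torus_hausdorff R) _ B mB BV).
  by move=> q Vq; exact: pr_phi_continuous (good_smooth gV) Vq.
by move=> q q'; rewrite !inE => Vq Vq'; exact: good_pr_inj gV Vq Vq'.
Qed.

Lemma good_transversal_borel (B : set (plane R)) : measurable B -> B `<=` V ->
  transversal_borel ((pr g \o phi) @` B).
Proof.
move=> mB BV; split; first exact: good_borel.
by exists S0; [exact: good_transversal gV|exact: image_subset].
Qed.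

Lemma transverse_measure_chart (nu : {measure set (transverse_sets g) -> \bar R})
    (B : set (plane R)) : transverse_measure nu -> measurable B -> B `<=` V ->
  nu ((pr g \o phi) @` B) = nu ((pr g \o @iota R) @` ((Y \o phi) @` B)).
Proof.
move=> tnu mB BV; rewrite -contract1_image//; apply/esym.
apply: (tm_invariant tnu (good_transversal gV) contract_isotopy).
  exact: image_subset.
exact: good_transversal_borel.
Qed.

End contraction.

End isotopy.

(** * Density of the holonomy group *)

Section kronecker.
Variable R : realType.
Implicit Types n : 'rV[int]_4.
Local Notation s2 := (Num.sqrt (2 : R)).
Local Notation s5 := (Num.sqrt (5 : R)).

(** For nonzero [x] the exponent of [p] is even on the left and odd on the right. *)
Lemma sqr_prime_multiple (p c x y : nat) : prime p -> ~~ (p %| c)%N ->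
  (y ^ 2 = p * c * x ^ 2)%N -> x = 0%N.
Proof.
move=> pp pc e; apply/eqP; apply: contraTT isT => x0.
have x_gt0 : (0 < x)%N by rewrite lt0n.
have c_gt0 : (0 < c)%N by rewrite lt0n; apply: contraNneq pc => ->; rewrite dvdn0.
have p_gt0 := prime_gt0 pp.
have := congr1 (logn p) e.
rewrite lognX lognM ?muln_gt0 ?expn_gt0 ?p_gt0 ?c_gt0 ?x_gt0// lognM// lognX.
have -> : logn p c = 0%N.
  by apply/eqP; rewrite -leqn0 leqNgt logn_gt0 mem_primes pp c_gt0.
by rewrite (logn_prime p pp) eqxx; lia.
Qed.

Lemma sqr_int_multiple (p c : nat) (x y : int) : prime p -> ~~ (p %| c)%N ->
  y ^+ 2 = (p * c)%:R * x ^+ 2 -> x = 0.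
Proof.
move=> pp pc e; apply/eqP; rewrite -absz_eq0; apply/eqP.
apply: (@sqr_prime_multiple p c _ `|y|%N pp pc).
have := congr1 absz e; rewrite abszM !abszX => ->.
by congr (_ * _)%N; rewrite natz absz_nat.
Qed.

(** Squaring the relation solved for [a] expresses an integer as [2 * b * c] times the root of 10.
    Squaring again forces [b * c = 0], and the irrationality of the roots of 5 and 2 settles the two
    cases. *)
Lemma sqrt_independent (a b c : int) : a%:~R + b%:~R * s2 + c%:~R * s5 = 0 ->
  [/\ a = 0, b = 0 & c = 0].
Proof.
move=> e.
have h2 : s2 ^+ 2 = 2 by rewrite sqr_sqrtr.
have h5 : s5 ^+ 2 = 5 by rewrite sqr_sqrtr.
have E1 : ((a ^+ 2 - 2 * b ^+ 2 - 5 * c ^+ 2)%:~R : R) ^+ 2 = 10 * ((2 * b * c)%:~R) ^+ 2.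
  have ha : (a%:~R : R) = - (b%:~R * s2 + c%:~R * s5).
    by apply/eqP; rewrite -addr_eq0 addrA e.
  have -> : (a ^+ 2 - 2 * b ^+ 2 - 5 * c ^+ 2)%:~R = 2 * b%:~R * c%:~R * (s2 * s5) :> R.
    rewrite !(rmorphB, rmorphM, rmorphXn) /= ha.
    transitivity (2 * b%:~R * c%:~R * (s2 * s5) + b%:~R ^+ 2 * (s2 ^+ 2 - 2) +
      c%:~R ^+ 2 * (s5 ^+ 2 - 5) : R); first by ring.
    by rewrite h2 h5; ring.
  rewrite exprMn [(s2 * s5) ^+ 2]exprMn h2 h5 !rmorphM /=; ring.
have E2 : (a ^+ 2 - 2 * b ^+ 2 - 5 * c ^+ 2) ^+ 2 = (5 * 2)%:R * (2 * b * c) ^+ 2.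
  apply: (@intr_inj R); rewrite [LHS]rmorphXn [RHS]rmorphM [in RHS]rmorphXn [LHS]E1.
  by congr (_ * _); rewrite rmorph_nat.
have bc0 := @sqr_int_multiple 5 2 _ _ isT isT E2.
have /orP[/eqP b0|/eqP c0] : (b == 0) || (c == 0).
  by move/eqP: bc0; rewrite !mulf_eq0 /=.
- have E3 : a ^+ 2 = (5 * 1)%:R * c ^+ 2.
    have ha : (a%:~R : R) = - (c%:~R * s5).
      by apply/eqP; rewrite -addr_eq0 -[X in _ == X]e b0 mul0r addr0.
    apply: (@intr_inj R); rewrite [LHS]rmorphXn [RHS]rmorphM [in RHS]rmorphXn /= ha.
    by rewrite sqrrN exprMn h5 mulrC; congr (_ * _); rewrite rmorph_nat.
  have c0 := @sqr_int_multiple 5 1 _ _ isT isT E3.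
  split => //; move: e; rewrite b0 c0 !mul0r !addr0 => /eqP.
  by rewrite intr_eq0 => /eqP.
- have E3 : a ^+ 2 = (2 * 1)%:R * b ^+ 2.
    have ha : (a%:~R : R) = - (b%:~R * s2).
      by apply/eqP; rewrite -addr_eq0 -[X in _ == X]e c0 mul0r addr0.
    apply: (@intr_inj R); rewrite [LHS]rmorphXn [RHS]rmorphM [in RHS]rmorphXn /= ha.
    by rewrite sqrrN exprMn h2 mulrC; congr (_ * _); rewrite rmorph_nat.
  have b0 := @sqr_int_multiple 2 1 _ _ isT isT E3.
  split => //; move: e; rewrite b0 c0 !mul0r !addr0 => /eqP.
  by rewrite intr_eq0 => /eqP.
Qed.

Definition irow4 (a b c d : int) : 'rV[int]_4 := \row_j nth 0 [:: a; b; c; d] j.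

Lemma icrd_irow4 a b c d k : (k < 4)%N -> icrd k (irow4 a b c d) = nth 0 [:: a; b; c; d] k.
Proof. by move=> k4; rewrite /icrd mxE inordK. Qed.

Lemma Y_lat n : Y (lat R n) = ((icrd 1 n)%:~R + s5 * (icrd 2 n)%:~R, s2 * (icrd 2 n)%:~R + (icrd 3 n)%:~R).
Proof. by rewrite /Y; have [_ -> _ ->] := crd_lat R n. Qed.

Lemma floor_frac (x : R) : 0 <= x - (Num.floor x)%:~R < 1.
Proof.
have /andP[h1 h2] := floor_itv x.
by rewrite subr_ge0 h1 /= ltrBlDl -[X in _ + X]/(1%:~R) -intrD.
Qed.

(* Dirichlet's pigeonhole argument. *)
Lemma dirichlet (e : R) : 0 < e -> exists n, icrd 2 n != 0 /\ `|Y (lat R n)| < e.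
Proof.
move=> e0; pose N := (Num.truncn e^-1).+1.
have N0 : (0 : R) < N%:R by rewrite ltr0n.
have Ne : N%:R^-1 < e by rewrite -[X in _ < X]invrK ltf_pV2 ?posrE ?invr_gt0// truncnS_gt.
pose fr (x : R) := x - (Num.floor x)%:~R.
have cell_lt (x : R) : (`|Num.floor (N%:R * fr x)| < N)%N.
  have /andP[f0 f1] := floor_frac x.
  have h0 : 0 <= N%:R * fr x by rewrite mulr_ge0// ltW.
  have fl0 : (0 <= Num.floor (N%:R * fr x))%R by rewrite floor_ge0.
  rewrite -ltz_nat gez0_abs// floor_lt_int.
  by rewrite -[X in _ < X]mulr1 -pmulrn ltr_pM2l.
pose cell x := Ordinal (cell_lt x).
have cellP x y : cell x = cell y -> `|fr x - fr y| < N%:R^-1.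
  move=> /(congr1 val) /= exy.
  have fl z : 0 <= Num.floor (N%:R * fr z).
    by have /andP[f0 _] := floor_frac z; rewrite floor_ge0; apply: mulr_ge0 => //; exact: ltW.
  have fxy : Num.floor (N%:R * fr x) = Num.floor (N%:R * fr y).
    by rewrite -[LHS]gez0_abs// -[RHS]gez0_abs// exy.
  have := floor_frac (N%:R * fr x); have := floor_frac (N%:R * fr y); rewrite fxy.
  move=> /andP[a1 a2] /andP[b1 b2].
  have : `|N%:R * (fr x - fr y)| < 1 by rewrite mulrBr ltr_norml; apply/andP; split; lra.
  by rewrite normrM gtr0_norm// -ltr_pdivlMl// mulr1.
pose f (i : 'I_(N * N).+1) := (cell (s5 * i%:R), cell (s2 * i%:R)).
have /injectivePn[i [j ij fij]] : ~~ injectiveb f.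
  apply/negP => /injectiveP/leq_card.
  by rewrite card_prod !card_ord ltnn.
(* With [i - j] as coefficient of the third row, these integers leave the differences of the
   fractional parts as y-coordinates. *)
pose dl (x : R) : int := Num.floor (x * j%:R) - Num.floor (x * i%:R).
exists (irow4 0 (dl s5) ((i : nat)%:Z - (j : nat)%:Z) (dl s2)).
rewrite icrd_irow4//=; split.
  rewrite subr_eq0; apply: contra ij => /eqP[e1]; apply/eqP; exact: val_inj.
have h1 := cellP _ _ (congr1 fst fij : cell _ = cell _).
have h2 := cellP _ _ (congr1 snd fij : cell _ = cell _).
rewrite Y_lat !icrd_irow4//= prod_normE gt_max /=; apply/andP; split; apply: lt_trans Ne.
  move: h1; rewrite /fr /dl; congr (`|_| < _); rewrite !intrB -!pmulrn; ring.
move: h2; rewrite /fr /dl; congr (`|_| < _); rewrite !intrB -!pmulrn; ring.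
Qed.

(** If the two vectors were dependent, [sqrt_independent] applied to their determinant would make
    the integer coefficients proportional, so that [Y (lat R n')] would have norm at least that of
    [Y (lat R n)] divided by the norm of [icrd 2 n]. The second vector is chosen shorter than
    this. *)
Lemma small_independent (e : R) : 0 < e -> exists n n',
  [/\ `|Y (lat R n)| < e, `|Y (lat R n')| < e &
  (Y (lat R n)).1 * (Y (lat R n')).2 - (Y (lat R n')).1 * (Y (lat R n)).2 != 0].
Proof.
move=> e0; have [n [k0 ne]] := dirichlet e0.
have nz (m : 'rV[int]_4) : icrd 2 m != 0 -> 0 < `|Y (lat R m)|.
  move=> m0; rewrite normr_gt0; apply: contra m0 => /eqP; rewrite Y_lat => -[h _].
  have [|_ _ ->] := @sqrt_independent (icrd 1 m) 0 (icrd 2 m); last by rewrite eqxx.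
  by rewrite mul0r addr0 mulrC.
have kp : 0 < `|(icrd 2 n)%:~R : R| by rewrite normr_gt0 intr_eq0.
have e1 : 0 < Num.min e (`|Y (lat R n)| / `|(icrd 2 n)%:~R|).
  by rewrite lt_min e0 divr_gt0// nz.
have [n' [k'0]] := dirichlet e1; rewrite lt_min => /andP[n'e n'k].
exists n, n'; split => //; apply/eqP => d0.
move: n'k; rewrite ltr_pdivlMr// ltNge => /negP; apply.
have [A0 B0 C0] : [/\ icrd 1 n * icrd 3 n' - icrd 1 n' * icrd 3 n = 0,
    icrd 1 n * icrd 2 n' - icrd 1 n' * icrd 2 n = 0 &
    icrd 2 n * icrd 3 n' - icrd 2 n' * icrd 3 n = 0].
  apply: sqrt_independent; rewrite -[RHS]d0 !Y_lat /= !(intrB, intrM); ring.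
have -> : `|Y (lat R n')| * `|(icrd 2 n)%:~R| = `|(icrd 2 n')%:~R| * `|Y (lat R n)|.
  rewrite mulrC -!normrZ; congr `|_|; rewrite !Y_lat.
  have B1 : (icrd 1 n)%:~R * (icrd 2 n')%:~R = (icrd 1 n')%:~R * (icrd 2 n)%:~R :> R.
    by rewrite -!intrM; congr (_%:~R); apply/eqP; rewrite -subr_eq0 B0.
  have C1 : (icrd 2 n)%:~R * (icrd 3 n')%:~R = (icrd 2 n')%:~R * (icrd 3 n)%:~R :> R.
    by rewrite -!intrM; congr (_%:~R); apply/eqP; rewrite -subr_eq0 C0.
  congr (_, _); rewrite /= /GRing.scale/= !mulrDr.
    by rewrite [_ * (icrd 1 n')%:~R]mulrC -B1; ring.
  by rewrite C1; ring.
rewrite -[leLHS]mul1r; apply: ler_wpM2r => //.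
by rewrite -intr_norm -[leLHS]/(1%:~R) ler_int; move: k'0; lia.
Qed.

Lemma latZ (z : int) n : lat R (z *: n) = z%:~R *: lat R n.
Proof. by rewrite /lat map_mxZ scalemxAl. Qed.

(** The centre of the target box is a real combination of two independent short vectors. Rounding
    both coefficients down moves each coordinate by at most [d / 4] twice, which stays in the
    box. *)
Lemma kronecker (x : R * R) (d : R) : 0 < d -> exists n,
  (x.1 <= (Y (lat R n)).1 <= x.1 + d) /\ (x.2 <= (Y (lat R n)).2 <= x.2 + d).
Proof.
move=> d0; have e0 : 0 < d / 4 by lra.
have [n [n' []]] := small_independent e0.
rewrite !prod_normE !gt_max => /andP[u1e u2e] /andP[v1e v2e].
set u1 := (Y (lat R n)).1 in u1e *; set u2 := (Y (lat R n)).2 in u2e *.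
set v1 := (Y (lat R n')).1 in v1e *; set v2 := (Y (lat R n')).2 in v2e *.
set D := _ - _ => D0.
pose p1 := x.1 + d / 2; pose p2 := x.2 + d / 2.
pose a := (p1 * v2 - p2 * v1) / D; pose b := (p2 * u1 - p1 * u2) / D.
have hp1 : p1 = a * u1 + b * v1 by rewrite /a /b /D; field; exact: D0.
have hp2 : p2 = a * u2 + b * v2 by rewrite /a /b /D; field; exact: D0.
exists (Num.floor a *: n + Num.floor b *: n').
have -> : Y (lat R (Num.floor a *: n + Num.floor b *: n')) =
    ((Num.floor a)%:~R * u1 + (Num.floor b)%:~R * v1, (Num.floor a)%:~R * u2 + (Num.floor b)%:~R * v2).
  by rewrite latD !latZ /Y !crdD !crdZ.
have fa := floor_frac a; have fb := floor_frac b.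
have bnd (t w : R) : 0 <= t < 1 -> `|w| < d / 4 -> `|t * w| <= d / 4.
  move=> /andP[t0 t1] hw; rewrite normrM ger0_norm//.
  apply: le_trans (ltW hw); rewrite -[leRHS]mul1r; apply: ler_wpM2r => //; exact: ltW.
have := bnd _ _ fa u1e; have := bnd _ _ fb v1e; have := bnd _ _ fa u2e; have := bnd _ _ fb v2e.
rewrite !ler_norml /= => /andP[? ?] /andP[? ?] /andP[? ?] /andP[? ?].
move: hp1 hp2; rewrite /p1 /p2 => hp1 hp2.
by split; apply/andP; split; lra.
Qed.

End kronecker.

(** * Measures on a square giving comparable mass to small boxes *)

Section rectangles.
Variable R : realType.
Local Notation plane := (plane R).

(** Half-open, so that boxes tile without overlap. *)
Definition rect (w : R * R) (a b : R) : set plane :=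
  `]w.1, w.1 + a]%classic `*` `]w.2, w.2 + b]%classic.

Lemma measurable_rect w a b : measurable (rect w a b).
Proof. by apply: measurableX; exact: measurable_itv. Qed.

Lemma rectP w a b y : rect w a b y <-> (w.1 < y.1 <= w.1 + a) /\ (w.2 < y.2 <= w.2 + b).
Proof. by split=> [[]|[]]; rewrite /rect /= !in_itv/=. Qed.

Lemma rect_hsplit w a a' b : 0 <= a -> 0 <= a' ->
  rect w (a + a') b = rect w a b `|` rect (w.1 + a, w.2) a' b.
Proof.
move=> a0 a'0; apply/seteqP; split => y; rewrite /setU /= !rectP /=.
  move=> [/andP[h1 h2] h3]; have [h|h] := leP y.1 (w.1 + a).
    by left; split => //; rewrite h1.
  by right; split => //; apply/andP; split => //; lra.
move=> [[/andP[h1 h2] h3]|[/andP[h1 h2] h3]]; split => //; apply/andP; split; lra.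
Qed.

Lemma rect_vsplit w a b b' : 0 <= b -> 0 <= b' ->
  rect w a (b + b') = rect w a b `|` rect (w.1, w.2 + b) a b'.
Proof.
move=> b0 b'0; apply/seteqP; split => y; rewrite /setU /= !rectP /=.
  move=> [h3 /andP[h1 h2]]; have [h|h] := leP y.2 (w.2 + b).
    by left; split => //; rewrite h1.
  by right; split => //; apply/andP; split => //; lra.
move=> [[h3 /andP[h1 h2]]|[h3 /andP[h1 h2]]]; split => //; apply/andP; split; lra.
Qed.

Lemma rect_lam2 w a b : 0 <= a -> 0 <= b -> lam2 R (rect w a b) = (a * b)%:E.
Proof.
have H (x c : R) : 0 <= c -> lebesgue_measure `]x, x + c]%classic = c%:E.
  move=> c0; rewrite lebesgue_measure_itv/= lte_fin ltrDl; case: ltP => c1.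
    by rewrite -EFinB addrC addKr.
  by congr EFin; lra.
by move=> a0 b0; rewrite /rect lam2X ?H ?EFinM//; exact: measurable_itv.
Qed.

Section uniform.
Variables (mu : {measure set plane -> \bar R}) (w : R * R).
Hypothesis mu_fin : (mu setT < +oo)%E.
(** In the application boxes are moved by a dense group: the gap between [h] and [h'] absorbs the
    approximation error, and 1/8 is the size of the charts in which a box slides along the
    leaves. *)
Hypothesis mu_cell : forall p p' (h h' : R), 0 < h -> h < h' -> h < 1 / 8 ->
  rect p h h `<=` rect w 1 1 -> rect p' h' h' `<=` rect w 1 1 ->
  (mu (rect p h h) <= mu (rect p' h' h'))%E.

Let m (A : set plane) : R := fine (mu A).

Let muE A : measurable A -> mu A = (m A)%:E.
Proof.
move=> mA; rewrite fineK// ge0_fin_numE//; apply: le_lt_trans mu_fin.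
by apply: le_measure => //; rewrite inE.
Qed.

Let m_ge0 A : 0 <= m A. Proof. exact: fine_ge0. Qed.

Let m_le A B : measurable A -> measurable B -> A `<=` B -> m A <= m B.
Proof. by move=> mA mB AB; rewrite -lee_fin -!muE//; apply: le_measure; rewrite ?inE. Qed.

Let mD A B : measurable A -> measurable B -> A `&` B = set0 -> m (A `|` B) = m A + m B.
Proof.
move=> mA mB AB; apply: EFin_inj; rewrite EFinD -!muE//; last exact: measurableU.
exact: measureU.
Qed.

Let hsum v d b p : 0 <= d ->
  m (rect v (p%:R * d) b) = \sum_(i < p) m (rect (v.1 + i%:R * d, v.2) d b).
Proof.
move=> d0; elim: p => [|p IH].
  rewrite big_ord0 mul0r; have -> : rect v 0 b = set0.
    by apply/seteqP; split => // y /rectP[/andP[h1 h2] _]; lra.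
  by rewrite /m measure0.
rewrite big_ord_recr /= -IH -natr1 mulrDl mul1r rect_hsplit ?mulr_ge0// mD//.
- exact: measurable_rect.
- exact: measurable_rect.
- by apply/seteqP; split => // y [/rectP[/andP[h1 h2] _] /rectP[/andP[/= h3 h4] _]]; lra.
Qed.

Let vsum v d a q : 0 <= d ->
  m (rect v a (q%:R * d)) = \sum_(j < q) m (rect (v.1, v.2 + j%:R * d) a d).
Proof.
move=> d0; elim: q => [|q IH].
  rewrite big_ord0 mul0r; have -> : rect v a 0 = set0.
    by apply/seteqP; split => // y /rectP[_ /andP[h1 h2]]; lra.
  by rewrite /m measure0.
rewrite big_ord_recr /= -IH -natr1 mulrDl mul1r rect_vsplit ?mulr_ge0// mD//.
- exact: measurable_rect.
- exact: measurable_rect.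
- by apply/seteqP; split => // y [/rectP[_ /andP[h1 h2]] /rectP[_ /andP[/= h3 h4]]]; lra.
Qed.

Let cell n (i j : nat) := rect (w.1 + i%:R * n%:R^-1, w.2 + j%:R * n%:R^-1) n%:R^-1 n%:R^-1.

Let grid n p q : m (rect w (p%:R * n%:R^-1) (q%:R * n%:R^-1)) =
  \sum_(i < p) \sum_(j < q) m (cell n i j).
Proof.
have d0 : 0 <= (n%:R^-1 : R) by rewrite invr_ge0.
by rewrite hsum//; apply: eq_bigr => i _; rewrite vsum.
Qed.

Let M := m (rect w 1 1).

Let cell_sub n i j : (0 < n)%N -> (i < n)%N -> (j < n)%N -> cell n i j `<=` rect w 1 1.
Proof.
move=> n0 ni nj y /rectP[/= /andP[h1 h2] /andP[h3 h4]].
have H (k : nat) : (k < n)%N -> 0 <= (k%:R * n%:R^-1 : R) /\ k%:R * n%:R^-1 + n%:R^-1 <= (1 : R).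
  move=> kn; split; first by rewrite mulr_ge0.
  by rewrite -[X in _ + X]mul1r -mulrDl ler_pdivrMr ?ltr0n// mul1r natr1 ler_nat.
have [a1 a2] := H _ ni; have [b1 b2] := H _ nj.
apply/rectP; move: h1 h2 h3 h4 a1 a2 b1 b2.
move: (i%:R * n%:R^-1 : R) (j%:R * n%:R^-1 : R) (n%:R^-1 : R) => x z t *.
by split; apply/andP; split; lra.
Qed.

Let cell_le n n' i j i' j' : (8 < n')%N -> (n < n')%N -> (0 < n)%N -> (i < n)%N -> (j < n)%N ->
  (i' < n')%N -> (j' < n')%N -> m (cell n' i' j') <= m (cell n i j).
Proof.
move=> n8 nn' n0 ni nj ni' nj'; rewrite -lee_fin -!muE; try exact: measurable_rect.
have n'0 : (0 < n')%N by exact: ltn_trans n8.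
apply: mu_cell; rewrite ?invr_gt0 ?ltr0n//; try exact: cell_sub.
  by rewrite ltf_pV2 ?posrE ?ltr0n// ltr_nat.
by rewrite mul1r ltf_pV2 ?posrE ?ltr0n// ltr_nat.
Qed.

Let sumM n : (0 < n)%N -> M = \sum_(i < n) \sum_(j < n) m (cell n i j).
Proof. by move=> n0; rewrite -grid mulfV// pnatr_eq0 -lt0n. Qed.

Let sum_const p q (c : R) : \sum_(i < p) \sum_(j < q) c = p%:R * q%:R * c.
Proof.
by rewrite !sumr_const !card_ord -[c *+ q]mulr_natl -[X in X = _]mulr_natl mulrA.
Qed.

(** Only cells of different size can be compared, so a cell of the [n]-grid is set against all cells
    of the next coarser grid here and of the next finer grid in [cell_lb]. This pins its mass
    between [M] over [(n + 1) ^ 2] and [M] over [(n - 1) ^ 2]. *)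
Let cell_ub n i j : (8 < n)%N -> (i < n)%N -> (j < n)%N -> m (cell n i j) * (n%:R - 1) ^+ 2 <= M.
Proof.
case: n => // n n8 ni nj; have n0 : (0 < n)%N by lia.
rewrite -natr1 addrK (sumM n0) expr2 mulrC -sum_const.
by apply: ler_sum => i' _; apply: ler_sum => j' _; apply: cell_le.
Qed.

Let cell_lb n i j : (8 < n)%N -> (i < n)%N -> (j < n)%N -> M <= m (cell n i j) * (n%:R + 1) ^+ 2.
Proof.
move=> n8 ni nj; rewrite natr1 (sumM (ltn0Sn n)) expr2 mulrC -sum_const.
by apply: ler_sum => i' _; apply: ler_sum => j' _; apply: cell_le => //; lia.
Qed.

Section bounds.
Variables (a b : R) (n : nat).
Hypotheses (a01 : 0 <= a <= 1) (b01 : 0 <= b <= 1) (n8 : (8 < n)%N).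
Let G := m (rect w a b).
Let n0 : (0 < n)%N. Proof. exact: ltn_trans n8. Qed.
Let nR : 0 < (n%:R : R). Proof. by rewrite ltr0n. Qed.

Let rect_le (x y : R) : a <= x -> b <= y -> G <= m (rect w x y).
Proof.
move=> ax by'; apply: m_le; try exact: measurable_rect.
by move=> z /rectP[/andP[? ?] /andP[? ?]]; apply/rectP; split; apply/andP; split; lra.
Qed.

Let rect_ge (x y : R) : x <= a -> y <= b -> m (rect w x y) <= G.
Proof.
move=> ax by'; apply: m_le; try exact: measurable_rect.
by move=> z /rectP[/andP[? ?] /andP[? ?]]; apply/rectP; split; apply/andP; split; lra.
Qed.

Let trunc_bounds (x : R) : 0 <= x <= 1 -> exists p : nat,
  [/\ (p <= n)%N, p%:R <= n%:R * x & n%:R * x <= p%:R + 1].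
Proof.
move=> /andP[x0 x1]; exists (Num.truncn (n%:R * x)).
have h0 : 0 <= n%:R * x by rewrite mulr_ge0.
split.
- rewrite -(ler_nat R); apply: le_trans (_ : n%:R * x <= _); first by rewrite truncn_le.
  by rewrite -[leRHS]mulr1 ler_pM2l.
- by rewrite truncn_le.
- by rewrite natr1 ltW// truncnS_gt.
Qed.

Let lower : M * (n%:R ^+ 2 * (a * b) - 2 * n%:R - 1) <= G * (n%:R + 1) ^+ 2.
Proof.
have [p [pn pa ap]] := trunc_bounds a01; have [q [qn qb bq]] := trunc_bounds b01.
have h : m (rect w (p%:R * n%:R^-1) (q%:R * n%:R^-1)) <= G.
  by apply: rect_ge; rewrite ler_pdivrMr// mulrC.
apply: le_trans (_ : m (rect w (p%:R * n%:R^-1) (q%:R * n%:R^-1)) * (n%:R + 1) ^+ 2 <= _); last first.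
  by apply: ler_wpM2r => //; rewrite sqr_ge0.
apply: le_trans (_ : p%:R * q%:R * M <= _); last first.
  rewrite grid mulr_suml -sum_const; apply: ler_sum => i _; rewrite mulr_suml.
  apply: ler_sum => j _; apply: cell_lb => //.
    exact: leq_trans (ltn_ord i) pn.
  exact: leq_trans (ltn_ord j) qn.
rewrite mulrC; apply: ler_wpM2r; first exact: m_ge0.
have P0 : (0 : R) <= p%:R by []. have Q0 : (0 : R) <= q%:R by [].
have PN : (p%:R : R) <= n%:R by rewrite ler_nat.
have QN : (q%:R : R) <= n%:R by rewrite ler_nat.
have [/andP[a0 a1] /andP[b0 b1]] := (a01, b01).
have : (n%:R * a) * (n%:R * b) <= (p%:R + 1) * (q%:R + 1) by apply: ler_pM => //; apply: mulr_ge0.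
rewrite expr2; move: (n%:R) (p%:R) (q%:R) P0 Q0 PN QN => N P Q *; lra.
Qed.

Let upper : G * (n%:R - 1) ^+ 2 <= M * (n%:R ^+ 2 * (a * b) + 2 * n%:R + 1).
Proof.
have [p [pn pa ap]] := trunc_bounds a01; have [q [qn qb bq]] := trunc_bounds b01.
(* Rounding up covers the box; the cap [n] keeps the cells in the unit box, where [mu_cell]
   applies. *)
pose p' := minn p.+1 n; pose q' := minn q.+1 n.
have hx (x : R) (r : nat) : x <= 1 -> n%:R * x <= r%:R + 1 -> x <= (minn r.+1 n)%:R * n%:R^-1.
  move=> x1 xr; rewrite ler_pdivlMr// mulrC /minn; case: ifP => _; first by rewrite -natr1.
  by rewrite -[leRHS]mulr1 ler_pM2l.
have h : G <= m (rect w (p'%:R * n%:R^-1) (q'%:R * n%:R^-1)).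
  by apply: rect_le; apply: hx => //; [case/andP: a01|case/andP: b01].
apply: le_trans (_ : m (rect w (p'%:R * n%:R^-1) (q'%:R * n%:R^-1)) * (n%:R - 1) ^+ 2 <= _).
  by apply: ler_wpM2r => //; rewrite sqr_ge0.
apply: le_trans (_ : p'%:R * q'%:R * M <= _).
  rewrite grid mulr_suml -sum_const; apply: ler_sum => i _; rewrite mulr_suml.
  apply: ler_sum => j _; apply: cell_ub => //.
    exact: leq_trans (ltn_ord i) (geq_minr _ _).
  exact: leq_trans (ltn_ord j) (geq_minr _ _).
rewrite mulrC; apply: ler_wpM2l; first exact: m_ge0.
have P1 : (p'%:R : R) <= p%:R + 1 by rewrite natr1 ler_nat geq_minl.
have Q1 : (q'%:R : R) <= q%:R + 1 by rewrite natr1 ler_nat geq_minl.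
have PN : (p%:R : R) <= n%:R by rewrite ler_nat.
have QN : (q%:R : R) <= n%:R by rewrite ler_nat.
have [/andP[a0 a1] /andP[b0 b1]] := (a01, b01).
have h1 : p'%:R * q'%:R <= (p%:R + 1) * (q%:R + 1) :> R by apply: ler_pM.
have h2 : p%:R * q%:R <= (n%:R * a) * (n%:R * b) by apply: ler_pM.
move: h1 h2; rewrite expr2; move: (n%:R) (p%:R) (q%:R) (p'%:R * q'%:R) PN QN => N P Q PQ *; lra.
Qed.

(** In [lower] and [upper] the main terms are quadratic in [n] and the errors linear, so one power
    of [n] cancels. *)
Lemma rect_area_approx : n%:R * `|G - M * (a * b)| <= 3 * (G + M).
Proof.
have G0 : 0 <= G by exact: m_ge0.
have M0 : 0 <= M by exact: m_ge0.
have n1 : (1 : R) <= n%:R by rewrite ler1n.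
have l := lower; have u := upper.
have L : n%:R * (n%:R * (M * (a * b) - G)) <= n%:R * (3 * (G + M)).
  have : G * (2 * n%:R + 1) <= G * (3 * n%:R) by apply: ler_wpM2l => //; lra.
  have : M * (2 * n%:R + 1) <= M * (3 * n%:R) by apply: ler_wpM2l => //; lra.
  move: l; rewrite !expr2; move: (n%:R) => N; lra.
have U : n%:R * (n%:R * (G - M * (a * b))) <= n%:R * (3 * (G + M)).
  have : G * (2 * n%:R - 1) <= G * (3 * n%:R) by apply: ler_wpM2l => //; lra.
  have : M * (2 * n%:R + 1) <= M * (3 * n%:R) by apply: ler_wpM2l => //; lra.
  move: u; rewrite !expr2; move: (n%:R) => N; lra.
rewrite ler_pM2l// in L; rewrite ler_pM2l// in U.
have [h|h] := leP 0 (G - M * (a * b)); first by rewrite ger0_norm.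
by rewrite ltr0_norm// opprB.
Qed.

End bounds.

Lemma rect_area (a b : R) : 0 <= a <= 1 -> 0 <= b <= 1 ->
  mu (rect w a b) = (M * (a * b))%:E.
Proof.
move=> a01 b01; rewrite muE; last exact: measurable_rect.
congr EFin; apply/eqP; rewrite -subr_eq0 -normr_eq0; apply/negPn/negP => d0.
have dp : 0 < `|m (rect w a b) - M * (a * b)| by rewrite lt_neqAle eq_sym d0 normr_ge0.
pose C := 3 * (m (rect w a b) + M).
pose n := (Num.truncn (C / `|m (rect w a b) - M * (a * b)|)).+1.
(* The shift by 9 ensures more than 8 cells per side. *)
have h := @rect_area_approx a b (n + 9) a01 b01 ltac:(lia).
have hn : C < n%:R * `|m (rect w a b) - M * (a * b)| by rewrite -ltr_pdivrMr// truncnS_gt.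
have : n%:R * `|m (rect w a b) - M * (a * b)| <= (n + 9)%:R * `|m (rect w a b) - M * (a * b)|.
  by apply: ler_wpM2r; rewrite ?normr_ge0// ler_nat leq_addr.
rewrite -/C in h; lra.
Qed.

Lemma uniform_measure A : measurable A -> A `<=` rect w 1 1 ->
  mu A = (mu (rect w 1 1) * lam2 R A)%E.
Proof.
move=> mA Aw; have mI := measurable_rect w 1 1.
have M0 : 0 <= M by exact: m_ge0.
pose mu1 := mrestr mu mI; pose mu2 := mscale (NngNum M0) (mrestr (lam2 R) mI).
suff H : mu1 A = mu2 A.
  have e1 : mu1 A = mu A by rewrite /mu1 /mrestr setIidl.
  have e2 : mu2 A = (mu (rect w 1 1) * lam2 R A)%E.
    transitivity (M%:E * lam2 R (A `&` rect w 1 1))%E; first by [].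
    by rewrite setIidl// [mu (rect w 1 1)]muE.
  by rewrite -e1 H.
(* A quadrant cuts the unit box in a box with the same lower left corner [w], whose sides are
   clipped to the unit interval; such boxes are the ones measured in [rect_area]. *)
pose clip (x y : R) : R := Num.min 1 (Num.max 0 (y - x)).
have clip01 x y : 0 <= clip x y <= 1.
  by rewrite le_min ge_min ler01 le_max lexx lexx.
have quad a b : (`]-oo, a]%classic `*` `]-oo, b]%classic) `&` rect w 1 1 =
    rect w (clip w.1 a) (clip w.2 b).
  have H (x y z : R) : (x < z <= x + clip y a) = (x < z <= x + clip y a) by [].
  have K (x c z : R) : (z <= c) && (x < z <= x + 1) = (x < z <= x + clip x c).
    have e : (z <= x + clip x c) = (z - x <= 1) && ((z - x <= 0) || (z - x <= c - x)).
      by rewrite /clip -lerBlDl le_min le_max.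
    rewrite e -[z <= x + 1]lerBlDl lerD2r; case: (ltP x z) => xz; rewrite ?andbF//= andbC.
    by have -> : (z - x <= 0) = false by apply/negbTE; rewrite -ltNge; lra.
  apply/seteqP; split => y.
    move=> [[/= h1 h2] /rectP[h3 h4]]; rewrite !in_itv/= in h1 h2.
    by apply/rectP; rewrite -!K h1 h2 h3 h4.
  move=> /rectP; rewrite -!K => -[/andP[h1 h3] /andP[h2 h4]].
  by split; [split; rewrite /= in_itv|apply/rectP].
have mu12 : forall B, @quadrants R B -> mu1 B = mu2 B.
  move=> _ [a [b ->]]; set Q := _ `*` _.
  have e1 : mu1 Q = mu (Q `&` rect w 1 1) by [].
  have e2 : mu2 Q = (M%:E * lam2 R (Q `&` rect w 1 1))%E by [].
  have /andP[c1 _] := clip01 w.1 a; have /andP[c2 _] := clip01 w.2 b.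
  by rewrite e1 e2 quad rect_area// rect_lam2.
apply: (measure_unique (@quadrants R) (fun k => `]-oo, k%:R]%classic `*` `]-oo, k%:R]%classic)) => //.
- exact: plane_measurableE.
- exact: quadrantsI.
- by move=> k; exists k%:R, k%:R.
- apply/seteqP; split => // -[x y] _.
  exists (Num.truncn (Num.max `|x| `|y|)).+1 => //; split => /=; rewrite in_itv/=.
    apply: le_trans (ler_norm x) _; apply: ltW; apply: le_lt_trans (truncnS_gt _).
    by rewrite le_max lexx.
  apply: le_trans (ler_norm y) _; apply: ltW; apply: le_lt_trans (truncnS_gt _).
  by rewrite le_max lexx orbT.
- move=> k; apply: le_lt_trans mu_fin; rewrite /mu1 /mrestr; apply: le_measure => //; rewrite ?inE//.
  by apply: measurableI => //; apply: measurableX; exact: measurable_itv.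
Qed.

End uniform.

End rectangles.

(** * Transverse measures on the fibre torus *)

Section fibre_torus.
Variable R : realType.
Local Notation g := (example R).
Local Notation plane := (plane R).
Local Notation pri := (pr g \o @iota R).
Local Notation T := (range pri).

Lemma iota_lat_diff n q w : differentiable (fun y => iota y + lat R n) q /\
  'd (fun y => iota y + lat R n) q w = iota w.
Proof.
have di := @ex_diff _ _ _ _ _ _ _ (@is_diff_id R (R * R)%type q).
have [d1 d2] := diff_linD (lat R n) (@iota_continuous R) di.
by split; [exact: d1|rewrite d2 diff_val].
Qed.

Lemma norm_Y_le (v : 'rV[R]_4) : `|Y v| <= `|v|.
Proof. by rewrite prod_normE ge_max !crd_le_norm. Qed.

Lemma good_iota (c : R * R) n : good (ball c (1 / 8)) (fun y => iota y + lat R n).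
Proof.
split.
- exact: ball_open.
- apply: (@smooth_on_affine R _ _ _ (@iota R : {linear _ -> _}) (lat R n)).
  exact: iota_continuous.
- by move=> q _ w; have [_ ->] := iota_lat_diff n q w; rewrite Y_iota.
- exists (iota c + lat R n) => q bq; rewrite opprD addrACA subrr addr0 -linearB.
  apply: le_lt_trans (norm_iota _) _; move: bq; rewrite -ball_normE /= distrC => bq.
  by apply: lt_trans bq _; lra.
- exists 1; split => // q q' _ _; rewrite mul1r opprD addrACA subrr addr0 -linearB /= Y_iota.
  exact: norm_iota.
- move=> W q oW WV Wq; have /nbhs_ballP[r /= r0 rW] := open_nbhs_nbhs (conj oW Wq).
  exists r; split => // q' _; rewrite opprD addrACA subrr addr0 -linearB /= => h.
  apply: rW; rewrite -ball_normE /= distrC; apply: le_lt_trans h.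
  by rewrite -{1}(Y_iota (q' - q)); exact: norm_Y_le.
Qed.

(** Within the plane [x = 0], coordinate 2 forces [icrd 2 n = 0]. So the fibre is the compact
    quotient by Z^2, although the group of all holonomies is dense. *)
Lemma pri_eq y z : pri y = pri z -> exists a b : int, y = (z.1 + a%:~R, z.2 + b%:~R).
Proof.
move=> /pr_eq[n e]; have [h0 h1 h2 h3] := crd_lat R n.
have e2 := congr1 (crd 2) e; rewrite crdD h2 !crd_row4//= add0r in e2.
rewrite -e2 !mulr0 ?addr0 ?add0r in h1 h3.
exists (icrd 1 n), (icrd 3 n).
have := congr1 (crd 1) e; have := congr1 (crd 3) e; rewrite !crdD h1 h3 !crd_row4//=.
by case: y {e} => a b /= -> ->.
Qed.

Lemma pri_int (y : R * R) (a b : int) : pri (y.1 + a%:~R, y.2 + b%:~R) = pri y.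
Proof.
apply/pr_eq; exists (irow4 0 a 0 b); have := crd_lat R (irow4 0 a 0 b).
rewrite !icrd_irow4//= !mulr0 !addr0 add0r => -[h0 h1 h2 h3].
by apply: rV4P; rewrite crdD ?h0 ?h1 ?h2 ?h3 !crd_row4//= ?addr0.
Qed.

Lemma T_transversal : Defs.transversal T.
Proof.
apply: locally_good_transversal => _ [y _ <-].
exists (pr g @` ball (iota y) (1 / 8)), (ball y (1 / 8)), (fun z => iota z + lat R 0); split.
- by apply: pr_open; exact: ball_open.
- by exists (iota y) => //; apply: ballxx; lra.
- exact: good_iota.
rewrite lat0; apply/seteqP; split => p.
  move=> [[z _ <-] [v bv e]]; have /pr_eq[n vE] := e.
  have [h0 h1 h2 h3] := crd_lat R n.
  have bk k : `|crd k (iota y) - crd k v| < 1 / 8.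
    rewrite -crdB; apply: le_lt_trans (crd_le_norm _ _) _.
    by move: bv; rewrite -ball_normE.
  (* The lattice vector has small x-coordinates; first [icrd 2 n] and then [icrd 0 n] is an integer
     of absolute value below 1. *)
  have n2 : icrd 2 n = 0.
    apply: (@intr_lt1 R); have := bk 2%N; rewrite vE crdD h2 !crd_row4//= sub0r normrN add0r; lra.
  rewrite n2 !mulr0 ?addr0 ?add0r in h0 h1 h2 h3.
  exists (Y v).
    by have b1 := bk 1%N; have b3 := bk 3%N; rewrite !crd_row4 //= in b1 b3.
  have n0 : icrd 0 n = 0.
    apply: (@intr_lt1 R); have := bk 0%N; rewrite vE crdD h0 !crd_row4//= sub0r normrN add0r; lra.
  rewrite n0 in h0; rewrite /= addr0; have <- : pr g v = pr g (iota z) := e; congr (pr g _).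
  by apply: rV4P; rewrite !crd_row4//= vE crdD ?h0 ?h2 crd_row4//= ?addr0.
move=> [z bz <-]; rewrite /= addr0; split; first by exists z.
exists (iota z) => //; rewrite -ball_normE /= -linearB.
by apply: le_lt_trans (norm_iota _) _; move: bz; rewrite -ball_normE.
Qed.

Lemma pri_rect_inj w : set_inj (rect w 1 1) pri.
Proof.
move=> y z; rewrite !inE => /rectP[/andP[h1 h2] /andP[h3 h4]] /rectP[/andP[k1 k2] /andP[k3 k4]].
move=> /pri_eq[a [b e]]; rewrite e /= in h1 h2 h3 h4 *.
have -> : a = 0 by apply: (@intr_lt1 R); rewrite ltr_norml; apply/andP; split; lra.
have -> : b = 0 by apply: (@intr_lt1 R); rewrite ltr_norml; apply/andP; split; lra.
by rewrite !addr0; case: z {e h1 h2 h3 h4 k1 k2 k3 k4}.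
Qed.

Lemma pri_rect_surj w : pri @` rect w 1 1 = T.
Proof.
apply/seteqP; split => _ [y _ <-]; first by exists y.
have := floor_frac (w.1 + 1 - y.1); have := floor_frac (w.2 + 1 - y.2).
set b := Num.floor _; set a := Num.floor (w.1 + _ - _) => /andP[b0 b1] /andP[a0 a1].
exists (y.1 + a%:~R, y.2 + b%:~R); last exact: pri_int.
by apply/rectP; split => /=; apply/andP; split; lra.
Qed.

Lemma pri_image_add (B : set plane) n : (pr g \o (fun y => iota y + lat R n)) @` B = pri @` B.
Proof.
by apply/seteqP; split => _ [y By <-]; exists y => //=; rewrite pr_lat.
Qed.

Lemma pri_ball_borel (B : set plane) c : measurable B -> B `<=` ball c (1 / 8) ->
  <<s @open (torus g) >> (pri @` B).
Proof. by move=> mB BV; rewrite -(pri_image_add _ 0); exact: good_borel (good_iota c 0) B mB BV. Qed.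

Lemma pri_borel (B : set plane) : measurable B -> transversal_borel (pri @` B).
Proof.
move=> mB; split; last by exists T; [exact: T_transversal|move=> _ [y _ <-]; exists y].
have -> : B = \bigcup_(n in [set n | exists c, @rat_box R n `<=` ball c (1 / 8)]) (B `&` @rat_box R n).
  apply/seteqP; split => [y By|y [n _ []]//].
  have oU : open (ball y (1 / 8 : R)) by exact: ball_open.
  have [|n [ny nU]] := rat_box_base (p := y) oU; first by apply: ballxx; lra.
  by exists n => //; exists y.
rewrite image_bigcup; apply: (@bigcup_measurable _ (g_sigma_algebraType (@open (torus g)))) => n [c hc].
apply: (@pri_ball_borel _ c); last by move=> y [_ /hc].
by apply: measurableI => //; exact: rat_box_measurable.
Qed.

Section slice.
Variables (nu : {measure set (transverse_sets g) -> \bar R}) (w : R * R).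

(** The pull-back of [nu] to the plane, cut down to a fundamental domain on which [pri] is
    injective; otherwise it would not be additive. *)
Definition slice (B : set plane) : \bar R := nu (pri @` (B `&` rect w 1 1)).

Let slice0 : slice set0 = 0%E.
Proof. by rewrite /slice set0I image_set0 measure0. Qed.

Let slice_ge0 B : (0 <= slice B)%E. Proof. exact: measure_ge0. Qed.

Let slice_sigma_additive : semi_sigma_additive slice.
Proof.
move=> F mF tF mUF; rewrite /slice setI_bigcupl image_bigcup.
have mFn n : measurable (F n `&` rect w 1 1) by apply: measurableI => //; exact: measurable_rect.
apply: measure_semi_sigma_additive.
- by move=> n; exact: pri_borel.
- move=> i j _ _ [p [[y [Fy wy] <-] [z [Fz wz] e]]]; apply: tF => //.
  by exists y; split => //; rewrite -(pri_rect_inj (mem_set wz) (mem_set wy) e).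
- rewrite -image_bigcup; apply: pri_borel.
  by apply: bigcup_measurable => n _; exact: mFn.
Qed.

HB.instance Definition _ := isMeasure.Build _ plane R slice slice0 slice_ge0 slice_sigma_additive.

Hypothesis tnu : transverse_measure nu.

Lemma T_compact : compact T.
Proof.
have -> : T = pri @` (`[0, 1]%classic `*` `[0, 1]%classic).
  rewrite -(pri_rect_surj (0, 0)); apply/seteqP; split => _ [y hy <-].
    exists y => //; move: hy => /rectP[/= /andP[h1 h2] /andP[h3 h4]].
    by split; rewrite /= in_itv/=; apply/andP; split; lra.
  have : T (pri y) by exists y.
  by rewrite -(pri_rect_surj (0, 0)).
apply: continuous_compact; last by apply: compact_setX; exact: segment_compact.
apply: continuous_subspaceT => y; apply: continuous_comp; first exact: iota_continuous.
exact: pr_continuous.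
Qed.

Lemma T_fin : (nu T < +oo)%E.
Proof. by apply: (tm_finite tnu T_transversal T_compact). Qed.

Lemma nu_le (B C : set plane) : measurable B -> measurable C -> pri @` B `<=` pri @` C ->
  (nu (pri @` B) <= nu (pri @` C))%E.
Proof. by move=> mB mC h; apply: le_measure => //; rewrite inE; exact: pri_borel. Qed.

(* Seen in the chart [iota + lat n], a piece of the fibre torus slides along the
   leaves onto its translate: this is the holonomy of the foliation. *)
Lemma nu_holonomy (B : set plane) c n : measurable B -> B `<=` ball c (1 / 8) ->
  nu (pri @` B) = nu (pri @` ((fun y => y + Y (lat R n)) @` B)).
Proof.
move=> mB BV; rewrite -{1}(pri_image_add _ n).
rewrite (transverse_measure_chart (good_iota c n) tnu mB BV); congr (nu (_ @` _)).
by apply/seteqP; split => _ [y By <-]; exists y => //=; rewrite YD Y_iota.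
Qed.

Lemma slice_cell p p' (h h' : R) : 0 < h -> h < h' -> h < 1 / 8 ->
  rect p h h `<=` rect w 1 1 -> rect p' h' h' `<=` rect w 1 1 ->
  (slice (rect p h h) <= slice (rect p' h' h'))%E.
Proof.
move=> h0 hh' h8 pw p'w; rewrite /slice !setIidl//.
have d0 : 0 < h' - h by rewrite subr_gt0.
(* The translated small box overshoots the corner [p'] by at most [h' - h], hence stays in the large
   box. *)
have [n [hn1 hn2]] := kronecker (p' - p) d0.
move: hn1 hn2 => /= /andP[a1 a2] /andP[a3 a4].
have mp := measurable_rect p h h; have mp' := measurable_rect p' h' h'.
rewrite (@nu_holonomy _ p n)//; last first.
  move=> y /rectP[/andP[? ?] /andP[? ?]]; split; rewrite /ball/= ltr_norml; apply/andP; split; lra.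
have -> : (fun y => y + Y (lat R n)) @` rect p h h = rect (p + Y (lat R n)) h h.
  apply/seteqP; split => y.
    by move=> [z /rectP[/andP[? ?] /andP[? ?]] <-]; apply/rectP; split => /=; apply/andP; split; lra.
  move=> /rectP[/= /andP[? ?] /andP[? ?]]; exists (y - Y (lat R n)); last by rewrite subrK.
  by apply/rectP; split => /=; apply/andP; split; lra.
apply: nu_le => //; first exact: measurable_rect.
apply: image_subset => y /rectP[/= /andP[? ?] /andP[? ?]].
by apply/rectP; split => /=; apply/andP; split; lra.
Qed.

Lemma nu_fibre (B : set plane) : measurable B -> B `<=` rect w 1 1 ->
  nu (pri @` B) = (nu T * lam2 R B)%E.
Proof.
move=> mB Bw; have e (C : set plane) : C `<=` rect w 1 1 -> slice C = nu (pri @` C).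
  by move=> Cw; rewrite /slice setIidl.
rewrite -e// -(pri_rect_surj w) -(e (rect w 1 1))//.
apply: (@uniform_measure R slice w) => //; last exact: slice_cell.
have h : slice setT = nu T by rewrite /slice setTI pri_rect_surj.
by have := T_fin; rewrite -h.
Qed.

End slice.

Lemma good_Y_inj V (phi : R * R -> 'rV[R]_4) q q' :
  good V phi -> V q -> V q' -> Y (phi q) = Y (phi q') -> q = q'.
Proof.
move=> gV Vq Vq' e; have [C [_ hC]] := good_lip gV.
exact: good_phi_inj gV Vq Vq' (inj_of_lip hC Vq Vq' e).
Qed.

Lemma good_Y_image (V : set (R * R)) (phi : R * R -> 'rV[R]_4) (B : set plane) :
  good V phi -> measurable B -> B `<=` V -> measurable ((Y \o phi) @` B : set plane).
Proof.
move=> gV mB BV; apply: plane_image_measurable (good_open gV) _ _ mB BV.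
  move=> q Vq; apply: continuous_comp; first exact: good_continuous gV Vq.
  exact: Y_continuous.
by move=> q q'; rewrite !inE => Vq Vq'; exact: good_Y_inj gV Vq Vq'.
Qed.

Lemma nu_chart (nu : {measure set (transverse_sets g) -> \bar R}) V phi (B : set plane) :
  transverse_measure nu -> good V phi -> measurable B -> B `<=` V ->
  nu ((pr g \o phi) @` B) = (nu T * lam2 R ((Y \o phi) @` B))%E.
Proof.
move=> tnu gV mB BV; rewrite (transverse_measure_chart gV tnu mB BV).
have [c hc] := good_small gV.
(* Every unit box gives the same density [nu T]; the one centred at [Y c] contains the projected
   chart. *)
apply: (nu_fibre (w := ((Y c).1 - 1 / 2, (Y c).2 - 1 / 2)) tnu (good_Y_image gV mB BV)).
move=> _ [q Bq <-]; have := hc _ (BV _ Bq) => h.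
have h1 := le_lt_trans (crd_le_norm 1 _) h; have h3 := le_lt_trans (crd_le_norm 3 _) h.
rewrite !crdB !ltr_norml in h1 h3; move: h1 h3 => /andP[? ?] /andP[? ?].
by apply/rectP; split => /=; apply/andP; split; lra.
Qed.

End fibre_torus.

(** * Borel partitions of transversals into charts *)

Section chart_partition.
Variable R : realType.
Local Notation g := (example R).
Local Notation plane := (plane R).

Lemma chart_good (S : set (torus g)) p : Defs.transversal S -> S p -> exists V phi,
  [/\ good V phi, parametrization S V phi, null_preserving V phi & ((pr g \o phi) @` V) p].
Proof.
move=> [subS tS] Sp; have [V0 [phi [p0 [q0 Vq0 e0]]]] := subS p Sp.
have [oV s0 i0 inj0 hom0] := p0.
have imm q : V0 q -> immersed_transversally phi q.
  move=> Vq; apply/transversalP; first exact: smooth_on_differentiable s0 Vq.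
  exact: tS p0 Vq.
have [r1 [C [r10 [C0 r1V] injY lip null]]] := chart_null oV s0 Vq0 (imm _ Vq0).
have : \forall q \near q0, `|phi q0 - phi q| < 1 / 4.
  by have /cvgrPdist_lt/(_ (1 / 4)) := smooth_on_continuous s0 Vq0; apply; lra.
move=> /nbhs_ballP[r2 /= r20 hr2].
pose r := Num.min r1 r2; pose V := ball q0 r.
have VV1 : V `<=` ball q0 r1 by apply: le_ball; rewrite ge_min lexx.
have VV2 : V `<=` ball q0 r2 by apply: le_ball; rewrite ge_min lexx orbT.
have VV0 : V `<=` V0 by move=> q /VV1/r1V.
have oV' : open V by exact: ball_open.
exists V, phi; split.
- split => //.
  + exact: smooth_on_sub VV0 s0.
  + by move=> q /VV0/imm.
  + by exists (phi q0) => q /VV2/hr2 /=; rewrite distrC.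
  + by exists C; split => // q q' /VV1 Vq /VV1 Vq'; exact: lip.
  (* The image of [W] is the trace of an open [U] on [S]; a point of the chart that lands in [U]
     comes from [W], by injectivity. *)
  + move=> W q oW WV Wq; have [U oU SU] := hom0 W oW (subset_trans WV VV0).
    have Uq : (pr g @^-1` U) (phi q).
      have : ((pr g \o phi) @` W) (pr g (phi q)) by exists q.
      by rewrite SU => -[].
    have /nbhs_ballP[e /= e00 he] := open_nbhs_nbhs (conj (oU : open (pr g @^-1` U)) Uq).
    exists e; split => // q' Vq' hq'.
    have [U0 oU0 SU0] := hom0 V0 oV (fun _ => id).
    have Sq' : S (pr g (phi q')).
      have : ((pr g \o phi) @` V0) (pr g (phi q')) by exists q' => //; exact: VV0.
      by rewrite SU0 => -[].
    have : (S `&` U) (pr g (phi q')).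
      by split => //; apply: he; rewrite -ball_normE /= distrC.
    rewrite -SU => -[q'' Wq'' e''].
    by rewrite -(inj0 q'' q' _ _ e'')// inE; [exact/VV0/WV|exact: VV0].
- split => //.
  + exact: smooth_on_sub VV0 s0.
  + by move=> q /VV0; exact: i0.
  + by move=> q q'; rewrite !inE => /VV0 Vq /VV0 Vq'; apply: inj0; rewrite inE.
  + by move=> W oW WV; exact: hom0 W oW (subset_trans WV VV0).
- by move=> E mE EV; apply: null => //; exact: subset_trans EV VV1.
- by exists q0 => //; apply: ballxx; rewrite lt_min r10.
Qed.

Lemma param_sub (S : set (torus g)) V W phi : open W -> W `<=` V -> parametrization S V phi ->
  parametrization S W phi.
Proof.
move=> oW WV [oV sV iV jV hV]; split => //.
- exact: smooth_on_sub WV sV.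
- by move=> q /WV; exact: iV.
- by move=> q q'; rewrite !inE => /WV Vq /WV Vq'; apply: jV; rewrite inE.
- by move=> W' oW' W'W; exact: hV W' oW' (subset_trans W'W WV).
Qed.

Lemma good_sub V W (phi : R * R -> 'rV[R]_4) : open W -> W `<=` V -> good V phi -> good W phi.
Proof.
move=> oW WV [oV sV iV [c hc] [C [C0 hC]] hV]; split => //.
- exact: smooth_on_sub WV sV.
- by move=> q /WV; exact: iV.
- by exists c => q /WV; exact: hc.
- by exists C; split => // q q' /WV Vq /WV; exact: hC.
- move=> W' q oW' W'W W'q; have [r [r0 h]] := hV W' q oW' (subset_trans W'W WV) W'q.
  by exists r; split => // q' /WV; exact: h.
Qed.

(** [Q] carries what a later argument needs of its charts: preservation of null sets for absolute
    continuity, a lift of the final map of the isotopy for invariance. Indices without a chart have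
    [B n = set0]. *)
Lemma chart_partition (Q : set (R * R) -> (R * R -> 'rV[R]_4) -> Prop) (S A : set (torus g)) :
  (forall p, S p -> exists V phi, [/\ good V phi, parametrization S V phi, Q V phi &
    ((pr g \o phi) @` V) p]) ->
  A `<=` S -> <<s @open (torus g) >> A ->
  exists (V : nat -> set (R * R)) (phi : nat -> R * R -> 'rV[R]_4) (B : nat -> set plane),
  [/\ forall n, measurable (B n),
      forall n, B n = set0 \/ [/\ good (V n) (phi n), parametrization S (V n) (phi n),
         Q (V n) (phi n) & B n `<=` V n],
      A = \bigcup_n (pr g \o phi n) @` (B n) &
      trivIset setT (fun n => (pr g \o phi n) @` (B n))].
Proof.
move=> hS AS bA.
pose chart p := if pselect (S p) is left Sp then
    let e := cid (hS p Sp) in (projT1 e, projT1 (cid (projT2 e))) else (set0, fun=> 0).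
have chartP p : S p -> [/\ good (chart p).1 (chart p).2, parametrization S (chart p).1 (chart p).2,
    Q (chart p).1 (chart p).2 & ((pr g \o (chart p).2) @` (chart p).1) p].
  by move=> Sp; rewrite /chart; case: pselect => // Sp'; case: cid => V /= e; case: cid.
have hU p : exists U : set (torus g), S p -> [/\ open U, U p &
    (pr g \o (chart p).2) @` (chart p).1 = S `&` U].
  have [Sp|nSp] := pselect (S p); last by exists set0.
  have [gV [oV _ _ _ hV] _ hp] := chartP p Sp.
  have [U oU e] := hV _ oV (fun _ => id); exists U => _; split => //.
  by move: hp; rewrite e => -[].
pose U p := projT1 (cid (hU p)).
have UP p : S p -> [/\ open (U p), U p p & (pr g \o (chart p).2) @` (chart p).1 = S `&` U p].
  by rewrite /U; case: cid.
have [s [sS sU]] := @torus_lindelof R S U (fun p Sp => let: And3 a b _ := UP p Sp in conj a b).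
pose D n := if s n is Some p then A `&` U p else set0.
have bD n : <<s @open (torus g) >> (D n).
  rewrite /D; case sn : (s n) => [p|]; last exact: sigma_algebra0.
  apply: (@measurableI _ (g_sigma_algebraType (@open (torus g)))) => //.
  by apply: sub_sigma_algebra; have [] := UP p (sS _ _ sn).
have bE n : <<s @open (torus g) >> (seqDU D n).
  apply: (@measurableD _ (g_sigma_algebraType (@open (torus g)))) => //.
    exact: bD.
  rewrite -(bigcup_mkord n D).
  by apply: (@bigcup_measurable _ (g_sigma_algebraType (@open (torus g)))) => k _; exact: bD.
have AE : A = \bigcup_n seqDU D n.
  rewrite -seqDU_bigcup_eq; apply/seteqP; split => p.
    move=> Ap; have [n [q [sn Uq]]] := sU p (AS _ Ap).
    by exists n => //; rewrite /D sn.
  by move=> [n _]; rewrite /D; case: (s n) => // q [].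
pose V n := if s n is Some p then (chart p).1 else set0.
pose phi n := if s n is Some p then (chart p).2 else fun=> 0.
pose B n : set plane := V n `&` (pr g \o phi n) @^-1` (seqDU D n).
have imB n : (pr g \o phi n) @` (B n) = seqDU D n.
  apply/seteqP; split => [_ [q [_ Dq] <-]//|p Dp].
  have : D n p by case: Dp.
  rewrite /B /V /phi /D; case sn : (s n) => [q|//] [Ap Uqp].
  have [_ _ e] := UP q (sS _ _ sn).
  have : (S `&` U q) p by split => //; exact: AS.
  by rewrite -e => -[q' Vq' e']; exists q' => //; split => //=; rewrite -e' in Dp.
exists V, phi, B; split.
- move=> n; rewrite /B /V /phi; case sn : (s n) => [p|].
    have [gV _ _ _] := chartP p (sS _ _ sn).
    apply: (borel_preimage (good_open gV) _ (bE n)) => q Vq.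
    exact: pr_phi_continuous (good_smooth gV) Vq.
  by rewrite set0I; exact: measurable0.
- move=> n; rewrite /B /V /phi; case sn : (s n) => [p|]; last by left; rewrite set0I.
  by right; have [h1 h2 h3 _] := chartP p (sS _ _ sn); split => // q [].
- by rewrite AE; apply: eq_bigcupr => n _; rewrite imB.
- by under eq_fun do rewrite imB; exact: trivIset_seqDU.
Qed.

End chart_partition.

(** * The transverse Lebesgue measure *)

Section transverse_lebesgue.
Variable R : realType.
Local Notation g := (example R).
Local Notation plane := (plane R).
Local Notation borelT := (g_sigma_algebraType (@open (torus g))).
Local Open Scope ereal_scope.

Definition frac (x : R) : R := (x - (Num.floor x)%:~R)%R.

Lemma frac_int (x : R) (n : int) : frac (x + n%:~R)%R = frac x.
Proof. by rewrite /frac floorDrz ?intr_int// intrKfloor intrD; ring. Qed.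

(* [Y] modulo the lattice, with values in the unit square: first translate by a
   multiple of the third row of [g] to bring [crd 2] into the unit interval. *)
Definition Yred (v : 'rV[R]_4) : R * R :=
  (frac (crd 1 v - Num.sqrt 5 * (Num.floor (crd 2 v))%:~R)%R,
   frac (crd 3 v - Num.sqrt 2 * (Num.floor (crd 2 v))%:~R)%R).

Lemma Yred_lat v n : Yred (v + lat R n)%R = Yred v.
Proof.
have [_ h1 h2 h3] := crd_lat R n.
rewrite /Yred !crdD h1 h2 h3 floorDrz ?intr_int// intrKfloor intrD !mulrDr.
congr (_, _); last rewrite -[RHS](frac_int _ (icrd 3 n)); first rewrite -[RHS](frac_int _ (icrd 1 n)).
all: congr frac; ring.
Qed.

Definition Yquot (p : torus g) : R * R := Yred (projT1 (cid (pr_surj p))).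

Lemma Yquot_pr v : Yquot (pr g v) = Yred v.
Proof. by rewrite /Yquot; case: cid => w /= /pr_eq[n ->]; rewrite Yred_lat. Qed.

(** A slab on which no reduction takes place; [crd 0] is left free because [Yred] does not involve
    it. *)
Definition in_cell (v : 'rV[R]_4) : Prop :=
  [/\ (0 <= crd 1 v < 1)%R, (0 <= crd 2 v < 1)%R & (0 <= crd 3 v < 1)%R].

Lemma Yred_cell v : in_cell v -> Yred v = Y v.
Proof.
move=> [h1 h2 h3]; have fl (x : R) : (0 <= x < 1)%R -> Num.floor x = 0%R.
  by move=> h; apply: floor_def; rewrite add0r.
by rewrite /Yred /frac (fl _ h2) mulr0 !subr0 mulr0 subr0 (fl _ h1) (fl _ h3) !subr0.
Qed.

Lemma to_cell v : exists n, in_cell (v + lat R n)%R.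
Proof.
have shift (x : R) : exists n : int, (0 <= x + n%:~R < 1)%R.
  by exists (- Num.floor x)%R; rewrite intrN; exact: floor_frac.
have [n2 f2] := shift (crd 2 v).
have [n1 f1] := shift (crd 1 v + Num.sqrt 5 * n2%:~R)%R.
have [n3 f3] := shift (crd 3 v + Num.sqrt 2 * n2%:~R)%R.
exists (irow4 0 n1 n2 n3); have [_ h1 h2 h3] := crd_lat R (irow4 0 n1 n2 n3).
rewrite !icrd_irow4//= in h1 h2 h3; rewrite /in_cell !crdD h1 h2 h3.
by split; lra.
Qed.

(** The outer measure makes sense for every set, so the measurability of images under [Yquot] need
    not be settled. *)
Definition tau (A : set (torus g)) : \bar R := mu_ext (lam2 R) (Yquot @` A).

Let tau0 : tau set0 = 0.
Proof. by rewrite /tau image_set0 mu_ext0. Qed.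

Let tau_ge0 A : 0 <= tau A. Proof. exact: mu_ext_ge0. Qed.

Let tau_le : {homo tau : A B / A `<=` B >-> A <= B}.
Proof. by move=> A B AB; apply: le_mu_ext; exact: image_subset. Qed.

Let tau_sub (F : (set (torus g))^nat) : tau (\bigcup_k F k) <= \sum_(k <oo) tau (F k).
Proof. by rewrite /tau image_bigcup; exact: mu_ext_sigma_subadditive. Qed.

Definition lebT (A : set borelT) : \bar R := @hull _ borelT R tau A.

Let lebT0 : lebT set0 = 0. Proof. exact: hull0. Qed.
Let lebT_ge0 A : 0 <= lebT A. Proof. exact: hull_ge0. Qed.
Let lebT_sigma : semi_sigma_additive lebT.
Proof. exact: hull_semi_sigma_additive. Qed.

HB.instance Definition _ := isMeasure.Build _ borelT R lebT lebT0 lebT_ge0 lebT_sigma.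

Lemma lebT_le A B : A `<=` B -> lebT A <= lebT B. Proof. exact: hull_le. Qed.

Definition transverse_lebesgue (A : set (transverse_sets g)) : \bar R := lebT A.

Let tl0 : transverse_lebesgue set0 = 0. Proof. exact: lebT0. Qed.
Let tl_ge0 A : 0 <= transverse_lebesgue A. Proof. exact: lebT_ge0. Qed.
Let tl_sigma : semi_sigma_additive transverse_lebesgue.
Proof.
move=> F mF tF [mUF _]; apply: (@lebT_sigma F) => //.
by move=> i; have [] := mF i.
Qed.

HB.instance Definition _ :=
  isMeasure.Build _ (transverse_sets g) R transverse_lebesgue tl0 tl_ge0 tl_sigma.

(** * The measure of an image, read in a parameter domain *)

Section image.
Variables (V : set (R * R)) (phi : R * R -> 'rV[R]_4) (f : R * R -> R * R).
Hypotheses (oV : open V) (cphi : forall q, V q -> {for q, continuous phi}).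
Hypothesis (iphi : set_inj V (pr g \o phi)).
Hypotheses (cf : forall q, V q -> {for q, continuous f}) (fI : set_inj V f).
Implicit Types E : set plane.

Let cprphi q : V q -> {for q, continuous (pr g \o phi)}.
Proof. by move=> Vq; apply: continuous_comp; [exact: cphi|exact: pr_continuous]. Qed.

Lemma measurable_lt_on (h : R * R -> R) (c : R) : (forall q, V q -> {for q, continuous h}) ->
  measurable (V `&` [set q | (h q < c)%R] : set plane).
Proof.
move=> ch; apply: plane_open_measurable.
have := open_preimage_on oV ch (@open_lt R c).
by [].
Qed.

Lemma measurable_in_on (h : R * R -> R) (a b : R) : (forall q, V q -> {for q, continuous h}) ->
  measurable (V `&` [set q | (a <= h q < b)%R] : set plane).
Proof.
move=> ch; have -> : V `&` [set q | (a <= h q < b)%R] =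
    (V `&` [set q | (h q < b)%R]) `\` (V `&` [set q | (h q < a)%R]).
  apply/seteqP; split => q /=.
    by move=> [Vq /andP[h1 h2]]; split => // -[_]; rewrite ltNge h1.
  by move=> [[Vq h1] h2]; split => //; rewrite h1 andbT leNgt; apply/negP => h3; exact: h2.
by apply: measurableD; exact: measurable_lt_on.
Qed.

Lemma measurable_eq_on (h : R * R -> R) (a : R) : (forall q, V q -> {for q, continuous h}) ->
  measurable (V `&` [set q | h q = a] : set plane).
Proof.
move=> ch; have -> : V `&` [set q | h q = a] =
    V `&` [set q | (a <= h q < a + 1)%R] `\` (V `&` [set q | (a < h q)%R]).
  apply/seteqP; split => q /=.
    by move=> [Vq ->]; rewrite lexx ltrDl ltr01; split => // -[_]; rewrite ltxx.
  move=> [[Vq /andP[h1 h2]] h3]; split => //; apply/eqP; rewrite eq_le h1 andbT leNgt.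
  by apply/negP => h4; apply: h3.
apply: measurableD; first exact: measurable_in_on.
apply: plane_open_measurable.
by have := open_preimage_on oV ch (@open_gt R a).
Qed.

Lemma measurable_f_image E : measurable E -> E `<=` V -> measurable (f @` E : set plane).
Proof. by move=> mE EV; exact: (plane_image_measurable oV cf fI mE EV). Qed.

Lemma borel_pr_image E : measurable E -> E `<=` V ->
  measurable ((pr g \o phi) @` E : set borelT).
Proof. by move=> mE EV; exact: (borel_image oV cprphi (@torus_hausdorff R) iphi mE EV). Qed.

Lemma inj_image_disjoint (T : Type) (h : R * R -> T) (F : (set plane)^nat) : set_inj V h ->
  (forall n, F n `<=` V) -> trivIset setT F -> trivIset setT (fun n => h @` F n).
Proof.
move=> hI FV tF i j _ _ [p [[y Fy <-] [z Fz e]]]; apply: tF => //.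
by exists y; split => //; rewrite -(hI z y (mem_set (FV _ _ Fz)) (mem_set (FV _ _ Fy)) e).
Qed.

Lemma lam2_image_bigcup (F : (set plane)^nat) : (forall n, measurable (F n)) ->
  (forall n, F n `<=` V) -> trivIset setT F ->
  lam2 R (f @` \bigcup_n F n) = \sum_(n <oo) lam2 R (f @` F n).
Proof.
move=> mF FV tF; rewrite image_bigcup; apply: measure_semi_bigcup.
- by move=> n; exact: measurable_f_image.
- exact: inj_image_disjoint.
- by apply: bigcup_measurable => n _; exact: measurable_f_image.
Qed.

Lemma tau_translate E c : measurable E -> E `<=` V ->
  (forall q, E q -> Yred (phi q) = (f q + c)%R) ->
  tau ((pr g \o phi) @` E) = lam2 R (f @` E).
Proof.
move=> mE EV h; rewrite /tau.
have -> : Yquot @` ((pr g \o phi) @` E) = (fun y : plane => y + - c : plane)%R @^-1` (f @` E).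
  apply/seteqP; split => y.
    by move=> [_ [q Eq <-] <-]; rewrite /= Yquot_pr h//; exists q => //; rewrite addrK.
  move=> [q Eq e]; exists (pr g (phi q)); first by exists q.
  by rewrite Yquot_pr h// e subrK.
have mfE := measurable_f_image mE EV.
have := lam2_shift (- c)%R mfE; rewrite /pushforward => <-.
by rewrite measurable_mu_extE//; exact: measurable_shift.
Qed.

Variable B : set plane.
Hypotheses (mB : measurable B) (BV : B `<=` V).
Hypothesis holonomy : forall q, B q -> exists n, Y (phi q) = (f q + Y (lat R n))%R.

(** Here [k] brings the lift into the slab and [m] is the holonomy between [f] and [Y]; with both
    fixed, [Yred] after [phi] is [f] plus a constant. Cells may overlap, and [seqDU] makes them
    disjoint. *)
Let cell (n : nat) : set plane :=
  if unpickle n is Some (k, m) then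
    B `&` [set q | in_cell (phi q + lat R k)%R /\ Y (phi q) = (f q + Y (lat R m))%R]
  else set0.

Let cell_cover : B = \bigcup_n cell n.
Proof.
apply/seteqP; split => q.
  move=> Bq; have [m hm] := holonomy Bq; have [k hk] := to_cell (phi q).
  by exists (pickle (k, m)) => //; rewrite /cell pickleK.
by move=> [n _]; rewrite /cell; case: unpickle => [[k m]|//] [].
Qed.

Let cell_measurable n : measurable (cell n).
Proof.
rewrite /cell; case: unpickle => [[k m]|]; last exact: measurable0.
have ccrd j q : V q -> {for q, continuous (fun q => crd j (phi q + lat R k)%R)}.
  move=> Vq; apply: (@continuous_comp _ _ _ (fun q => phi q + lat R k)%R (crd j)).
    by apply: cvgD; [exact: cphi|exact: cvg_cst].
  exact: crd_continuous.
pose d1 q := (crd 1 (phi q) - (f q).1)%R.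
pose d2 q := (crd 3 (phi q) - (f q).2)%R.
have cd1 q : V q -> {for q, continuous d1}.
  move=> Vq; apply: cvgB; first by apply: (continuous_comp (cphi Vq)); exact: crd_continuous.
  by apply: (continuous_comp (cf Vq)); exact: cvg_fst.
have cd2 q : V q -> {for q, continuous d2}.
  move=> Vq; apply: cvgB; first by apply: (continuous_comp (cphi Vq)); exact: crd_continuous.
  by apply: (continuous_comp (cf Vq)); exact: cvg_snd.
have -> : B `&` [set q | in_cell (phi q + lat R k)%R /\ Y (phi q) = (f q + Y (lat R m))%R] =
    B `&` ((V `&` [set q | (0 <= crd 1 (phi q + lat R k) < 1)%R]) `&`
      (V `&` [set q | (0 <= crd 2 (phi q + lat R k) < 1)%R]) `&`
      (V `&` [set q | (0 <= crd 3 (phi q + lat R k) < 1)%R]) `&`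
      (V `&` [set q | d1 q = (Y (lat R m)).1]) `&` (V `&` [set q | d2 q = (Y (lat R m)).2])).
  apply/seteqP; split => q.
    move=> [Bq [[h1 h2 h3] e]]; have Vq := BV Bq; split => //.
    have e1 := congr1 fst e; have e2 := congr1 snd e; rewrite /= in e1 e2.
    do !split => //=; rewrite /d1 /d2 ?e1 ?e2 /=; ring.
  move=> [Bq [[[[[_ h1] [_ h2]] [_ h3]] [_ e1]] [_ e2]]]; do 2!split => //.
  have e1' : crd 1 (phi q) = ((f q).1 + (Y (lat R m)).1)%R by rewrite -e1 /d1; ring.
  have e2' : crd 3 (phi q) = ((f q).2 + (Y (lat R m)).2)%R by rewrite -e2 /d2; ring.
  by rewrite /Y e1' e2'; case: (f q).
apply: measurableI => //; apply: measurableI; last exact: (measurable_eq_on _ cd2).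
apply: measurableI; last exact: (measurable_eq_on _ cd1).
apply: measurableI; last exact: (measurable_in_on _ _ (@ccrd _)).
by apply: measurableI; exact: (measurable_in_on _ _ (@ccrd _)).
Qed.

Let cell_translate n : exists c, forall q, cell n q -> Yred (phi q) = (f q + c)%R.
Proof.
rewrite /cell; case: unpickle => [[k m]|]; last by exists 0%R.
exists (Y (lat R m) + Y (lat R k))%R => q [_ [h e]].
by rewrite -(Yred_lat _ k) Yred_cell// YD e addrA.
Qed.

Let piece n := seqDU cell n.

Let piece_sub n : piece n `<=` cell n. Proof. by move=> q []. Qed.

Let piece_measurable n : measurable (piece n).
Proof.
apply: measurableD; first exact: cell_measurable.
by rewrite -(bigcup_mkord n cell); apply: bigcup_measurable => k _; exact: cell_measurable.
Qed.

Let pieceV n : piece n `<=` V.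
Proof. by move=> q /piece_sub cq; apply: BV; rewrite cell_cover; exists n. Qed.

Let piece_cover : B = \bigcup_n piece n.
Proof. by rewrite cell_cover seqDU_bigcup_eq. Qed.

Let piece_tau E n : measurable E -> E `<=` piece n ->
  tau ((pr g \o phi) @` E) = lam2 R (f @` E).
Proof.
move=> mE En; have [c hc] := cell_translate n; apply: (@tau_translate _ c) => //.
  exact: subset_trans En (@pieceV n).
by move=> q /En/piece_sub/hc.
Qed.

Let tau_image_le E : measurable E -> E `<=` B ->
  tau ((pr g \o phi) @` E) <= lam2 R (f @` E).
Proof.
move=> mE EB; pose F n := E `&` piece n.
have mF n : measurable (F n) by apply: measurableI => //; exact: piece_measurable.
have {1}-> : E = \bigcup_n F n by rewrite -setI_bigcupr -piece_cover setIidl.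
have -> : lam2 R (f @` E) = lam2 R (f @` \bigcup_n F n) by rewrite -setI_bigcupr -piece_cover setIidl.
rewrite image_bigcup; apply: le_trans (tau_sub _) _; rewrite lam2_image_bigcup//.
- apply: lee_nneseries => [i _ _|n _]; first exact: tau_ge0.
  by rewrite (@piece_tau _ n)// => q [].
- by move=> n q [/EB/BV].
- by apply: trivIset_setIl; exact: trivIset_seqDU.
Qed.

(** Lower bound: on a piece [tau] is already the area, and the hull lies above [tau]. Upper bound:
    for any labelling, subadditivity bounds [tau] of a class by the area of its [f]-image, and
    injectivity of [f] makes these images disjoint. *)
Lemma lebT_image : lebT ((pr g \o phi) @` B) = lam2 R (f @` B).
Proof.
apply/eqP; rewrite eq_le; apply/andP; split; last first.
  rewrite {1}piece_cover lam2_image_bigcup//; last exact: trivIset_seqDU.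
  rewrite piece_cover image_bigcup measure_semi_bigcup.
  - apply: lee_nneseries => // n _; rewrite -(@piece_tau _ n)//.
    exact: (@tau_le_hull _ borelT R tau tau_le).
  - by move=> n; apply: borel_pr_image => //; exact: pieceV.
  - by apply: inj_image_disjoint => //; exact: trivIset_seqDU.
  - apply: bigcup_measurable => n _; apply: borel_pr_image => //; exact: pieceV.
apply: hull_le_ub => l n hl.
pose F (i : 'I_n) : set plane := B `&` (V `&` (pr g \o phi) @^-1` (l @^-1` [set (i : nat)])).
have mF i : measurable (F i).
  by apply: measurableI => //; apply: (borel_preimage oV cprphi); exact: hl.
have FB i : F i `<=` B by move=> q [].
have FV i : F i `<=` V by exact: subset_trans (@FB i) BV.
apply: (@le_trans _ _ (\sum_(i < n) lam2 R (f @` F i))).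
  apply: lee_sum => i _; apply: le_trans (tau_image_le (mF i) (@FB i)); apply: tau_le.
  by move=> _ [[q Bq <-] lq]; exists q => //; split => //; split => //; exact: BV.
rewrite -(@measure_bigsetU_ord _ _ _ (lam2 R) n xpredT).
- apply: le_measure; rewrite ?inE.
  + by apply: bigsetU_measurable => i _; exact: measurable_f_image.
  + exact: measurable_f_image.
  + by move=> y; rewrite -bigcup_seq => -[i _ [q Fq <-]]; exists q => //; exact: FB Fq.
- by move=> i; exact: measurable_f_image.
- move=> i j _ _ [p [[y Fy <-] [z Fz e]]]; apply: val_inj.
  have yz := fI (mem_set (FV _ _ Fz)) (mem_set (FV _ _ Fy)) e.
  by move: Fy Fz => [_ [_ /= <-]] [_ [_ /= <-]]; rewrite yz.
Qed.

End image.

Lemma lebT_chart V phi (B : set plane) : good V phi -> measurable B -> B `<=` V ->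
  lebT ((pr g \o phi) @` B) = lam2 R ((Y \o phi) @` B).
Proof.
move=> gV mB BV; apply: (@lebT_image V) => //.
- exact: good_open gV.
- by move=> q; exact: good_continuous gV.
- by move=> q q'; rewrite !inE; exact: good_pr_inj gV.
- move=> q Vq; apply: continuous_comp; first exact: good_continuous gV Vq.
  exact: Y_continuous.
- by move=> q q'; rewrite !inE; exact: good_Y_inj gV.
- by move=> q _; exists 0%R; rewrite lat0 /= -YD addr0.
Qed.

End transverse_lebesgue.

(** * Unique ergodicity *)

Section unique_ergodicity.
Variable R : realType.
Local Notation g := (example R).
Local Notation plane := (plane R).
Local Notation borelT := (g_sigma_algebraType (@open (torus g))).
Local Open Scope ereal_scope.

Lemma chart_small V (phi : R * R -> 'rV[R]_4) : good V phi ->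
  exists w, (Y \o phi) @` V `<=` rect w 1 1.
Proof.
move=> gV; have [c hc] := good_small gV.
exists ((Y c).1 - 1 / 2, (Y c).2 - 1 / 2)%R => _ [q Vq <-]; have h := hc _ Vq.
have h1 := le_lt_trans (crd_le_norm 1 _) h; have h3 := le_lt_trans (crd_le_norm 3 _) h.
rewrite !crdB !ltr_norml in h1 h3; move: h1 h3 => /andP[? ?] /andP[? ?].
by apply/rectP; split => /=; apply/andP; split; lra.
Qed.

Lemma chart_finite V (phi : R * R -> 'rV[R]_4) : good V phi ->
  lebT ((pr g \o phi) @` V) < +oo.
Proof.
move=> gV; have mV : measurable (V : set plane) by exact: plane_open_measurable (good_open gV).
rewrite (lebT_chart gV mV)//; have [w hw] := chart_small gV.
apply: (@le_lt_trans _ _ (lam2 R (rect w 1 1))); last by rewrite rect_lam2//= ltry.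
apply: le_measure => //; rewrite inE; last exact: measurable_rect.
exact: (good_Y_image gV mV).
Qed.

Lemma lebT_nonzero : exists A : set (transverse_sets g), measurable A /\
  transverse_lebesgue A != 0.
Proof.
have gi := good_iota (0%R : R * R) 0.
have mr := measurable_rect (0%R : R * R) (1 / 16) (1 / 16).
have rb : rect (0%R : R * R) (1 / 16) (1 / 16) `<=` ball (0%R : R * R) (1 / 8).
  move=> y /rectP[/= /andP[? ?] /andP[? ?]].
  by split; rewrite /ball/= sub0r normrN ltr_norml; apply/andP; split; lra.
exists ((pr g \o (fun y => iota y + lat R 0)%R) @` rect 0%R (1 / 16) (1 / 16)); split.
  exact: (good_transversal_borel gi mr rb).
rewrite [X in X != _](lebT_chart gi mr rb) (_ : _ @` _ = rect 0%R (1 / 16) (1 / 16)).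
  by rewrite rect_lam2 ?eqe//; lra.
by rewrite lat0; apply/seteqP; split => y;
  [move=> [z hz <-]|move=> hy; exists y => //]; rewrite /= addr0 Y_iota.
Qed.

Lemma lebT_finite (S K : set (torus g)) : Defs.transversal S -> compact K -> K `<=` S ->
  transverse_lebesgue K < +oo.
Proof.
move=> tS cK KS.
have hU p : exists U : set (torus g), S p -> [/\ open U, U p &
    exists E : set borelT, [/\ measurable E, lebT E < +oo & S `&` U `<=` E]].
  have [Sp|nSp] := pselect (S p); last by exists set0.
  have [V [phi [gV [oV _ _ _ hV] _ hp]]] := chart_good tS Sp.
  have [U oU e] := hV _ oV (fun _ => id); exists U => _; split => //.
    by move: hp; rewrite e => -[].
  exists ((pr g \o phi) @` V); split; last by rewrite e.
    by apply: (good_borel gV) => //; apply: plane_open_measurable; exact: good_open gV.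
  exact: chart_finite.
pose U p := projT1 (cid (hU p)).
have UP p : S p -> [/\ open (U p), U p p &
    exists E : set borelT, [/\ measurable E, lebT E < +oo & S `&` U p `<=` E]].
  by rewrite /U; case: cid.
move: cK; rewrite compact_cover => /(_ _ K U)[p Kp|p Kp|D DK KD].
- by have [] := UP p (KS p Kp).
- by exists p => //; have [] := UP p (KS p Kp).
rewrite /cover bigcup_fset big_seq in KD; set C := (X in K `<=` X) in KD.
(* To have a Borel bound of finite measure is stable under unions, so it passes from the chart
   domains to a finite cover. *)
suff [E [_ Eoo KE]] : exists E : set borelT, [/\ measurable E, lebT E < +oo & S `&` C `<=` E].
  by apply: le_lt_trans Eoo; apply: lebT_le => p Kp; apply: KE; split; [exact: KS|exact: KD].
apply: (big_ind (fun A => exists E : set borelT, [/\ measurable E, lebT E < +oo & S `&` A `<=` E])).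
- by exists set0; split => [||p []//]; [exact: measurable0|rewrite measure0 ltry].
- move=> A B [E [mE Eoo AE]] [F [mF Foo BF]]; exists (E `|` F); split.
  + exact: measurableU.
  + by apply: le_lt_trans (measureU2 _ mE mF) _; rewrite lte_add_pinfty.
  + by rewrite setIUr; exact: setUSS.
- by move=> p /DK; rewrite inE => /KS Sp; have [] := UP p Sp.
Qed.

(** [null_in] concerns parameters and [lebT] the y-plane; [null_preserving] carries null sets from
    the first to the second, chart by chart. *)
Lemma lebT_ac (S A : set (torus g)) : Defs.transversal S -> A `<=` S -> transversal_borel A ->
  null_in S A -> transverse_lebesgue A = 0.
Proof.
move=> tS AS [bA hA] nA.
have [V [phi [B [mB hB AE tB]]]] :=
  @chart_partition R (@null_preserving R) S A (fun p Sp => chart_good tS Sp) AS bA.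
have mp n : measurable ((pr g \o phi n) @` B n : set borelT).
  have [->|[gV _ _ BV]] := hB n; first by rewrite image_set0.
  exact: (good_borel gV (mB n) BV).
rewrite /transverse_lebesgue AE measure_semi_bigcup//; last exact: bigcup_measurable.
apply: eseries0 => n _ _; have [->|[gV pV nV BV]] := hB n; first by rewrite image_set0 measure0.
rewrite [LHS](lebT_chart gV (mB n) BV); apply: nV => //.
have [N [mN N0 hN]] := nA _ _ pV.
apply/eqP; rewrite eq_le measure_ge0 andbT -N0; apply: le_measure; rewrite ?inE//.
move=> q Bq; apply: hN; split; first exact: BV.
by rewrite /= AE; exists n => //; exists q.
Qed.

(** Pieces of [A] and their images under [H 1] have lifts over the same parameters, and [lebT_image]
    measures both by the same map, [Y] after the chart of [S]. *)
Lemma lebT_invariant (S A : set (torus g)) (H : R -> torus g -> torus g) :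
  Defs.transversal S -> leafwise_isotopy S H -> A `<=` S -> transversal_borel A ->
  transverse_lebesgue (H 1%R @` A) = transverse_lebesgue A.
Proof.
move=> tS [_ _ embH leafH] AS [bA _].
have s01 : (0 <= (1 : R) <= 1)%R by rewrite ler01 lexx.
have [[injH liftH] tH] := embH 1%R s01.
pose Q V (phi : R * R -> 'rV[R]_4) := exists phi', parametrization (H 1%R @` S) V phi' /\
  forall q, V q -> pr g (phi' q) = H 1%R (pr g (phi q)).
have hS p : S p -> exists V phi, [/\ good V phi, parametrization S V phi, Q V phi &
    ((pr g \o phi) @` V) p].
  move=> Sp; have [V [phi [gV pV _ [q Vq e]]]] := chart_good tS Sp.
  have [V' [phi' [V'V V'q pV' h]]] := liftH _ _ _ pV Vq.
  have oV' : open V' by case: pV'.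
  exists V', phi; split.
  - exact: good_sub gV.
  - exact: param_sub pV.
  - by exists phi'.
  - by exists q.
have [V [phi [B [mB hB AE tB]]]] := @chart_partition R Q S A hS AS bA.
have subA n : (pr g \o phi n) @` B n `<=` A by move=> p hp; rewrite AE; exists n.
have mp n : measurable ((pr g \o phi n) @` B n : set borelT).
  have [->|[gV _ _ BV]] := hB n; first by rewrite image_set0.
  exact: (good_borel gV (mB n) BV).
have [mHp Hp] : (forall n, measurable (H 1%R @` ((pr g \o phi n) @` B n) : set borelT)) /\
    (forall n, lebT (H 1%R @` ((pr g \o phi n) @` B n)) = lebT ((pr g \o phi n) @` B n)).
  suff h n : measurable (H 1%R @` ((pr g \o phi n) @` B n) : set borelT) /\
      lebT (H 1%R @` ((pr g \o phi n) @` B n)) = lebT ((pr g \o phi n) @` B n).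
    by split => n; have [] := h n.
  have [->|[gV pV [phi' [pV' h]] BV]] := hB n; first by rewrite !image_set0.
  have [oV' sV' _ iV' _] := pV'.
  have cphi' q : V n q -> {for q, continuous phi'} by exact: smooth_on_continuous sV'.
  have -> : H 1%R @` ((pr g \o phi n) @` B n) = (pr g \o phi') @` B n.
    apply/seteqP; split => p.
      by move=> [_ [q Bq <-] <-]; exists q => //=; rewrite h//; exact: BV.
    move=> [q Bq <-]; exists (pr g (phi n q)); first by exists q.
    by rewrite -h//; exact: BV.
  split; first exact: (borel_pr_image oV' cphi' iV' (mB n) BV).
  rewrite (lebT_chart gV (mB n) BV).
  apply: (@lebT_image R (V n) phi' (Y \o phi n)) => //.
  - move=> q Vq; apply: continuous_comp; first exact: good_continuous gV Vq.
    exact: Y_continuous.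
  - by move=> q q'; rewrite !inE; exact: good_Y_inj gV.
  (* As [H 1] preserves leaves, the two lifts have the same y-coordinates up to a lattice vector
     depending on [q]. *)
  - move=> q Bq; have Vq := BV _ Bq.
    pose L := pr g @` [set v : 'rV[R]_4 | forall j, v 0%R (y_coord j) = phi n q 0%R (y_coord j)].
    have leafL : leaf L by exists (fun j => phi n q 0%R (y_coord j)).
    have Lq : L (pr g (phi n q)) by exists (phi n q).
    have Sq : S (pr g (phi n q)) by apply/AS/(@subA n); exists q.
    have [v hv] := leafH _ 1%R _ leafL s01 Sq Lq.
    rewrite -h// => /esym/pr_eq[m ->]; exists m; rewrite YD; congr (_ + _)%R.
    apply/eqP; rewrite -subr_eq0 -YB; apply/eqP/horizontalP => j.
    by rewrite !mxE hv subrr.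
rewrite /transverse_lebesgue AE image_bigcup !measure_semi_bigcup//.
- by apply: eq_eseriesr => n _; exact: Hp.
- exact: bigcup_measurable.
- move=> i j _ _ [p [[y Fy <-] [z Fz e]]]; apply: tB => //; exists y; split => //.
  have Sz : z \in S by rewrite inE; apply/AS/(@subA j).
  have Sy : y \in S by rewrite inE; apply/AS/(@subA i).
  by rewrite -(injH _ _ Sz Sy e).
- by apply: bigcup_measurable => n _; exact: mHp.
Qed.

Lemma transverse_lebesgueP : transverse_measure (@transverse_lebesgue R).
Proof.
split; [exact: lebT_nonzero|exact: lebT_finite|exact: lebT_ac|exact: lebT_invariant].
Qed.

Local Notation T := (range (pr g \o @iota R)).

(** The factor [s], possibly infinite, is fixed before [nu]; hence any two transverse measures are
    proportional. *)
Lemma transverse_measure_lebesgue (A : set (transverse_sets g)) : measurable A ->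
  exists2 s : \bar R, 0 <= s & forall nu : {measure set (transverse_sets g) -> \bar R},
    transverse_measure nu -> nu A = nu T * s.
Proof.
move=> mA; have [bA [S tS AS]] := mA.
have [V [phi [B [mB hB AE tB]]]] :=
  @chart_partition R (@null_preserving R) S A (fun p Sp => chart_good tS Sp) AS bA.
exists (\sum_(n <oo) lam2 R ((Y \o phi n) @` B n)) => [|nu tnu].
  by apply: nneseries_ge0 => n _ _; exact: measure_ge0.
have finT : nu T \is a fin_num by rewrite ge0_fin_numE//; exact: T_fin tnu.
rewrite -[nu T]fineK// -nneseriesZl => [|n _]; last exact: measure_ge0.
rewrite fineK// {1}AE measure_semi_bigcup -?AE//.
  apply: eq_eseriesr => n _; have [->|[gV _ _ BV]] := hB n.
    by rewrite !image_set0 !measure0 mule0.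
  exact: (nu_chart tnu gV (mB n) BV).
move=> n; have [->|[gV _ _ BV]] := hB n; first by rewrite image_set0.
exact: (good_transversal_borel gV (mB n) BV).
Qed.

Lemma example_uniquely_ergodic : uniquely_ergodic g.
Proof.
exists (@transverse_lebesgue R); first exact: transverse_lebesgueP.
have H (nu : {measure set (transverse_sets g) -> \bar R}) : transverse_measure nu ->
    exists2 r : R, r != 0%R & nu T = r%:E.
  move=> tnu; exists (fine (nu T)); last first.
    by rewrite fineK// ge0_fin_numE//; exact: T_fin tnu.
  (* If [nu T] were 0, [nu] would vanish on every measurable set. *)
  have [A [mA]] := tm_nonzero tnu; apply: contra => /eqP n0.
  have [s _ hs] := transverse_measure_lebesgue mA.
  rewrite (hs _ tnu) -[nu T]fineK ?n0 ?mul0e//.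
  by rewrite ge0_fin_numE//; exact: T_fin tnu.
move=> nu tnu; have [r r0 hr] := H _ tnu; have [m m0 hm] := H _ transverse_lebesgueP.
exists (r / m)%R => [|A mA]; first by rewrite mulf_neq0// invr_eq0.
have [s _ hs] := transverse_measure_lebesgue mA.
rewrite (hs _ tnu) (hs _ transverse_lebesgueP) hr hm muleA -EFinM; congr (_ * _).
by rewrite mulfVK.
Qed.

End unique_ergodicity.

(** * Divergence of the geodesic flow *)

Section divergence.
Variable R : realType.
Implicit Types (v w : 'rV[R]_4) (m : 'M[R]_4).

(** The Euclidean norm, which U(2) preserves; the norm of the library on matrices is the sup
    norm. *)
Definition sqnorm v : R := \sum_j v 0 j ^+ 2.

Lemma normr_sqr_le (x y : R) : 0 <= y -> x ^+ 2 <= y ^+ 2 -> `|x| <= y.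
Proof. by move=> y0 h; rewrite -(ler_pXn2r (n := 2))// ?nnegrE// real_normK ?num_real. Qed.

Lemma norm_le_sqnorm v : `|v| ^+ 2 <= sqnorm v.
Proof.
have s0 : 0 <= sqnorm v by apply: sumr_ge0 => j _; exact: sqr_ge0.
rewrite -[leRHS]sqr_sqrtr//; apply: lerXn2r; rewrite ?nnegrE ?sqrtr_ge0//.
apply: norm_le_crd => [|k _]; first exact: sqrtr_ge0.
apply: normr_sqr_le; rewrite ?sqrtr_ge0// sqr_sqrtr//.
by rewrite /sqnorm (bigD1 (inord k))//= lerDl; apply: sumr_ge0 => j _; exact: sqr_ge0.
Qed.

Lemma norm_mulmx_le v m : `|v *m m| <= 4 * (`|v| * `|m|).
Proof.
have h (A : 'M[R]_4) i j : `|A i j| <= `|A|.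
  by rewrite {2}/Num.Def.normr/= mx_normrE; apply/bigmax_geP; right; exists (i, j).
have h' j : `|v 0 j| <= `|v| by rewrite -(inord_val j); exact: crd_le_norm.
apply: norm_le_crd => [|k _]; first by rewrite !mulr_ge0.
rewrite /crd mxE; apply: le_trans (ler_norm_sum _ _ _) _.
apply: (@le_trans _ _ (\sum_(j < 4) `|v| * `|m|)); last by rewrite sumr_const card_ord mulr_natl.
by apply: ler_sum => j _; rewrite normrM ler_pM.
Qed.

Lemma sqnorm_perturb (x d : 'rV[R]_4) (e : R) : 0 <= e -> `|d| <= e * `|x| ->
  (1 - 8 * e) * sqnorm x <= sqnorm (x + d).
Proof.
move=> e0 de; have n0 := normr_ge0 x.
apply: (@le_trans _ _ (sqnorm x - 8 * e * `|x| ^+ 2)).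
  rewrite mulrBl mul1r lerD2l lerN2; apply: ler_wpM2l; first by lra.
  exact: norm_le_sqnorm.
(* In each of the four coordinates the cross term costs at most [2 * e] times the squared sup norm
   of [x]. *)
have -> : 8 * e * `|x| ^+ 2 = \sum_(j < 4) 2 * e * `|x| ^+ 2.
  by rewrite sumr_const card_ord -mulr_natl; ring.
rewrite /sqnorm -sumrB; apply: ler_sum => j _; rewrite mxE -(inord_val j).
have hx := crd_le_norm j x; have hd := le_trans (crd_le_norm j d) de.
rewrite /crd in hx hd; move: (x 0 _) (d 0 _) hx hd => a b ha hb.
have : `|a * b| <= `|x| * (e * `|x|) by rewrite normrM ler_pM.
by rewrite ler_norml => /andP[h _]; have := sqr_ge0 b; nra.
Qed.

Lemma to_C2_norm v : (to_C2 v *m (to_C2 v ^t*)%sesqui) 0 0 = (sqnorm v)%:C%C.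
Proof.
rewrite mxE /sqnorm !big_ord_recl !big_ord0 !mxE /=.
have hc (x y : R) : ((x +i* y) * (x +i* y)^* = (x ^+ 2 + y ^+ 2)%:C)%C.
  by rewrite -sqr_normc normc_def /= -rmorphXn/= sqr_sqrtr// addr_ge0 ?sqr_ge0.
rewrite !hc !addr0 -rmorphD/=; congr (_%:C)%C.
rewrite -!addrA; congr (_ + (_ + (_ + _))); congr (v 0 _ ^+ 2).
all: by apply: val_inj; rewrite /= inordK.
Qed.

Lemma U2_norm k v : U2 k -> sqnorm (v *m k) = sqnorm v.
Proof.
move=> [u /unitarymxP uu hk]; apply: (@complexI R); rewrite -!to_C2_norm hk.
by rewrite trmx_mul map_mxM mulmxA -(mulmxA _ u) uu mulmx1.
Qed.

(* The square of the systole of the lattice spanned by the rows of [m] is at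
   least [d]. *)
Definition sys_ge (d : R) m : Prop :=
  forall n : 'rV[int]_4, n != 0 -> d <= sqnorm (map_mx intr n *m m).

Lemma SL4Z_inv (c : 'M[R]_4) (n : 'rV[int]_4) : SL4Z c -> n != 0 ->
  exists2 n' : 'rV[int]_4, n' != 0 & map_mx intr n *m c = map_mx intr n'.
Proof.
move=> [z dz ->] n0; exists (n *m z); last by rewrite map_mxM.
have zu : z \in unitmx by rewrite unitmxE dz unitr1.
by apply: contra n0 => /eqP h; rewrite -(mulmxK zu n) h mul0mx.
Qed.

Lemma sys_ge_kah (d : R) (g h : SL4 R) : kah_eq g h -> sys_ge d (set_val g) -> sys_ge d (set_val h).
Proof.
move=> /asboolP[c [k [cZ ku ->]]] sg n n0; have [n' n'0 e] := SL4Z_inv cZ n0.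
by rewrite !mulmxA e U2_norm//; exact: sg.
Qed.

Lemma norm_intr_ge1 (n : 'rV[int]_4) : n != 0 -> 1 <= `|map_mx intr n : 'rV[R]_4|.
Proof.
move=> n0; rewrite leNgt; apply: contra n0 => h; apply/eqP/rowP => j.
rewrite mxE; apply: (@intr_lt1 R); apply: le_lt_trans h.
by have := crd_le_norm j (map_mx intr n : 'rV[R]_4); rewrite /crd mxE inord_val.
Qed.

Lemma SL4_unit (g : SL4 R) : set_val g \in unitmx.
Proof. by rewrite unitmxE SL4_det unitr1. Qed.

(** A nonzero integer vector has sup norm at least 1 and is recovered from its lattice vector by the
    inverse matrix. *)
Lemma sys_ge_exists (g : SL4 R) : exists2 d : R, 0 < d & sys_ge d (set_val g).
Proof.
pose C : R := 4 * (1 + `|invmx (set_val g)|).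
have C0 : 0 < C by rewrite mulr_gt0// ltr_wpDr.
exists (C^-1 ^+ 2) => [|n n0]; first by rewrite exprn_gt0// invr_gt0.
apply: le_trans (norm_le_sqnorm _); apply: lerXn2r; rewrite ?nnegrE//.
  by rewrite invr_ge0 ltW.
rewrite -[C^-1]mul1r ler_pdivrMr//.
apply: le_trans (norm_intr_ge1 n0) _; rewrite -{1}(mulmxK (SL4_unit g) (map_mx _ n)).
apply: le_trans (norm_mulmx_le _ _) _; rewrite /C mulrCA ler_wpM2l// ler_wpM2l//.
by rewrite lerDr.
Qed.

Definition wide (e : R) : set (SL4 R) :=
  [set g | exists2 d, e < d & sys_ge d (set_val g)].

(** Changing [g] to [h] moves a lattice vector [x] by [x] times the inverse of [g] times [h - g]: an
    error relative to [x], hence uniform over the lattice. *)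
Lemma wide_open (e : R) : 0 < e -> open (wide e).
Proof.
move=> e0; rewrite openE => g [d ed sd].
have d0 : 0 < d := lt_trans e0 ed.
pose M := `|invmx (set_val g)|; have M0 : 0 <= M by exact: normr_ge0.
(* Chosen so that [(1 - 8 * r) * d] is the midpoint of [d] and [e]. *)
pose r := (d - e) / (16 * d).
have r0 : 0 < r by rewrite divr_gt0 ?subr_gt0// mulr_gt0.
have cv : {for g, continuous (set_val : SL4 R -> 'M[R]_4)} by exact: initial_continuous.
(* The factor 16 comes from two uses of [norm_mulmx_le]. *)
have t0 : 0 < r / (16 * (M + 1)) by rewrite divr_gt0// mulr_gt0// ltr_wpDl.
have /cvgrPdist_le/(_ _ t0) near_g := cv.
apply: filterS near_g => h hgh; exists ((d + e) / 2); first by lra.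
move=> n n0; set x := map_mx intr n *m set_val g.
have -> : map_mx intr n *m set_val h = x + x *m (invmx (set_val g) *m (set_val h - set_val g)).
  by rewrite mulmxA mulmxK ?SL4_unit// mulmxBr addrC subrK.
apply: (@le_trans _ _ ((1 - 8 * r) * sqnorm x)).
  apply: (@le_trans _ _ ((1 - 8 * r) * d)).
    have -> : 8 * r = (d - e) / d / 2 by rewrite /r; field; lra.
    have -> : (1 - (d - e) / d / 2) * d = (d + e) / 2 by field; lra.
    by [].
  apply: ler_wpM2l; last exact: sd.
  have -> : 8 * r = (1 - e / d) / 2 by rewrite /r; field; lra.
  have : 0 < e / d by rewrite divr_gt0.
  lra.
apply: sqnorm_perturb; first exact: ltW.
rewrite mulmxA; apply: le_trans (norm_mulmx_le _ _) _.
have h1 := norm_mulmx_le x (invmx (set_val g)); rewrite -/M in h1.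
rewrite distrC in hgh.
apply: (@le_trans _ _ (4 * ((4 * (`|x| * M)) * (r / (16 * (M + 1)))))).
  by rewrite ler_wpM2l// ler_pM.
have -> : 4 * (4 * (`|x| * M) * (r / (16 * (M + 1)))) = (r * `|x|) * (M / (M + 1)) by field; lra.
rewrite -[leRHS]mulr1; apply: ler_wpM2l; first by rewrite mulr_ge0// ltW.
by rewrite ler_pdivrMr ?mul1r ?lerDl ?ltr_wpDl.
Qed.

Definition wide_classes (e : R) : set (Kah R) :=
  [set p | forall g, kah_point g = p -> wide e g].

Lemma kah_pointP (g h : SL4 R) : kah_point g = kah_point h -> kah_eq g h.
Proof. by move=> e; apply/eqmodP. Qed.

Lemma wide_kah (e : R) g : wide e g -> wide_classes e (kah_point g).
Proof.
move=> [d ed sd] h /kah_pointP; rewrite kah_eq_sym => gh.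
by exists d => //; exact: sys_ge_kah gh sd.
Qed.

Lemma wide_classes_open (e : R) : 0 < e -> open (wide_classes e).
Proof.
move=> e0; suff : open ((@kah_point R) @^-1` wide_classes e) by [].
rewrite (_ : _ @^-1` _ = wide e); first exact: wide_open.
by apply/seteqP; split => g; [exact|exact: wide_kah].
Qed.

Lemma wide_classes_le (e e' : R) : e <= e' -> wide_classes e' `<=` wide_classes e.
Proof.
by move=> ee' p h g /h[d ed sd]; exists d => //; exact: le_lt_trans ed.
Qed.

(** The open sets [wide_classes e] increase to the whole space as [e] decreases to 0, so compactness
    yields a single [e]. *)
Lemma compact_wide (K : set (Kah R)) : compact K -> exists2 e : R, 0 < e & K `<=` wide_classes e.
Proof.
move=> /compact_near_coveringP cK.
have : \forall e \near 0^'+, K `<=` wide_classes e.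
  apply: cK => p _; have [g gp] : exists g, kah_point g = p.
    by exists (repr (p : {eq_quot (@kah_eq R)}%qT)); rewrite /kah_point reprK.
  have [d d0 sd] := sys_ge_exists g.
  have d20 : 0 < d / 2 by rewrite divr_gt0.
  have wp : wide_classes (d / 2) p by rewrite -gp; apply: wide_kah; exists d => //; lra.
  exists (wide_classes (d / 2), [set e | e <= d / 2]) => /=.
    split; first by exact: (open_nbhs_nbhs (conj (wide_classes_open d20) wp)).
    exact: nbhs_right_le.
  by move=> [q e] [/= hq he]; exact: wide_classes_le hq.
move=> h; have h0 : \forall e \near (0 : R)^'+, 0 < e by exact: nbhs_right_gt.
by have [e [Ke e0]] := @filter_ex _ _ (at_right_proper_filter (0 : R)) _ (filterI h h0); exists e.
Qed.

Lemma example_flow_short (t : R) :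
  sqnorm (map_mx intr (delta_mx 0 0 : 'rV[int]_4) *m (set_val (example R) *m a_flow t)) =
  expR (- t) ^+ 2.
Proof.
have -> : map_mx intr (delta_mx 0 0 : 'rV[int]_4) *m (set_val (example R) *m a_flow t) =
    expR (- t) *: delta_mx 0 0.
  rewrite map_delta_mx mulmxA -rowE; apply/rowP => j.
  rewrite /a_flow mul_mx_diag !mxE /=.
  by case: j => [] [|[|[|[|]]]] //= h; rewrite ?mul1r ?mul0r ?mulr1 ?mulr0.
rewrite /sqnorm !big_ord_recl big_ord0 !mxE /= mulr1 !mulr0 expr0n /= !addr0.
by [].
Qed.

Lemma example_divergent : divergent (fun t : R => Ra t (example R)).
Proof.
move=> K /compact_wide[e e0 Ke].
(* Below 1 the square of [expR (- t)] is at most [expR (- t)] itself, hence below [e]. *)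
have h : \forall t \near +oo, expR (- t) < Num.min 1 e.
  have /cvgrPdist_lt/(_ (Num.min 1 e)) := @cvgr_expR R.
  rewrite lt_min ltr01 e0 => /(_ isT); apply: filterS => t.
  by rewrite sub0r normrN ger0_norm ?expR_ge0.
apply: filterS h => t; rewrite lt_min => /andP[t1 te] /Ke/(_ _ erefl)[d ed sd].
have /sd : (delta_mx 0 0 : 'rV[int]_4) != 0.
  by apply/eqP => /rowP/(_ 0); rewrite !mxE.
rewrite example_flow_short leNgt => /negP; apply; apply: lt_trans ed; apply: le_lt_trans te.
by rewrite expr2 -[leRHS]mulr1 ler_wpM2l ?expR_ge0// ltW.
Qed.

End divergence.

Theorem proposition4p4 (R : realType) :
  uniquely_ergodic (example R) /\ divergent (fun t : R => Ra t (example R)).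
Proof. by split; [exact: example_uniquely_ergodic|exact: example_divergent]. Qed.
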